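(* Let $n\ge 2$, $p>1$, $r>0$ and let $\alpha,\beta,\gamma\in\mathbb R$ satisfy $$\frac1r-\frac{\gamma}{n}>0,\qquad \frac1p-\frac{\alpha}{n}>0,\qquad 1-\frac{\beta}{n}>0,\qquad \gamma=\frac{1+\alpha}{r}+\frac{p-1}{pr}\beta .$$ Let $\partial_r=\frac{x}{|x|}\cdot\nabla$ be the radial derivative on $\mathbb R^n$. Then the following inequalities hold for every $f\in C_0^\infty(\mathbb R^n)$: (a) if $r>1$, then $$\int_{\mathbb R^n}\frac{|f|^r}{|x|^{\gamma r}}\,dx\le \frac{r}{n-\gamma r}\left(\int_{\mathbb R^n}\frac{|\partial_r f|^p}{|x|^{\alpha p}}\,dx\right)^{\frac1p}\left(\int_{\mathbb R^n}\frac{|f|^{\frac{p(r-1)}{p-1}}}{|x|^{\beta}}\,dx\right)^{\frac{p-1}{p}};$$ (b) if $r\in(0,1)$, then $$\int_{\mathbb R^n}\frac{|f|^r}{|x|^{\gamma r}}\,dx\le \frac{r}{n-\gamma r}\left(\int_{\mathbb R^n}\frac{|\partial_r f|^p}{|x|^{\alpha p}}\,dx\right)^{\frac1p}\left(\int_{\operatorname{supp} f}\frac{|f|^{\frac{p(r-1)}{p-1}}}{|x|^{\beta}}\,dx\right)^{\frac{p-1}{p}}.$$ Moreover, the constant $\frac{r}{n-\gamma r}$ is sharp if one of the following conditions (i)--(v) holds, and in each case a family of extremals is as indicated (with $\omega=x/|x|$ and $a_+=\max\{a,0\}$): (i) $1<p<r$ and $n-\beta<\left(1+\alpha-\frac{\beta}{p}\right)\frac{p(r-1)}{r-p}$;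 a family of extremals is $f(x)=c\left(\lambda(\omega)+|x|^{1+\alpha-\frac{\beta}{p}}\right)^{\frac{p-1}{p-r}}$, where $c$ is a constant and $\lambda:S^{n-1}\to(0,\infty)$ is such that $\int_{S^{n-1}}\lambda(\omega)^{\frac{p(r-1)}{p-r}+\frac{n-\beta}{1+\alpha-\beta/p}}\,d\omega<\infty$. (ii) $0<r<p$, $r\ne1$ and $1+\alpha-\frac{\beta}{p}>0$; a family of extremals is $f(x)=c\left(\lambda(\omega)-|x|^{1+\alpha-\frac{\beta}{p}}\right)_+^{\frac{p-1}{p-r}}$, where $c$ is a constant and $\lambda:S^{n-1}\to(0,\infty)$ is such that $\int_{S^{n-1}}\lambda(\omega)^{\frac{p(r-1)}{p-r}+\frac{n-\beta}{1+\alpha-\beta/p}}\,d\omega<\infty$. (iii) $0<r<p$, $r\ne1$ and $1+\alpha-\frac{\beta}{p}=0$; a family of extremals is $f(x)=c\left(\lambda(\omega)-\ln|x|\right)_+^{\frac{p-1}{p-r}}$, where $c$ is a constant and $\lambda:S^{n-1}\to\mathbb R$ is such that $\int_{S^{n-1}}e^{(n-\beta)\lambda(\omega)}\,d\omega<\infty$. (iv) $0<r<p$, $r\ne1$, $1+\alpha-\frac{\beta}{p}<0$ and $n-\beta+\left(1+\alpha-\frac{\beta}{p}\right)\frac{p(r-1)}{p-r}>0$; a family of extremals is $f(x)=c\left(|x|^{1+\alpha-\frac{\beta}{p}}-\lambda(\omega)\right)_+^{\frac{p-1}{p-r}}$, where $c$ is a constant and $\lambda:S^{n-1}\to(0,\infty)$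 is such that $\int_{S^{n-1}}\lambda(\omega)^{\frac{p(r-1)}{p-r}+\frac{n-\beta}{1+\alpha-\beta/p}}\,d\omega<\infty$. (v) $r=p$ and $1+\alpha-\frac{\beta}{p}>0$; a family of extremals is $f(x)=\lambda(\omega)e^{-c|x|^{1+\alpha-\frac{\beta}{p}}}$, where $c>0$ is a constant and $\lambda:S^{n-1}\to\mathbb R$ is such that $\int_{S^{n-1}}|\lambda(\omega)|^p\,d\omega<\infty$.
   Context: $\operatorname{supp} f$ denotes the support of $f$, and $d\omega$ is the surface measure on the unit sphere $S^{n-1}$. ''Sharp'' means that $\frac{r}{n-\gamma r}$ is the best constant in the inequality, i.e. it cannot be replaced by a smaller one. An extremal is a function for which equality holds in the inequality.
   Formalization: For 0<r<1 the right side of (b) is infinite for every nonzero f in C_0^∞, so sharpness is proved over continuous, compactly supported f that are smooth where f≠0; also for r<1 the integral over supp f is taken over {f≠0}, as equality can fail for rough λ otherwise. *)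

(* Defs.v *)
From HB Require Import structures.
From mathcomp Require Import all_boot all_order all_algebra.
From mathcomp Require Import all_classical all_reals all_analysis.
From mathcomp Require Import measurable_realfun.

Set Implicit Arguments.
Unset Strict Implicit.
Unset Printing Implicit Defensive.

Import Order.TTheory GRing.Theory Num.Theory.
Import numFieldNormedType.Exports.

Local Open Scope classical_set_scope.
Local Open Scope ring_scope.

(* The norm carried by 'rV[R]_n in the library is the sup norm. *)
Definition enorm (R : rcfType) (n : nat) (x : 'rV[R]_n) : R :=
  Num.sqrt (\sum_i x 0 i ^+ 2).

Definition dir (R : rcfType) (n : nat) (x : 'rV[R]_n) : 'rV[R]_n :=
  (enorm x)^-1 *: x.

Definition usphere (R : rcfType) (n : nat) : set 'rV[R]_n :=
  [set w | enorm w = 1].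

(* The sigma-algebra generated by the coordinates, i.e. the product (= Borel)
   sigma-algebra of R^n, as the library does for tuples. *)
Section measurable_rV.
Context (R : realType) (n : nat).

Let coords (i : 'I_n) (x : 'rV[R]_n) : R := x 0 i.

Let rV_set0 : g_sigma_preimage coords set0.
Proof. exact: sigma_algebra0. Qed.

Let rV_setC A : g_sigma_preimage coords A -> g_sigma_preimage coords (~` A).
Proof. exact: sigma_algebraC. Qed.

Let rV_bigcup (F : _^nat) : (forall i, g_sigma_preimage coords (F i)) ->
  g_sigma_preimage coords (\bigcup_i (F i)).
Proof. exact: sigma_algebra_bigcup. Qed.

HB.instance Definition _ := @isMeasurable.Build default_measure_display
  'rV[R]_n (g_sigma_preimage coords) rV_set0 rV_setC rV_bigcup.

End measurable_rV.

Lemma measurable_coord (R : realType) n (i : 'I_n) :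
  measurable_fun [set: 'rV[R]_n] (fun x : 'rV[R]_n => x 0 i).
Proof.
move=> _ Y mY; rewrite setTI; apply: sub_sigma_algebra => /=.
rewrite -bigcup_seq/=; exists i => /=; first by rewrite mem_index_enum.
by exists Y => //; rewrite setTI.
Qed.

Lemma measurable_fun_coordP d (T : measurableType d) (R : realType) n
    (f : T -> 'rV[R]_n) :
  (forall i, measurable_fun [set: T] (fun t => f t 0 i)) ->
  measurable_fun [set: T] f.
Proof.
move=> mf _ A mA; rewrite setTI.
pose G : set (set 'rV[R]_n) := [set A | measurable (f @^-1` A)].
suff : measurable `<=` G by apply.
apply: smallest_sub.
  split; rewrite /G/=.
  - by rewrite preimage_set0; exact: measurable0.
  - by move=> B mB; rewrite setTD preimage_setC; exact: measurableC.
  - by move=> F mF; rewrite preimage_bigcup; exact: bigcup_measurable.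
rewrite -bigcup_seq => B [i _ [C mC <-]]; rewrite /G/= setTI.
by have := mf i measurableT _ mC; rewrite setTI.
Qed.


Definition cons_rV (R : realType) n (u : R * 'rV[R]_n) : 'rV[R]_n.+1 :=
  \row_i oapp (u.2 0) u.1 (unlift ord0 i).

Lemma cons_rV0 (R : realType) n (u : R * 'rV[R]_n) : cons_rV u 0 ord0 = u.1.
Proof. by rewrite mxE unlift_none. Qed.

Lemma cons_rVS (R : realType) n (u : R * 'rV[R]_n) (i : 'I_n) :
  cons_rV u 0 (lift ord0 i) = u.2 0 i.
Proof. by rewrite mxE liftK. Qed.

Lemma cons_rVK (R : realType) n (x : 'rV[R]_n.+1) :
  cons_rV (x 0 ord0, \row_i x 0 (lift ord0 i)) = x.
Proof.
apply/rowP => i; have [j ->|->] := unliftP ord0 i.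
  by rewrite cons_rVS mxE.
by rewrite cons_rV0.
Qed.

Lemma measurable_cons_rV (R : realType) n :
  measurable_fun [set: R * 'rV[R]_n] (@cons_rV R n).
Proof.
apply: measurable_fun_coordP => i; have [j ->|->] := unliftP ord0 i.
  under eq_fun do rewrite cons_rVS.
  apply: (measurableT_comp (measurable_coord j)); exact: measurable_snd.
by under eq_fun do rewrite cons_rV0; exact: measurable_fst.
Qed.

Lemma pushforward_semi_sigma_additive d d' (T1 : measurableType d)
    (T2 : measurableType d') (R : realType) (f : T1 -> T2)
    (m : {measure set T1 -> \bar R}) :
  measurable_fun [set: T1] f -> semi_sigma_additive (pushforward m f).
Proof.
move=> mf F mF tF mUF; rewrite /pushforward preimage_bigcup.
apply: measure_semi_sigma_additive.
- by move=> n; rewrite -[X in measurable X]setTI; exact: mf.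
- apply/trivIsetP => /= i j _ _ ij; rewrite -preimage_setI.
  by move/trivIsetP : tF => /(_ _ _ _ _ ij) ->//; rewrite preimage_set0.
- by rewrite -preimage_bigcup -[X in measurable X]setTI; exact: mf.
Qed.

Section lebesgue_rV_succ.
Context (R : realType) (n : nat).
Variable mu : {sigma_finite_measure set 'rV[R]_n -> \bar R}.

Definition lebesgue_rV_succ : set 'rV[R]_n.+1 -> \bar R :=
  pushforward (@lebesgue_measure R \x mu)%E (@cons_rV R n).

Let succ0 : lebesgue_rV_succ set0 = 0%E.
Proof. by rewrite /lebesgue_rV_succ/pushforward preimage_set0 measure0. Qed.

Let succ_ge0 A : (0 <= lebesgue_rV_succ A)%E.
Proof. by rewrite /lebesgue_rV_succ/pushforward; exact: measure_ge0. Qed.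

Let succ_sigma_additive : semi_sigma_additive lebesgue_rV_succ.
Proof. by apply: pushforward_semi_sigma_additive; exact: measurable_cons_rV. Qed.

HB.instance Definition _ := isMeasure.Build _ _ _ lebesgue_rV_succ
  succ0 succ_ge0 succ_sigma_additive.

Let succ_sigma_finite : sigma_finite [set: 'rV[R]_n.+1] lebesgue_rV_succ.
Proof.
pose uncons (x : 'rV[R]_n.+1) := (x 0 ord0, \row_i x 0 (lift ord0 i)).
have consK : cancel (@cons_rV R n) uncons.
  move=> [t v]; rewrite /uncons cons_rV0; congr pair.
  by apply/rowP => i; rewrite mxE cons_rVS.
have muncons : measurable_fun [set: 'rV[R]_n.+1] uncons.
  apply: measurable_fun_pair; first exact: measurable_coord.
  apply: measurable_fun_coordP => i.
  by under eq_fun do rewrite mxE; exact: measurable_coord.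
have /sigma_finiteP[F [TF ndF Foo]] := sigma_finiteT (@lebesgue_measure R).
have /sigma_finiteP[G [TG ndG Goo]] := sigma_finiteT mu.
exists (fun k => uncons @^-1` (F k `*` G k)).
  rewrite -preimage_bigcup; apply/esym/seteqP; split=> // x _ /=.
  have : (\bigcup_k F k) (uncons x).1 by rewrite -TF.
  have : (\bigcup_k G k) (uncons x).2 by rewrite -TG.
  move=> [j _ Gj] [i _ Fi]; exists (maxn i j) => //; split.
  - by move: Fi; exact/subsetPset/ndF/leq_maxl.
  - by move: Gj; exact/subsetPset/ndG/leq_maxr.
move=> k; have [mF Fk] := Foo k; have [mG Gk] := Goo k; split.
  by rewrite -[X in measurable X]setTI; apply: muncons => //; exact: measurableX.
rewrite /lebesgue_rV_succ /pushforward -comp_preimage.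
rewrite (_ : _ \o _ = id); last by apply/funext => u /=; exact: consK.
rewrite preimage_id.
rewrite [ltLHS](product_measure1E (@lebesgue_measure R) mu)//.
by rewrite lte_mul_pinfty// ge0_fin_numE.
Qed.

HB.instance Definition _ := Measure_isSigmaFinite.Build _ _ _ lebesgue_rV_succ
  succ_sigma_finite.

End lebesgue_rV_succ.

Fixpoint lebesgue_rV (R : realType) n :
    {sigma_finite_measure set 'rV[R]_n -> \bar R} :=
  match n with
  | 0 => \d_(0 : 'rV[R]_0)
  | n.+1 => lebesgue_rV_succ (lebesgue_rV R n)
  end.

Lemma measurable_enorm (R : realType) n :
  measurable_fun [set: 'rV[R]_n] (@enorm R n).
Proof.
apply: measurableT_comp.
  by apply: continuous_measurable_fun; exact: sqrt_continuous.
apply: measurable_sum => i.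
by apply: measurable_funX; exact: measurable_coord.
Qed.

Lemma measurable_dir (R : realType) n :
  measurable_fun [set: 'rV[R]_n] (@dir R n).
Proof.
apply: measurable_fun_coordP => i; under eq_fun do rewrite mxE.
apply: measurable_funM; last exact: measurable_coord.
under eq_fun do rewrite -powR_inv1 ?sqrtr_ge0//.
by apply: (measurableT_comp (measurable_powR _)); exact: measurable_enorm.
Qed.

Section surface_measure.
Context (R : realType) (n : nat).

Definition cone (A : set 'rV[R]_n) : set 'rV[R]_n :=
  [set x | 0 < enorm x <= 1 /\ A (dir x)].

(* The surface measure of the unit sphere, as a measure on R^n carried by the
   sphere: n times the volume of the cone over A, i.e. the measure d(omega) for
   which dx = rho^(n-1) d(rho) d(omega) in polar coordinates. *)
Definition surface_measure (A : set 'rV[R]_n) : \bar R :=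
  (n%:R%:E * lebesgue_rV R n (cone A))%E.

Let ball : set 'rV[R]_n := [set x | 0 < enorm x <= 1].

Let mball : measurable ball.
Proof.
rewrite (_ : ball = @enorm R n @^-1` `]0, 1]%classic).
  by rewrite -[X in measurable X]setTI; exact: measurable_enorm.
by apply/seteqP; split=> x; rewrite /ball/= in_itv.
Qed.

Let m : {measure set 'rV[R]_n -> \bar R} :=
  mscale (NngNum (ler0n R n)) (mrestr (lebesgue_rV R n) mball).

Let surfaceE : surface_measure = pushforward m (@dir R n).
Proof.
apply/funext => A; rewrite /pushforward/m/mscale/mrestr/surface_measure/=.
congr (_ * lebesgue_rV _ _ _)%E.
by apply/seteqP; split=> x; rewrite /ball/= => -[].
Qed.

Let surface0 : surface_measure set0 = 0%E.
Proof. by rewrite surfaceE /pushforward preimage_set0 measure0. Qed.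

Let surface_ge0 A : (0 <= surface_measure A)%E.
Proof. by rewrite surfaceE /pushforward; exact: measure_ge0. Qed.

Let surface_sigma_additive : semi_sigma_additive surface_measure.
Proof.
rewrite surfaceE; apply: pushforward_semi_sigma_additive.
exact: measurable_dir.
Qed.

HB.instance Definition _ := isMeasure.Build _ _ _ surface_measure
  surface0 surface_ge0 surface_sigma_additive.

End surface_measure.

Section smooth_functions.
Context (R : realType) (n : nat).
Implicit Types (f : 'rV[R]_n -> R) (U : set 'rV[R]_n).

Definition supp f : set 'rV[R]_n := closure [set x | f x != 0].

Definition partial (i : 'I_n) f : 'rV[R]_n -> R :=
  fun x => 'D_(delta_mx 0 i) f x.

Definition partials (s : seq 'I_n) f : 'rV[R]_n -> R := foldr partial f s.

Definition smooth_on U f : Prop :=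
  forall (s : seq 'I_n) x, U x ->
    {for x, continuous (partials s f)} /\
    forall i, derivable (partials s f) x (delta_mx 0 i).

Definition test_fun f : Prop := smooth_on setT f /\ compact (supp f).

(* For r < 1 the exponent p (r - 1) / (p - 1) is negative, and a nonzero test
   function makes the right-hand side infinite, because it vanishes to infinite
   order at the far end of its support on each ray that meets [f != 0]. The
   inequality for r < 1, and the optimality of its constant, have content on
   this larger class only. *)
Definition weak_test_fun f : Prop :=
  [/\ continuous f, compact (supp f) & smooth_on [set x | f x != 0] f].

(* The derivative in the direction x / |x|; for f differentiable at x this is
   (x / |x|) . grad f, but it makes sense for f smooth only along rays. *)
Definition radial_derive f (x : 'rV[R]_n) : R := 'D_(dir x) f x.

End smooth_functions.

Section ckn.
Context (R : realType) (n : nat).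
Variables (p r alpha beta gamma : R).
Implicit Types (f : 'rV[R]_n -> R) (D : set 'rV[R]_n) (C : R).

Definition ckn_lhs f : \bar R :=
  (\int[lebesgue_rV R n]_x (`|f x| `^ r / enorm x `^ (gamma * r))%:E)%E.

Definition ckn_grad f : \bar R :=
  (\int[lebesgue_rV R n]_x
     (`|radial_derive f x| `^ p / enorm x `^ (alpha * p))%:E)%E.

(* As 0 `^ a = 0 for a < 0, zeros of f in D do not contribute when r < 1. *)
Definition ckn_pot D f : \bar R :=
  (\int[lebesgue_rV R n]_(x in D)
     (`|f x| `^ (p * (r - 1) / (p - 1)) / enorm x `^ beta)%:E)%E.

Definition ckn_rhs D C f : \bar R :=
  (C%:E * (ckn_grad f `^ p^-1 * ckn_pot D f `^ ((p - 1) / p)))%E.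

Definition ckn_ineq D C f : Prop := (ckn_lhs f <= ckn_rhs D C f)%E.

Definition ckn_domain f : set 'rV[R]_n := if r < 1 then supp f else setT.

Definition ckn_class f : Prop :=
  if r < 1 then weak_test_fun f else test_fun f.

Definition ckn_best_constant C : Prop :=
  (forall f, ckn_class f -> ckn_ineq (ckn_domain f) C f) /\
  (forall C', (forall f, ckn_class f -> ckn_ineq (ckn_domain f) C' f) ->
    C <= C').

Definition ckn_extremal C f : Prop :=
  [/\ {ae lebesgue_rV R n, forall x, derivable f x (dir x)},
      (ckn_lhs f < +oo)%E & ckn_lhs f = ckn_rhs (ckn_domain f) C f].

End ckn.

(* Main.v *)
(* On each ray the inequality is a one-dimensional Hardy inequality. With
   m = n - gamma r > 0, integration by parts gives
     m int |f|^r t^(m-1) dt <= r int |f|^(r-1) |d_r f| t^m dt,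
   and integrating over the sphere (polar coordinates) and applying Hoelder
   with exponents p and p/(p-1) yields the constant r/m. The nonsmoothness at
   the zeros of f is removed by composing |f|^r with a smooth ramp that vanishes
   near 0.

   Equality holds when the boundary terms vanish and, on every ray,
     |d_r f| = a |x|^(s-1) |f|^((r-1)/(p-1)),  s = 1 + alpha - beta/p,
   with the same a on all rays; the five families solve this separable ODE.

   For sharpness take the radial extremal f = F(|x|) and compose F with smooth
   1-Lipschitz cutoffs N_j that are constant above M_j and, for r > 1, vanish
   near 0. The weighted norm of the derivative can only decrease, the left side
   converges by monotone convergence, and the potential term is bounded by its
   value at f, up to a factor tending to 1 and a term tending to 0. *)

Require Import Defs.
From HB Require Import structures.
From mathcomp Require Import all_boot all_order all_algebra.
From mathcomp Require Import all_classical all_reals all_analysis.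
From mathcomp Require Import measurable_realfun ring lra zify.

Import Order.TTheory GRing.Theory Num.Theory.
Import numFieldNormedType.Exports.

Local Open Scope classical_set_scope.
Local Open Scope ring_scope.

Set Implicit Arguments.
Unset Strict Implicit.
Unset Printing Implicit Defensive.

(** Three obstacles shape the proof. The radial derivative is never shown to be measurable: a test
    function may be smooth only off its zeros, and the [lambda] of an extremal is merely measurable.
    Integrals containing it are therefore compared, by monotonicity alone, with those of explicit
    measurable functions. The surface measure is defined by volumes of cones, so polar coordinates
    are derived from the scaling of Lebesgue measure under dilations. The extremals are not test
    functions, so their equality is not read off the inequality: the ODE makes the gradient
    integrand [a ^ p] times the potential integrand, integration by parts makes the left side
    [r / m * a] times the potential integral, and Hoelder is then an identity between multiples of
    one integral.

    With sigma = (r-1)/(p-1), the exponent theta = (p-1)/(p-r) satisfies theta * sigma = theta - 1,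
    so q^theta solves the ODE whenever q' is a multiple of t^(s-1). In (i), (ii) and (iv) the
    resulting ray integral is at most a constant times lambda^(theta r + m/s), and theta r + m/s is
    the exponent of the integrability condition. *)

(** * Lebesgue measure and cones in R^n *)

(* The library's measure structure on [pushforward m f] is not found by
   unification, as its measurability argument does not occur in the term. *)
Section image_measure.
Context d d' (T1 : measurableType d) (T2 : measurableType d') (R : realType).
Variables (m : {measure set T1 -> \bar R}) (f : T1 -> T2).
Hypothesis mf : measurable_fun [set: T1] f.

Definition image_measure of measurable_fun [set: T1] f : set T2 -> \bar R :=
  pushforward m f.

Let image0 : image_measure mf set0 = 0%E.
Proof. by rewrite /image_measure /pushforward preimage_set0 measure0. Qed.

Let image_ge0 A : (0 <= image_measure mf A)%E.
Proof. exact: measure_ge0. Qed.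

Let image_sigma_additive : semi_sigma_additive (image_measure mf).
Proof. exact: pushforward_semi_sigma_additive. Qed.

HB.instance Definition _ := isMeasure.Build _ _ _ (image_measure mf)
  image0 image_ge0 image_sigma_additive.

End image_measure.

Lemma lebesgue_measure_dilation (R : realType) (c : R) (A : set R) : 0 < c ->
  measurable A ->
  (c%:E * lebesgue_measure [set x | A (c * x)%R] = lebesgue_measure A)%E.
Proof.
move=> c0 mA.
have mc : measurable_fun [set: measurableTypeR R]
    ((fun x : R => c * x) : measurableTypeR R -> measurableTypeR R).
  exact: mulrl_measurable.
pose m' : {measure set (measurableTypeR R) -> \bar R} :=
  mscale (NngNum (ltW c0)) (image_measure (@lebesgue_measure R) mc).
have := @lebesgue_measure_unique R m'.
move=> /(_ _ A mA) ->//.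
move=> _ /ocitvP[->|[[a b] /= ab ->]].
  by rewrite measure0.
rewrite /m' /image_measure /pushforward/= /mscale/=.
rewrite (_ : _ @^-1` _ = `](a / c), (b / c)]%classic); last first.
  apply/seteqP; split => x /=; rewrite !in_itv/= ltr_pdivrMr// ler_pdivlMr//.
    by rewrite mulrC.
  by rewrite mulrC.
rewrite !lebesgue_measure_itv/= !lte_fin ltr_pM2r ?invr_gt0// ab.
rewrite -!EFinD -EFinM; congr (_%:E).
by rewrite -mulrBl mulrCA divff ?mulr1// gt_eqF.
Qed.

(** The two measures agree on rectangles, which determine a product measure. This is the induction
    step for dilations of R^n, whose measure is built one coordinate at a time. *)
Lemma product_dilation d1 d2 (T1 : measurableType d1) (T2 : measurableType d2)
    (R : realType) (m1 : {sigma_finite_measure set T1 -> \bar R})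
    (m2 : {sigma_finite_measure set T2 -> \bar R}) (h1 : T1 -> T1)
    (h2 : T2 -> T2) (c1 c2 : R) : 0 <= c1 -> 0 <= c2 ->
  measurable_fun setT h1 -> measurable_fun setT h2 ->
  (forall B, measurable B -> c1%:E * m1 (h1 @^-1` B) = m1 B)%E ->
  (forall B, measurable B -> c2%:E * m2 (h2 @^-1` B) = m2 B)%E ->
  forall X, measurable X ->
  ((c1 * c2)%:E * (m1 \x m2) [set u | X (h1 u.1, h2 u.2)] = (m1 \x m2) X)%E.
Proof.
move=> c10 c20 mh1 mh2 m1E m2E X mX.
pose h (u : T1 * T2) := (h1 u.1, h2 u.2).
have mh : measurable_fun setT h.
  by apply: measurable_fun_pair; apply: measurableT_comp.
pose m' : {measure set (T1 * T2) -> \bar R} :=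
  mscale (NngNum (mulr_ge0 c10 c20)) (image_measure (m1 \x m2)%E mh).
rewrite [RHS](@product_measure_unique _ _ _ _ _ m1 m2 m')// => B C mB mC.
rewrite -(m1E _ mB) -(m2E _ mC) /m' /image_measure /pushforward/= /mscale/=.
rewrite (_ : h @^-1` _ = (h1 @^-1` B) `*` (h2 @^-1` C))//.
rewrite product_measure1E//; last 2 first.
  by rewrite -[X in measurable X]setTI; exact: mh1.
  by rewrite -[X in measurable X]setTI; exact: mh2.
by rewrite EFinM muleACA.
Qed.

Lemma measurable_scale_rV (R : realType) n (c : R) :
  measurable_fun [set: 'rV[R]_n] (fun x : 'rV[R]_n => c *: x).
Proof.
apply: measurable_fun_coordP => i; under eq_fun do rewrite mxE.
by apply: measurable_funM => //; exact: measurable_coord.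
Qed.

Lemma lebesgue_rV_dilation (R : realType) n (c : R) (A : set 'rV[R]_n) : 0 < c ->
  measurable A ->
  ((c ^+ n)%:E * lebesgue_rV R n [set x | A (c *: x)%R] =
    lebesgue_rV R n A)%E.
Proof.
move=> c0; elim: n A => [A mA|n IH A mA].
  rewrite expr0 mul1e; congr (lebesgue_rV _ _ _).
  apply/funext => x /=; congr (A _); apply/rowP => -[]//.
have := @product_dilation _ _ (measurableTypeR R) 'rV[R]_n R
  (@lebesgue_measure R) (lebesgue_rV R n)
  (fun x => c * x) (fun v => c *: v) _ _ (ltW c0) (exprn_ge0 n (ltW c0))
  (mulrl_measurable c) (measurable_scale_rV c).
move=> /(_ (fun B => lebesgue_measure_dilation c0) IH).
move=> /(_ (@cons_rV R n @^-1` A)).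
rewrite -[X in measurable X]setTI => /(_ (measurable_cons_rV measurableT mA)).
rewrite -exprS /= /lebesgue_rV_succ /pushforward => <-.
congr (_ * product_measure1 _ _ _)%E; apply/funext => -[t v] /=; congr (A _).
apply/rowP => i; rewrite mxE; have [j ->|->] := unliftP ord0 i.
  by rewrite !cons_rVS mxE.
by rewrite !cons_rV0.
Qed.

Lemma measurable_coords (R : realType) n (B : 'I_n -> set R) :
  (forall i, measurable (B i)) ->
  measurable [set x : 'rV[R]_n | forall i, B i (x 0 i)].
Proof.
move=> mB; rewrite (_ : [set _ | _] =
    \big[setI/setT]_i ((fun x : 'rV[R]_n => x 0 i) @^-1` B i)).
  apply: bigsetI_measurable => i _.
  by rewrite -[X in measurable X]setTI; exact: measurable_coord.
rewrite -bigcap_seq; apply/seteqP; split => x /= H i; first by move=> _; exact: H.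
by apply: H; rewrite /= mem_index_enum.
Qed.

Lemma measurable_box (R : realType) n (a b : R) :
  measurable [set x : 'rV[R]_n | forall i, a < x 0 i <= b].
Proof.
exact: (@measurable_coords R n (fun=> `]a, b]%classic) (fun=> measurable_itv _)).
Qed.

(** Used twice: large boxes show that balls have finite measure, and a small box gives a set of
    positive measure on which a radial extremal is positive. *)
Lemma lebesgue_rV_box (R : realType) n (a b : R) : a <= b ->
  lebesgue_rV R n [set x | forall i, a < x 0 i <= b] = ((b - a) ^+ n)%:E.
Proof.
move=> ab; elim: n => [|n IH].
  by rewrite expr0 /= diracE mem_set//= => -[].
have mbox := @measurable_box R n a b.
rewrite /= /lebesgue_rV_succ /pushforward.
rewrite (_ : _ @^-1` _ = `]a, b]%classic `*` [set x : 'rV[R]_n | forall i, a < x 0 i <= b]).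
  rewrite [LHS]product_measure1E// exprS EFinM; congr (_ * _)%E; last exact: IH.
  rewrite [LHS]lebesgue_measure_itv/= lte_fin.
  by case: ltP => // ba; rewrite (le_anti (introT andP (conj ab ba))) subrr.
apply/seteqP; split => -[t v] /=.
  move=> H; split; first by have := H ord0; rewrite cons_rV0 in_itv.
  by move=> i; have := H (lift ord0 i); rewrite cons_rVS.
rewrite in_itv/= => -[Ht Hv] i; have [j ->|->] := unliftP ord0 i.
  by rewrite cons_rVS.
by rewrite cons_rV0.
Qed.

Lemma measurable_rV0 (R : realType) n : measurable [set (0 : 'rV[R]_n)].
Proof.
rewrite (_ : [set _] = [set x : 'rV[R]_n | forall i, [set 0] (x 0 i)]).
  exact: (measurable_coords (fun=> measurable_set1 _)).
apply/seteqP; split => x /= H; first by move=> i; rewrite H mxE.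
by apply/rowP => i; rewrite H mxE.
Qed.

Lemma lebesgue_rV_set0 (R : realType) n :
  (0 < n)%N -> lebesgue_rV R n [set 0] = 0%E.
Proof.
case: n => // n _; rewrite /= /lebesgue_rV_succ /pushforward.
have m0 := @measurable_rV0 R n.
rewrite (_ : _ @^-1` _ = [set (0 : R)] `*` [set (0 : 'rV[R]_n)]).
  rewrite [LHS]product_measure1E//.
  by rewrite [X in (X * _)%E](lebesgue_measure_set1 0) mul0e.
apply/seteqP; split => -[t v] /=.
  move=> H; split; first by have := cons_rV0 (t, v); rewrite H mxE.
  by apply/rowP => i; have := cons_rVS (t, v) i; rewrite H !mxE.
move=> [-> ->]; apply/rowP => i; have [j ->|->] := unliftP ord0 i.
  by rewrite cons_rVS !mxE.
by rewrite cons_rV0 mxE.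
Qed.

Section radial_decomposition.
Context (R : realType) (n : nat).
Implicit Types (x : 'rV[R]_n) (c : R).

Lemma enorm_ge0 x : 0 <= enorm x.
Proof. exact: sqrtr_ge0. Qed.

Lemma enorm_sqr x : enorm x ^+ 2 = \sum_i x 0 i ^+ 2.
Proof. by rewrite sqr_sqrtr// sumr_ge0// => i _; exact: sqr_ge0. Qed.

Lemma enormZ c x : enorm (c *: x) = `|c| * enorm x.
Proof.
rewrite /enorm (eq_bigr (fun i => c ^+ 2 * x 0 i ^+ 2)); last first.
  by move=> i _; rewrite mxE exprMn.
by rewrite -mulr_sumr sqrtrM ?sqr_ge0// sqrtr_sqr.
Qed.

Lemma coord_le_enorm x i : `|x 0 i| <= enorm x.
Proof.
rewrite -sqrtr_sqr ler_sqrt ?sumr_ge0// => [|j _]; last exact: sqr_ge0.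
by rewrite (bigD1 i)//= lerDl sumr_ge0// => j _; exact: sqr_ge0.
Qed.

Lemma enorm_eq0 x : (enorm x == 0) = (x == 0).
Proof.
apply/eqP/eqP => [x0|->]; last first.
  by rewrite -(scale0r (0 : 'rV_n)) enormZ normr0 mul0r.
apply/rowP => i; rewrite mxE; apply/eqP; rewrite -normr_le0 -x0.
exact: coord_le_enorm.
Qed.

Lemma enorm_gt0 x : (0 < enorm x) = (x != 0).
Proof. by rewrite lt_neqAle enorm_ge0 andbT eq_sym enorm_eq0. Qed.

Lemma enormK x : enorm x *: dir x = x.
Proof.
rewrite /dir scalerA; have [->|x0] := eqVneq x 0; first by rewrite scaler0.
by rewrite divff ?scale1r// enorm_eq0.
Qed.

Lemma usphere_dir x : x != 0 -> @usphere R n (dir x).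
Proof.
move=> x0; rewrite /usphere/= /dir enormZ ger0_norm ?invr_ge0 ?enorm_ge0//.
by rewrite mulVf// enorm_eq0.
Qed.

Lemma dirZ c x : 0 < c -> dir (c *: x) = dir x.
Proof.
move=> c0; rewrite /dir enormZ gtr0_norm// invfM scalerA mulrAC mulVf ?mul1r//.
by rewrite gt_eqF.
Qed.

Lemma enorm_ray c w : 0 <= c -> @usphere R n w -> enorm (c *: w) = c.
Proof. by move=> c0 w1; rewrite enormZ w1 mulr1 ger0_norm. Qed.

Lemma dir_ray c w : 0 < c -> @usphere R n w -> dir (c *: w) = w.
Proof. by move=> c0 w1; rewrite dirZ// /dir w1 invr1 scale1r. Qed.

Lemma measurable_enorm_itv (i : interval R) :
  measurable [set x : 'rV[R]_n | enorm x \in i].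
Proof.
rewrite -[X in measurable X]setTI.
exact: (measurable_enorm measurableT (measurable_itv i)).
Qed.

Lemma measurable_usphere : measurable (@usphere R n).
Proof.
rewrite -[X in measurable X]setTI.
exact: (measurable_enorm measurableT (measurable_set1 (1 : R))).
Qed.

Lemma measurable_enorm_ball (b : R) : measurable [set x : 'rV[R]_n | enorm x <= b].
Proof.
exact: (measurable_enorm_itv `]-oo, b]).
Qed.

Lemma lebesgue_rV_ball_fin (b : R) :
  (lebesgue_rV R n [set x | (enorm x <= b)%R] < +oo)%E.
Proof.
apply: (@le_lt_trans _ _
    (lebesgue_rV R n [set x | forall i, - (`|b| + 1) < x 0 i <= `|b| + 1])).
  apply: le_measure; rewrite ?inE.
  - exact: measurable_enorm_ball.
  - exact: measurable_box.
  move=> x /= xb i; have := le_trans (coord_le_enorm x i) xb.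
  by have := ler_norm b; rewrite ler_norml; lra.
by rewrite lebesgue_rV_box ?ltry//; have := normr_ge0 b; lra.
Qed.

Lemma measurable_cone (A : set 'rV[R]_n) (b : R) : measurable A ->
  measurable [set x | 0 < enorm x <= b /\ A (dir x)].
Proof.
move=> mA.
have -> : [set x | 0 < enorm x <= b /\ A (dir x)] =
    [set x | enorm x \in `]0, b]] `&` (@dir R n @^-1` A).
  by apply/seteqP; split => x /=; rewrite in_itv/=.
apply: measurableI; first exact: measurable_enorm_itv.
by rewrite -[X in measurable X]setTI; exact: measurable_dir.
Qed.

Lemma surface_measure_fin (A : set 'rV[R]_n) : measurable A ->
  (surface_measure A < +oo)%E.
Proof.
move=> mA; rewrite /surface_measure lte_mul_pinfty ?lee_fin//.
apply: le_lt_trans (lebesgue_rV_ball_fin 1); apply: le_measure; rewrite ?inE.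
- exact: measurable_cone.
- exact: measurable_enorm_ball.
- by move=> x /= [/andP[]].
Qed.

(** Dilation by [b] carries the unit cone over [A], whose volume defines the surface measure, to the
    cone of radius [b]. This is the polar formula on sets ]0, b] x A. *)
Lemma lebesgue_rV_cone (A : set 'rV[R]_n) (b : R) : (0 < n)%N -> measurable A ->
  0 < b ->
  (lebesgue_rV R n [set x | (0 < enorm x <= b)%R /\ A (dir x)] =
   (b ^+ n / n%:R)%:E * surface_measure A)%E.
Proof.
move=> n0 mA b0; rewrite -(lebesgue_rV_dilation b0)//; last exact: measurable_cone.
rewrite /surface_measure muleA -EFinM mulfVK ?pnatr_eq0 -?lt0n//.
congr (_ * lebesgue_rV _ _ _)%E; apply/seteqP; split => x /=.
  rewrite enormZ gtr0_norm// dirZ// pmulr_rgt0// -{2}(mulr1 b) ler_pM2l//.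
rewrite enormZ gtr0_norm// dirZ// pmulr_rgt0// -{2}(mulr1 b) ler_pM2l//.
Qed.

End radial_decomposition.

(** * Polar coordinates *)

(** A half-open interval is a difference of two rays, and finiteness on rays permits the
    subtraction; half-open intervals generate the sigma-algebra. *)
Lemma measure_eq_ray (R : realType)
    (m1 m2 : {measure set (measurableTypeR R) -> \bar R}) :
  (forall b, m1 `]-oo, b]%classic < +oo)%E ->
  (forall b, m1 `]-oo, b]%classic = m2 `]-oo, b]%classic) ->
  forall A, measurable A -> m1 A = m2 A.
Proof.
move=> m1oo m12 A mA.
have mray (b : R) : measurable (`]-oo, b]%classic : set (measurableTypeR R)).
  exact: measurable_itv.
apply: (@measure_unique _ R (measurableTypeR R) (R.-ocitv.-measurable)
  (fun k => `](- k%:R), k%:R]%classic)) => //.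
- exact: ocitvI.
- by move=> k; exact: is_ocitv.
- apply/seteqP; split => // x _; exists (Num.truncn `|x|).+1 => //=.
  by rewrite in_itv/=; have := truncnS_gt `|x|; rewrite ltr_norml; lra.
- move=> _ /ocitvP[->|[[a b] /= ab ->]]; first by rewrite !measure0.
  have -> : `]a, b]%classic = `]-oo, b]%classic `\` `]-oo, a]%classic.
    apply/seteqP; split => x /=; rewrite !in_itv/=.
      by move=> /andP[ax ->]; split=> //; apply/negP; rewrite -ltNge.
    by move=> [-> /negP]; rewrite -ltNge => ->.
  have E : `]-oo, b]%classic `&` `]-oo, a]%classic = `]-oo, a]%classic.
    apply/seteqP; split => x /=; rewrite !in_itv/=; first by case.
    by move=> xa; split=> //; rewrite (le_trans xa)// ltW.
  have mD (m : {measure set (measurableTypeR R) -> \bar R}) :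
      (forall c, m `]-oo, c]%classic < +oo)%E ->
      m (`]-oo, b]%classic `\` `]-oo, a]%classic) =
        (m `]-oo, b]%classic - m `]-oo, a]%classic)%E.
    move=> moo; rewrite measureD; first by congr (_ - m _)%E.
    - exact: mray.
    - exact: mray.
    - exact: moo.
  by rewrite !mD// ?m12// => c; rewrite -m12.
- move=> k; apply: le_lt_trans (m1oo k%:R); apply: le_measure; rewrite ?inE//.
  by move=> x /=; rewrite !in_itv/= => /andP[].
Qed.

Section density_measure.
Local Open Scope ereal_scope.
Context d (T : measurableType d) (R : realType).
Variables (m : {measure set T -> \bar R}) (w : T -> R).
Hypotheses (mw : measurable_fun [set: T] w) (w0 : forall x, (0 <= w x)%R).

Definition density_measure of measurable_fun [set: T] w &
    (forall x, (0 <= w x)%R) : set T -> \bar R :=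
  fun A => \int[m]_(x in A) (w x)%:E.

Local Notation nu := (density_measure mw w0).

Let density0 : nu set0 = 0.
Proof. by rewrite /density_measure integral_set0. Qed.

Let density_ge0 A : 0 <= nu A.
Proof. by apply: integral_ge0 => x _; rewrite lee_fin. Qed.

Let density_sigma_additive : semi_sigma_additive nu.
Proof.
move=> F mF tF mUF; rewrite /density_measure ge0_integral_bigcup//=.
- by apply: is_cvg_ereal_nneg_natsum_cond => n _ _; exact: density_ge0.
- by apply: measurable_funTS; exact/measurable_EFinP.
- by move=> x _; rewrite lee_fin.
Qed.

HB.instance Definition _ := isMeasure.Build _ _ _ nu
  density0 density_ge0 density_sigma_additive.

Import HBNNSimple.

(** Monotone convergence reduces the identity to simple functions and linearity to the indicator of
    a level set, where it is the definition of the density measure. *)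
Lemma ge0_integral_density (f : T -> \bar R) :
  measurable_fun setT f -> (forall x, 0 <= f x) ->
  \int[nu]_x f x = \int[m]_x (f x * (w x)%:E).
Proof.
move=> mf f0; pose f_ := nnsfun_approx measurableT mf.
have mw' : measurable_fun setT (fun x => (w x)%:E) by exact/measurable_EFinP.
transitivity (limn (fun n => \int[nu]_x (f_ n x)%:E)).
  rewrite -monotone_convergence//.
  - by apply: eq_integral => y _; apply/esym/cvg_lim => //; exact: cvg_nnsfun_approx.
  - by move=> n; exact/measurable_EFinP/measurable_funP.
  - by move=> n y _; rewrite lee_fin.
  - by move=> y _ k n kn; rewrite lee_fin; exact/lefP/nd_nnsfun_approx.
transitivity (limn (fun n => \int[m]_x ((f_ n x)%:E * (w x)%:E))); last first.
  rewrite -monotone_convergence//.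
  - apply: eq_integral => y _; apply/cvg_lim => //.
    apply: cvgeZr => //; exact: cvg_nnsfun_approx.
  - move=> n; apply: emeasurable_funM => //.
    exact/measurable_EFinP/measurable_funP.
  - by move=> n y _; rewrite mule_ge0// lee_fin.
  - move=> y _ k n kn; rewrite lee_wpmul2r ?lee_fin//.
    exact/lefP/nd_nnsfun_approx.
congr (limn _); apply/funext => n.
have mfn k : measurable (f_ n @^-1` [set k]).
  by rewrite -[X in measurable X]setTI; exact: measurable_funP.
transitivity (\sum_(k \in range (f_ n))
    \int[nu]_x (k * \1_(f_ n @^-1` [set k]) x)%:E).
  under eq_integral do rewrite fimfunE -fsumEFin//.
  rewrite ge0_integral_fsum//.
  - by move=> y; exact/measurable_EFinP/measurable_funM.
  - by move=> y x _; rewrite nnfun_muleindic_ge0.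
transitivity (\sum_(k \in range (f_ n))
    \int[m]_x ((k * \1_(f_ n @^-1` [set k]) x)%:E * (w x)%:E)); last first.
  rewrite -ge0_integral_fsum//.
  - apply: eq_integral => x _; rewrite -ge0_mule_fsuml; last first.
      by move=> k; rewrite nnfun_muleindic_ge0.
    by rewrite fsumEFin// -fimfunE.
  - move=> y; apply: emeasurable_funM => //.
    exact/measurable_EFinP/measurable_funM.
  - by move=> y x _; rewrite mule_ge0// ?nnfun_muleindic_ge0// lee_fin.
apply: eq_fsbigr => k /set_mem[x _ <-].
rewrite integralZl_indic_nnsfun// integral_indic// setIT.
transitivity (\int[m]_y ((f_ n x)%:E * ((\1_(f_ n @^-1` [set f_ n x]) y)%:E * (w y)%:E))).
  rewrite ge0_integralZl//; last 3 first.
  - apply: emeasurable_funM => //; exact/measurable_EFinP.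
  - by move=> y _; rewrite mule_ge0// lee_fin.
  - by rewrite lee_fin.
  congr (_ * _); rewrite [LHS]integral_mkcond.
  apply: eq_integral => y _; rewrite patchE indicE.
  by case: ifP => _; rewrite ?mul1e ?mul0e.
by apply: eq_integral => y _; rewrite muleA.
Qed.

End density_measure.

Section polar_coordinates.
Local Open Scope ereal_scope.
Context (R : realType) (n : nat).
Hypothesis n0 : (0 < n)%N.

(** The Jacobian of polar coordinates, extended by 0 so that the radial factor is a measure on the
    whole line and can enter a product measure. *)
Definition radial_weight (t : measurableTypeR R) : R :=
  if (0 < t)%R then (t ^+ n.-1)%R else 0%R.

Lemma measurable_radial_weight : measurable_fun setT radial_weight.
Proof.
apply: measurable_fun_ifT => //.
  apply: (measurable_fun_bool true) => /=.
  rewrite setTI (_ : _ @^-1` _ = `]0%R, +oo[%classic); first exact: measurable_itv.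
  by apply/seteqP; split => x /=; rewrite in_itv/= andbT.
Qed.

Lemma radial_weight_ge0 t : (0 <= radial_weight t)%R.
Proof. by rewrite /radial_weight; case: ifPn => // t0; rewrite exprn_ge0// ltW. Qed.

Definition radial_measure : set (measurableTypeR R) -> \bar R :=
  density_measure (@lebesgue_measure R) measurable_radial_weight radial_weight_ge0.

HB.instance Definition _ := Measure.on radial_measure.

Lemma radial_measure_ray (b : R) :
  radial_measure `]-oo, b]%classic =
    if (0 < b)%R then (b ^+ n / n%:R)%:E else 0.
Proof.
rewrite /radial_measure /density_measure.
transitivity (\int[@lebesgue_measure R]_(x in `]0%R, b]) (x ^+ n.-1)%:E).
  rewrite integral_mkcond [RHS]integral_mkcond; apply: eq_integral => x _.
  rewrite !patchE /radial_weight !mem_setE !in_itv/=.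
  by case: (0 < x)%R; case: (x <= b)%R.
case: ltP => b0; last first.
  by rewrite set_itv_ge ?integral_set0// bnd_simp -leNgt.
rewrite integral_itv_obnd_cbnd; last first.
  by apply/measurable_EFinP; apply: measurable_funTS; exact: exprn_measurable.
rewrite (@continuous_FTC2 _ _ (fun x => x ^+ n / n%:R)%R)//.
- by rewrite expr0n gtn_eqF// mul0r sube0.
- by apply: continuous_subspaceT => x; exact: exprn_continuous.
- split.
  + by move=> x _; apply: derivableM => //; exact: exprn_derivable.
  + apply: cvg_at_right_filter; apply: cvgMl; exact: exprn_continuous.
  + apply: cvg_at_left_filter; apply: cvgMl; exact: exprn_continuous.
- move=> x _; rewrite derive1Mr; last exact: exprn_derivable.
  by rewrite exp_derive1 -[_ *: _]/(_ * _)%R mulrAC divff ?mul1r// pnatr_eq0 -lt0n.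
Qed.

End polar_coordinates.

Section polar_coordinates.
Local Open Scope ereal_scope.
Context (R : realType) (n : nat).

Let radial_sigma_finite : sigma_finite setT (@radial_measure R n).
Proof.
exists (fun k => `]-oo, k%:R]%classic).
  apply/esym/seteqP; split => // x _; exists (Num.truncn `|x|).+1 => //=.
  by rewrite in_itv/=; have := truncnS_gt `|x|; rewrite ltr_norml => /andP[_ /ltW].
move=> k; split; first exact: measurable_itv.
rewrite [ltLHS](@radial_measure_ray R n.-1.+1 isT).
by case: ifP => _; rewrite ltry.
Qed.

HB.instance Definition _ := Measure_isSigmaFinite.Build _ _ _
  (@radial_measure R n) radial_sigma_finite.

Let surface_fin : fin_num_fun (@surface_measure R n).
Proof.
by move=> A mA; rewrite ge0_fin_numE; [exact: surface_measure_fin|exact: measure_ge0].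
Qed.

HB.instance Definition _ := Measure_isFinite.Build _ _ _
  (@surface_measure R n) surface_fin.

Lemma surface_measureC_usphere : surface_measure (~` @usphere R n) = 0.
Proof.
rewrite /surface_measure (_ : cone _ = set0) ?measure0 ?mule0//.
apply/seteqP; split => x //= [/andP[x0 _]]; apply.
by apply: usphere_dir; rewrite -enorm_gt0.
Qed.

Let polar (x : 'rV[R]_n) : measurableTypeR R * 'rV[R]_n := (enorm x, dir x).

Let mpolar : measurable_fun setT polar.
Proof.
apply: measurable_fun_pair; first exact: measurable_enorm.
exact: measurable_dir.
Qed.

(** On a rectangle with fixed second side [B], both sides are measures of the first side. They are
    compared on rays, where the preimage is a cone up to the origin. *)
Lemma polar_measureE (X : set (measurableTypeR R * 'rV[R]_n)) : (0 < n)%N ->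
  measurable X ->
  (@radial_measure R n \x @surface_measure R n) X =
  image_measure (lebesgue_rV R n) mpolar X.
Proof.
move=> n0; apply: product_measure_unique => A B mA mB.
have mrB : measurable ((@dir R n) @^-1` B).
  by rewrite -[X in measurable X]setTI; exact: measurable_dir.
have menorm : measurable_fun setT (@enorm R n : 'rV[R]_n -> measurableTypeR R).
  exact: measurable_enorm.
have sB0 : (0 <= fine (surface_measure B))%R by rewrite fine_ge0.
pose m1 : {measure set (measurableTypeR R) -> \bar R} :=
  mscale (NngNum sB0) (@radial_measure R n).
pose m2 : {measure set (measurableTypeR R) -> \bar R} :=
  image_measure (mrestr (lebesgue_rV R n) mrB) menorm.
suff /(_ A mA) : forall A, measurable A -> m1 A = m2 A.
  rewrite /m1/m2/=/mscale/= /image_measure/pushforward/mrestr/=.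
  by rewrite fineK ?surface_fin// muleC => ->.
have rayE (b : R) : m1 `]-oo, b]%classic = m2 `]-oo, b]%classic.
  rewrite /m1/m2/=/mscale/= /image_measure/pushforward/mrestr/=.
  rewrite radial_measure_ray// fineK ?surface_fin//.
  set C := (_ `&` _).
  have mC : measurable C.
    by apply: measurableI => //; exact: (measurable_enorm_itv `]-oo, b]).
  have m0 := @measurable_rV0 R n.
  (* Since [dir 0] is 0, the origin belongs to [C] when 0 lies in [B] and [b] is nonnegative, while
     cones exclude it. It is a null set because [n] is positive. *)
  transitivity (lebesgue_rV R n (C `\ (0%R : 'rV[R]_n))); last first.
    rewrite measureD//; last first.
      apply: le_lt_trans (lebesgue_rV_ball_fin n b); apply: le_measure; rewrite ?inE//.
        exact: (@measurable_enorm_ball R n b).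
      by move=> x [/=]; rewrite in_itv.
    rewrite -[RHS]sube0; congr (_ - _).
    by apply: (subset_measure0 _ _ _ (lebesgue_rV_set0 R n0)) => //; exact: measurableI.
  have CE : C `\ (0%R : 'rV[R]_n) = [set x | (0 < enorm x <= b)%R /\ B (dir x)].
    apply/seteqP; split => x /=.
      by rewrite /C/= in_itv/= enorm_gt0 => -[[-> ?] /eqP ->].
    by rewrite /C/= in_itv/= enorm_gt0 => -[/andP[/eqP ? ?] ?].
  rewrite CE; case: ltP => b0; first by rewrite lebesgue_rV_cone// muleC.
  rewrite mule0 (_ : [set _ | _] = set0) ?measure0//.
  by apply/seteqP; split => x //= [/andP[/lt_le_trans/[apply]]]; rewrite ltNge b0.
apply: measure_eq_ray => // b; rewrite /m1/= /mscale/= radial_measure_ray//.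
by case: ifP => _; rewrite ?mule0 -?EFinM ltry.
Qed.

(** As x = |x| * dir x, [F] factors through the polar map, whose image of Lebesgue measure is the
    product of the radial and surface measures; Tonelli then separates the variables. *)
Theorem ge0_integral_polar (F : 'rV[R]_n -> \bar R) : (0 < n)%N ->
  measurable_fun setT F -> (forall x, 0 <= F x) ->
  \int[lebesgue_rV R n]_x F x =
  \int[@surface_measure R n]_(w in @usphere R n)
    \int[@lebesgue_measure R]_(t in `]0%R, +oo[)
      (F (t *: w) * (t ^+ n.-1)%:E).
Proof.
move=> n0 mF F0.
pose T (u : measurableTypeR R * 'rV[R]_n) : 'rV[R]_n := u.1 *: u.2.
have mT : measurable_fun setT T.
  apply: measurable_fun_coordP => i; under eq_fun do rewrite mxE.
  apply: measurable_funM; first exact: measurable_fst.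
  apply: (measurableT_comp (measurable_coord i)); exact: measurable_snd.
have mFT : measurable_fun setT (F \o T) by exact: measurableT_comp.
have FT0 u : 0 <= (F \o T) u by exact: F0.
transitivity (\int[lebesgue_rV R n]_x ((F \o T) \o polar) x).
  by apply: eq_integral => x _; rewrite /T/= enormK.
transitivity (\int[image_measure (lebesgue_rV R n) mpolar]_u (F \o T) u).
  rewrite (ge0_integral_pushforward mpolar (lebesgue_rV R n) measurableT mFT)//.
transitivity (\int[(@radial_measure R n \x @surface_measure R n)]_u (F \o T) u).
  by apply: eq_measure_integral => A mA _; apply/esym; exact: polar_measureE.
rewrite (fubini_tonelli2 _ mFT FT0).
transitivity (\int[@surface_measure R n]_(w in @usphere R n)
    \int[@radial_measure R n]_t (F \o T) (t, w)).
  rewrite (@ge0_negligible_integral _ _ _ (@surface_measure R n) setT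
    (~` @usphere R n))//.
  - by rewrite setTD setCK.
  - apply: measurableC; exact: measurable_usphere.
  - exact: (measurable_fun_fubini_tonelli_G (F \o T) mFT FT0).
  - by move=> w _; apply: integral_ge0 => t _; exact: F0.
  - exact: surface_measureC_usphere.
apply: eq_integral => w _.
rewrite ge0_integral_density//; last first.
  by apply: measurableT_comp => //; exact: measurable_pair2.
rewrite [RHS]integral_mkcond; apply: eq_integral => t _.
rewrite patchE mem_setE in_itv/= andbT /radial_weight/T/=.
by case: ifP => _//; rewrite mule0.
Qed.

End polar_coordinates.

(** * Integration along rays *)

Lemma measurable_in_set d (T : measurableType d) (N : set T) :
  measurable N -> measurable_fun setT (fun x => x \in N).
Proof.
move=> mN; apply: (measurable_fun_bool true); rewrite setTI.
by rewrite (_ : _ @^-1` _ = N)//; apply/seteqP; split => x /=; [exact: set_mem|exact: mem_set].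
Qed.

Section integral_nonmeasurable.
Local Open Scope ereal_scope.
Context d (T : measurableType d) (R : realType).
Variable mu : {measure set T -> \bar R}.
Implicit Types f g : T -> \bar R.

(* The integral of a nonnegative function is a supremum over simple functions
   below it, hence it is monotone even on nonmeasurable functions. *)
Lemma ge0_le_integral_nomeas f g :
  (forall x, 0 <= f x) -> (forall x, f x <= g x) ->
  \int[mu]_x f x <= \int[mu]_x g x.
Proof.
move=> f0 fg; have g0 x : 0 <= g x by exact: le_trans (fg x).
rewrite !ge0_integralTE//; apply: ge_ereal_sup => _ [h hf <-]; apply: ereal_sup_ubound.
by exists h => // x; exact: le_trans (fg x).
Qed.

(** Raising [g] to [+oo] on the exceptional null set keeps its integral, as [g] is measurable, and
    turns the inequality into one valid everywhere. No measurability of [f] enters, so [f] may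
    contain a radial derivative. *)
Lemma ae_le_integral_measurabler f g : measurable_fun setT g ->
  (forall x, 0 <= f x) -> (forall x, 0 <= g x) ->
  {ae mu, forall x, f x <= g x} -> \int[mu]_x f x <= \int[mu]_x g x.
Proof.
move=> mg f0 g0 [N [mN N0 fgN]].
pose g' x := if x \in N then +oo else g x.
have mg' : measurable_fun setT g'.
  by apply: measurable_fun_ifT => //; exact: measurable_in_set.
have -> : \int[mu]_x g x = \int[mu]_x g' x.
  apply: ge0_ae_eq_integral => //.
    by move=> x _; rewrite /g'; case: ifP.
  exists N; split => // x /= xN; apply: contrapT => Nx; apply: xN => _.
  by rewrite /g' memNset.
apply: ge0_le_integral_nomeas => // x; rewrite /g'; case: ifPn => xN.
  by rewrite leey.
apply: contrapT => fg; move: xN; rewrite notin_setE; apply; exact: fgN.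
Qed.

(** The dual device: the measurable lower function is lowered to 0 on the null set. *)
Lemma ae_le_integral_measurablel f g : measurable_fun setT f ->
  (forall x, 0 <= f x) -> (forall x, 0 <= g x) ->
  {ae mu, forall x, f x <= g x} -> \int[mu]_x f x <= \int[mu]_x g x.
Proof.
move=> mf f0 g0 [N [mN N0 fgN]].
pose f' x := if x \in N then 0 else f x.
have mf' : measurable_fun setT f'.
  by apply: measurable_fun_ifT => //; exact: measurable_in_set.
have -> : \int[mu]_x f x = \int[mu]_x f' x.
  apply: ge0_ae_eq_integral => //.
    by move=> x _; rewrite /f'; case: ifP.
  exists N; split => // x /= xN; apply: contrapT => Nx; apply: xN => _.
  by rewrite /f' memNset.
apply: ge0_le_integral_nomeas => x; rewrite /f'; case: ifPn => xN //.
apply: contrapT => fg; move: xN; rewrite notin_setE; apply; exact: fgN.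
Qed.

End integral_nonmeasurable.

(** * Improper integrals by exhaustion *)

Section exhaustion.
Context (R : realType).
Local Notation mu := (@lebesgue_measure R).

(** The derivative [f] has no sign in the applications. It is integrated together with a nonnegative
    [B] that makes f + B nonnegative, so that monotone convergence can carry the identity to the
    whole interval without integrability of [f]. *)
Lemma integral_itv_ftc (F f B : R -> R) (a b : R) : a < b ->
  (forall t, a <= t <= b -> is_derive t 1 F (f t)) ->
  (forall t, a <= t <= b -> {for t, continuous f}) ->
  (forall t, a <= t <= b -> {for t, continuous B}) ->
  (\int[mu]_(t in `[a, b]) (f t + B t)%:E =
   (F b - F a)%:E + \int[mu]_(t in `[a, b]) (B t)%:E)%E.
Proof.
move=> ab dF cf cB.
have within (h : R -> R) : (forall t, a <= t <= b -> {for t, continuous h}) ->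
    {within `[a, b], continuous h}.
  move=> ch; apply: continuous_in_subspaceT => t; rewrite inE/= in_itv/=.
  exact: ch.
have intg (h : R -> R) : {within `[a, b], continuous h} ->
    mu.-integrable `[a, b] (EFin \o h).
  by apply: continuous_compact_integrable; exact: segment_compact.
have cF t : a <= t <= b -> {for t, continuous F}.
  move=> tab; have := dF t tab => -[/derivable1_diffP dFt _].
  exact: differentiable_continuous.
have -> : (\int[mu]_(t in `[a, b]) (f t + B t)%:E =
    \int[mu]_(t in `[a, b]) (f t)%:E + \int[mu]_(t in `[a, b]) (B t)%:E)%E.
  under eq_integral do rewrite EFinD.
  by rewrite integralD//; apply: intg; exact: within.
congr (_ + _)%E; rewrite (@continuous_FTC2 _ f F)//.
- exact: within.
- split.
  + move=> t; rewrite in_itv/= => /andP[/ltW ? /ltW ?].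
    by have [] := dF t; first by apply/andP.
  + by apply: cvg_at_right_filter; apply: cF; rewrite lexx ltW.
  + by apply: cvg_at_left_filter; apply: cF; rewrite lexx ltW.
- move=> t; rewrite in_itv/= => /andP[/ltW at_ /ltW tb].
  have tab : a <= t <= b by rewrite at_.
  by rewrite derive1E; have [_ ->] := dF t tab.
Qed.

Variables (a b : nat -> R).
Hypotheses (ab : forall k, a k < b k) (nia : {homo a : k l / (k <= l)%N >-> l <= k}).
Hypothesis ndb : {homo b : k l / (k <= l)%N >-> k <= l}.
Variables (F f B : R -> R).
Let S k : set R := `[a k, b k]%classic.
Variable I : set R.
Hypothesis IE : I = \bigcup_k `[a k, b k]%classic.
Hypothesis dF : forall t, I t -> is_derive t 1 F (f t).
Hypothesis cf : forall t, I t -> {for t, continuous f}.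
Hypothesis cB : forall t, I t -> {for t, continuous B}.
Hypothesis B0 : forall t, I t -> 0 <= B t.
Hypothesis fB0 : forall t, I t -> 0 <= f t + B t.

Let SI k t : a k <= t <= b k -> I t.
Proof. by move=> tab; rewrite IE; exists k => //; rewrite /S/= in_itv. Qed.

Let cvgS (h : R -> R) : (forall t, I t -> {for t, continuous h}) ->
  (forall t, I t -> 0 <= h t) ->
  (\int[mu]_(t in S k) (h t)%:E)%E @[k --> \oo] --> (\int[mu]_(t in I) (h t)%:E)%E.
Proof.
move=> ch h0; rewrite IE; apply: ge0_nondecreasing_set_cvg_integral.
- move=> k l kl; apply/subsetPset => t; rewrite /S/= !in_itv/= => /andP[akt tbk].
  by rewrite (le_trans (nia kl))//= (le_trans tbk)// ndb.
- by move=> k; exact: measurable_itv.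
- move=> k; apply/measurable_EFinP; apply: subspace_continuous_measurable_fun.
    exact: measurable_itv.
  apply: continuous_in_subspaceT => t; rewrite inE => Skt.
  by apply: ch; rewrite IE; exists k.
- by move=> k t Skt; rewrite lee_fin; apply: h0; rewrite IE; exists k.
Qed.

Let stepE k : (\int[mu]_(t in S k) (f t + B t)%:E =
   (F (b k) - F (a k))%:E + \int[mu]_(t in S k) (B t)%:E)%E.
Proof.
by apply: integral_itv_ftc => // t /SI It; [exact: dF|exact: cf|exact: cB].
Qed.

Let cfB t : I t -> {for t, continuous (fun t => f t + B t)}.
Proof. by move=> It; apply: continuousD; [exact: cf|exact: cB]. Qed.

Lemma exhaustion_ftc_le : (\forall k \near \oo, F (b k) <= F (a k)) ->
  (\int[mu]_(t in I) (f t + B t)%:E <=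
   \int[mu]_(t in I) (B t)%:E)%E.
Proof.
move=> Fle; have cA := cvgS cfB fB0; have cB' := cvgS cB B0.
rewrite -(cvg_lim _ cA)// -(cvg_lim _ cB')//.
apply: lee_lim; [by apply/cvg_ex; eexists; exact: cA|
  by apply/cvg_ex; eexists; exact: cB'|].
apply: filterS Fle => k Fk; rewrite [leLHS]stepE -[leRHS]add0e.
by rewrite leeD2r// lee_fin subr_le0.
Qed.

Lemma exhaustion_ftc_eq (l : R) : F (b k) - F (a k) @[k --> \oo] --> l ->
  (\int[mu]_(t in I) (f t + B t)%:E =
   l%:E + \int[mu]_(t in I) (B t)%:E)%E.
Proof.
move=> F0; have cA := cvgS cfB fB0; have cB' := cvgS cB B0.
have cD : ((F (b k) - F (a k))%:E + \int[mu]_(t in S k) (B t)%:E)%E @[k --> \oo]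
    --> (l%:E + \int[mu]_(t in I) (B t)%:E)%E.
  apply: cvgeD => //.
  by apply/fine_cvgP; split; [exact: nearW|exact: F0].
rewrite -(cvg_lim _ cA)// -(cvg_lim _ cD)//.
by congr (lim (_ @ \oo)); apply/funext => k; exact: stepE.
Qed.

End exhaustion.

(** * Integration by parts along a ray *)

Section radial_integration_by_parts.
Context (R : realType).
Local Notation mu := (@lebesgue_measure R).
Implicit Types (u v h : R -> R) (m t : R).

Lemma is_derive_mul_powR u du m t : 0 < t -> is_derive t 1 u du ->
  is_derive t 1 (fun t => u t * t `^ m) (du * t `^ m + m * (u t * t `^ (m - 1))).
Proof.
move=> t0 hu; have hp := is_derive1_powR m t0.
have -> : (fun t => u t * t `^ m) = u * (fun t => t `^ m) by [].
apply: is_derive_eq.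
by rewrite -![_ *: _]/(_ * _) addrC; congr (_ + _); [rewrite mulrC|rewrite mulrCA].
Qed.

Lemma continuous_powR_gt0 m t : 0 < t -> {for t, continuous (fun t => t `^ m)}.
Proof.
move=> t0; apply/differentiable_continuous/derivable1_diffP.
by have [] := is_derive1_powR m t0.
Qed.

Lemma is_derive_continuous u du t : is_derive t 1 u du -> {for t, continuous u}.
Proof. by move=> [/derivable1_diffP/differentiable_continuous]. Qed.

Lemma cvg_invS_powR (c : R) (j : nat) m : 0 < c -> 0 < m ->
  (c / (k + j.+1)%:R) `^ m @[k --> \oo] --> 0.
Proof.
move=> c0 m0.
have u0 : c / (k + j.+1)%:R @[k --> \oo] --> 0.
  rewrite -(mulr0 c); apply: cvgMr.
  under eq_fun do rewrite addnS.
  have := @cvg_harmonic R; rewrite -(cvg_shiftn j); exact.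
apply: cvg_comp (powR_cvg0 m0) => A A0.
suff : \forall k \near \oo, A (c / (k + j.+1)%:R) by [].
have : \forall k \near \oo, 0 < c / (k + j.+1)%:R -> A (c / (k + j.+1)%:R).
  exact: (u0 _ A0).
apply: filterS => k; apply.
by rewrite divr_gt0// ltr0n addnS.
Qed.

(** The offset 3 makes L/(k+3) smaller than L - L/(k+3) already at k = 0; with offset 2 the first
    interval would be a point. *)
Lemma bigcup_itv_bounded (L : R) : 0 < L ->
  `]0, L[%classic =
    \bigcup_k `[L / (k + 3)%:R, L - L / (k + 3)%:R]%classic.
Proof.
move=> L0; apply/seteqP; split => t /=; last first.
  move=> [k _ /=]; rewrite !in_itv/= => /andP[ht ht'].
  have : 0 < L / (k + 3)%:R by rewrite divr_gt0// ltr0n addnS.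
  by lra.
rewrite in_itv/= => /andP[t0 tL].
have m0 : 0 < Num.min t (L - t) by rewrite lt_min t0 subr_gt0.
exists (Num.truncn (L / Num.min t (L - t))) => //=.
set k := Num.truncn _.
have : L / (k + 3)%:R <= Num.min t (L - t).
  have k3 : 0 < (k + 3)%:R :> R by rewrite ltr0n addnS.
  rewrite ler_pdivrMr// mulrC -ler_pdivrMr//.
  by apply: (le_trans (ltW (truncnS_gt _))); rewrite ler_nat -addn1 leq_add2l.
by rewrite le_min in_itv/= => /andP[-> /=]; lra.
Qed.

(** The offset 2 makes the interval nondegenerate at k = 0. *)
Lemma bigcup_itv_unbounded :
  `]0, +oo[%classic =
    \bigcup_k `[1 / (k + 2)%:R, (k + 2)%:R]%classic :> set R.
Proof.
apply/seteqP; split => t /=; last first.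
  move=> [k _ /=]; rewrite !in_itv/= andbT => /andP[+ _].
  by apply: lt_le_trans; rewrite divr_gt0// ltr0n addnS.
rewrite in_itv/= andbT => t0.
exists (Num.truncn (Num.max t t^-1)) => //=.
set k := Num.truncn _.
have : Num.max t t^-1 <= (k + 2)%:R.
  by apply: (le_trans (ltW (truncnS_gt _))); rewrite ler_nat -addn1 leq_add2l.
rewrite ge_max in_itv/= => /andP[-> ht]; rewrite andbT.
have k2 : 0 < (k + 2)%:R :> R by rewrite ltr0n addnS.
by rewrite ler_pdivrMr// -ler_pdivrMl// mulr1.
Qed.

Lemma continuous_mul_powR u m t : 0 < t -> {for t, continuous u} ->
  {for t, continuous (fun t => u t * t `^ m)}.
Proof. by move=> t0 cu; apply: continuousM => //; exact: continuous_powR_gt0. Qed.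

Section equality.
Variables (a b : nat -> R).
Hypotheses (ab : forall k, a k < b k) (nia : {homo a : k l / (k <= l)%N >-> l <= k}).
Hypothesis ndb : {homo b : k l / (k <= l)%N >-> k <= l}.
Variable I : set R.
Hypothesis IE : I = \bigcup_k `[a k, b k]%classic.
Variables (u v : R -> R) (m : R).
Hypothesis I0 : forall t, I t -> 0 < t.
Hypothesis m0 : 0 < m.
Hypothesis du : forall t, I t -> is_derive t 1 u (- v t).
Hypothesis cv : forall t, I t -> {for t, continuous v}.
Hypothesis u0 : forall t, I t -> 0 <= u t.
Hypothesis v0 : forall t, I t -> 0 <= v t.

(** The derivative of u t^m is -v t^m + m u t^(m-1). With B = v t^m added it becomes the nonnegative
    left integrand, and the boundary term tends to 0 by assumption. *)
Lemma radial_by_parts :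
  u (b k) * b k `^ m - u (a k) * a k `^ m @[k --> \oo] --> 0 ->
  (\int[mu]_(t in I) (m * (u t * t `^ (m - 1)))%:E =
   \int[mu]_(t in I) (v t * t `^ m)%:E)%E.
Proof.
move=> F0.
have E t : m * (u t * t `^ (m - 1)) =
  (- v t * t `^ m + m * (u t * t `^ (m - 1))) + v t * t `^ m.
  by rewrite mulNr addrAC addNr add0r.
under eq_integral do rewrite E.
rewrite -[RHS]add0e; apply: (@exhaustion_ftc_eq _ a b ab nia ndb (fun t => u t * t `^ m)
  (fun t => - v t * t `^ m + m * (u t * t `^ (m - 1)))
  (fun t => v t * t `^ m) I IE) => //.
- by move=> t It; apply: is_derive_mul_powR; [exact: I0|exact: du].
- move=> t It; apply: continuousD.
    by apply: continuous_mul_powR; [exact: I0|apply: continuousN; exact: cv].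
  apply: continuousM; first exact: cvg_cst.
  by apply: continuous_mul_powR; [exact: I0|exact: is_derive_continuous (du It)].
- by move=> t It; apply: continuous_mul_powR; [exact: I0|exact: cv].
- by move=> t It; rewrite mulr_ge0 ?powR_ge0 ?v0.
- by move=> t It; rewrite -E mulr_ge0 ?(ltW m0)// mulr_ge0 ?powR_ge0 ?u0.
Qed.

End equality.

(** The boundary term vanishes at [L] because [u] tends to 0 there, and at 0 because u t^m is
    dominated by a positive power of t. *)
Lemma radial_by_parts_bounded (L C k m : R) u v : 0 < L -> 0 < m -> 0 < k ->
  (forall t, 0 < t < L -> is_derive t 1 u (- v t)) ->
  (forall t, 0 < t < L -> {for t, continuous v}) ->
  (forall t, 0 < t < L -> 0 <= u t) -> (forall t, 0 < t < L -> 0 <= v t) ->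
  (forall t, 0 < t < L -> u t * t `^ m <= C * t `^ k) ->
  u t @[t --> L^'-] --> 0 ->
  (\int[mu]_(t in `]0%R, L[) (m * (u t * t `^ (m - 1)))%:E =
   \int[mu]_(t in `]0%R, L[) (v t * t `^ m)%:E)%E.
Proof.
move=> L0 m0 k0 du cv u0 v0 uC uL.
have IL t : (`]0, L[%classic : set R) t <-> 0 < t < L by rewrite /= in_itv.
have j0 j : 0 < (j + 3)%:R :> R by rewrite ltr0n addnS.
have Lj j : 0 < L / (j + 3)%:R < L.
  by rewrite divr_gt0//= ltr_pdivrMr// ltr_pMr// ltr1n addn3.
have Ljh i j : (i <= j)%N -> L / (j + 3)%:R <= L / (i + 3)%:R.
  by move=> ij; rewrite ler_pM2l// lef_pV2 ?posrE// ler_nat leq_add2r.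
apply: (radial_by_parts _ _ _ (bigcup_itv_bounded L0)) => //.
- move=> j; have j3 : L / (j + 3)%:R <= L / 3.
    by rewrite ler_pM2l// lef_pV2 ?posrE// ler_nat leq_addl.
  by lra.
- by move=> i j ij; rewrite lerD2l lerN2 Ljh.
- by move=> t /IL/andP[].
have cL : L - L / (j + 3)%:R @[j --> \oo] --> L.
  rewrite -[X in _ --> X]subr0; apply: cvgB; first exact: cvg_cst.
  have := @cvg_invS_powR L 2 1 L0 ltr01.
  by under eq_fun do rewrite powRr1 ?(ltW (andP (Lj _)).1)//.
rewrite -[X in _ --> X](subr0 0); apply: cvgB.
  rewrite -(mul0r (L `^ m)); apply: cvgM; last first.
    have cp : t `^ m @[t --> L] --> L `^ m := @continuous_powR_gt0 m L L0.
    by apply: cvg_comp cp; exact: cL.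
  apply: cvg_comp uL => A AL.
  suff : \forall j \near \oo, A (L - L / (j + 3)%:R) by [].
  have : \forall j \near \oo, L - L / (j + 3)%:R < L -> A (L - L / (j + 3)%:R).
    exact: (cL _ AL).
  apply: filterS => j; apply.
  by rewrite ltrBlDr ltrDl; have /andP[] := Lj j.
apply: (@squeeze_cvgr _ _ _ _ (fun=> 0) (fun j => C * (L / (j + 3)%:R) `^ k)).
- apply: nearW => j; have /andP[j1 j2] := Lj j.
  by rewrite mulr_ge0 ?powR_ge0 ?u0 ?Lj//= uC ?Lj.
- exact: cvg_cst.
- rewrite -(mulr0 C); apply: cvgMr; exact: cvg_invS_powR.
Qed.

Lemma radial_by_parts_unbounded (C1 C2 k1 k2 m : R) u v :
  0 < m -> 0 < k1 -> 0 < k2 ->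
  (forall t, 0 < t -> is_derive t 1 u (- v t)) ->
  (forall t, 0 < t -> {for t, continuous v}) ->
  (forall t, 0 < t -> 0 <= u t) -> (forall t, 0 < t -> 0 <= v t) ->
  (forall t, 0 < t -> u t * t `^ m <= C1 * t `^ k1) ->
  (forall t, 0 < t -> u t * t `^ m <= C2 * t `^ (- k2)) ->
  (\int[mu]_(t in `]0%R, +oo[) (m * (u t * t `^ (m - 1)))%:E =
   \int[mu]_(t in `]0%R, +oo[) (v t * t `^ m)%:E)%E.
Proof.
move=> m0 k10 k20 du cv u0 v0 uC1 uC2.
have IL t : (`]0, +oo[%classic : set R) t <-> 0 < t by rewrite /= in_itv/= andbT.
have j0 j : 0 < (j + 2)%:R :> R by rewrite ltr0n addnS.
have j1 j : 0 < 1 / (j + 2)%:R :> R by rewrite divr_gt0.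
apply: (radial_by_parts _ _ _ bigcup_itv_unbounded) => //.
- move=> j; rewrite ltr_pdivrMr// -natrM ltr1n; nia.
- by move=> i j ij; rewrite ler_pM2l// lef_pV2 ?posrE// ler_nat leq_add2r.
- by move=> i j ij; rewrite ler_nat leq_add2r.
- by move=> t /IL.
- by move=> t /IL/du.
- by move=> t /IL/cv.
- by move=> t /IL/u0.
- by move=> t /IL/v0.
rewrite -[X in _ --> X](subr0 0); apply: cvgB.
- apply: (@squeeze_cvgr _ _ _ _ (fun=> 0) (fun j => C2 * (1 / (j + 2)%:R) `^ k2)).
  + apply: nearW => j; rewrite mulr_ge0 ?powR_ge0 ?u0//=.
    have -> : (1 / (j + 2)%:R) `^ k2 = (j + 2)%:R `^ (- k2).
      by rewrite div1r -powR_inv1 ?(ltW (j0 j))// -powRrM mulN1r.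
    exact: uC2.
  + exact: cvg_cst.
  + by rewrite -(mulr0 C2); apply: cvgMr; exact: cvg_invS_powR.
- apply: (@squeeze_cvgr _ _ _ _ (fun=> 0) (fun j => C1 * (1 / (j + 2)%:R) `^ k1)).
  + by apply: nearW => j; rewrite mulr_ge0 ?powR_ge0 ?u0//= uC1.
  + exact: cvg_cst.
  + by rewrite -(mulr0 C1); apply: cvgMr; exact: cvg_invS_powR.
Qed.

Lemma measurable_fun_gt0_continuous (g : R -> R) :
  (forall t, 0 < t -> {for t, continuous g}) ->
  measurable_fun (`]0, +oo[%classic : set R) g.
Proof.
move=> cg; apply: open_continuous_measurable_fun => //.
by move=> t; rewrite inE/= in_itv/= andbT; exact: cg.
Qed.

(** The boundary term at infinity is 0 because [h] vanishes beyond [M]; the one at 0 is -h(a) a^m,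
    which is nonpositive and is dropped. No control of [h] near 0 is needed. *)
Lemma radial_hardy (m M : R) (h dh : R -> R) : 0 < m -> 
  (forall t, 0 < t -> is_derive t 1 h (dh t)) ->
  (forall t, 0 < t -> {for t, continuous dh}) ->
  (forall t, 0 < t -> 0 <= h t) -> (forall t, M <= t -> h t = 0) ->
  (\int[mu]_(t in `]0%R, +oo[) (m * (h t * t `^ (m - 1)))%:E <=
   \int[mu]_(t in `]0%R, +oo[) (`|dh t| * t `^ m)%:E)%E.
Proof.
move=> m0 dhh cdh h0 hM.
have IL t : (`]0, +oo[%classic : set R) t <-> 0 < t by rewrite /= in_itv/= andbT.
have j0 j : 0 < (j + 2)%:R :> R by rewrite ltr0n addnS.
have j1 j : 0 < 1 / (j + 2)%:R :> R by rewrite divr_gt0.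
pose f t := dh t * t `^ m + m * (h t * t `^ (m - 1)).
pose B t := `|dh t| * t `^ m.
have cB t : 0 < t -> {for t, continuous B}.
  move=> t0; apply: continuous_mul_powR => //.
  by apply: continuous_comp; [exact: cdh|exact: norm_continuous].
have ch t : 0 < t -> {for t, continuous (fun t => h t * t `^ (m - 1))}.
  by move=> t0; apply: continuous_mul_powR => //; exact: is_derive_continuous (dhh t t0).
have cf t : 0 < t -> {for t, continuous f}.
  move=> t0; apply: continuousD; first by apply: continuous_mul_powR => //; exact: cdh.
  by apply: continuousM; [exact: cvg_cst|exact: ch].
have A0 t : 0 < t -> 0 <= m * (h t * t `^ (m - 1)).
  by move=> t0; rewrite mulr_ge0 ?(ltW m0)// mulr_ge0 ?powR_ge0 ?h0.
have fB t : m * (h t * t `^ (m - 1)) <= f t + B t.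
  rewrite /f /B addrAC lerDr -mulrDl mulr_ge0 ?powR_ge0//.
  by have := ler_norm (- dh t); rewrite normrN; lra.
apply: (@le_trans _ _ (\int[mu]_(t in `]0%R, +oo[) (f t + B t)%:E)%E).
  apply: ge0_le_integral => //.
  - by move=> t /IL t0; rewrite lee_fin A0.
  - apply/measurable_EFinP; apply: measurable_fun_gt0_continuous => t t0.
    by apply: continuousM; [exact: cvg_cst|exact: ch].
  - apply/measurable_EFinP; apply: measurable_fun_gt0_continuous => t t0.
    by apply: continuousD; [exact: cf|exact: cB].
  - by move=> t _; rewrite lee_fin.
apply: (@exhaustion_ftc_le _ (fun k => 1 / (k + 2)%:R) (fun k => (k + 2)%:R) _ _ _
  (fun t => h t * t `^ m) f B _ bigcup_itv_unbounded).
- move=> j; rewrite ltr_pdivrMr// -natrM ltr1n; nia.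
- by move=> i j ij; rewrite ler_pM2l// lef_pV2 ?posrE// ler_nat leq_add2r.
- by move=> i j ij; rewrite ler_nat leq_add2r.
- by move=> t /IL t0; apply: is_derive_mul_powR => //; exact: dhh.
- by move=> t /IL t0; exact: cf.
- by move=> t /IL t0; exact: cB.
- by move=> t _; rewrite /B mulr_ge0 ?powR_ge0.
- by move=> t /IL t0; exact: le_trans (A0 t t0) (fB t).
near=> k; rewrite hM.
  by rewrite mul0r mulr_ge0 ?powR_ge0// h0.
near: k; exists (Num.truncn `|M|).+1 => // k /= Mk.
apply: (le_trans (ler_norm M)); apply: (le_trans (ltW (truncnS_gt _))).
by rewrite ler_nat (leq_trans Mk)// leq_addr.
Unshelve. all: by end_near. Qed.

Lemma integral_powR_bounded (L k : R) : 0 < L -> 0 < k ->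
  (\int[mu]_(t in `]0%R, L[) (t `^ (k - 1))%:E = (L `^ k / k)%:E)%E.
Proof.
move=> L0 k0.
have IL t : (`]0, L[%classic : set R) t <-> 0 < t < L by rewrite /= in_itv.
have j0 j : 0 < (j + 3)%:R :> R by rewrite ltr0n addnS.
have Lj j : 0 < L / (j + 3)%:R < L.
  by rewrite divr_gt0//= ltr_pdivrMr// ltr_pMr// ltr1n addn3.
have Ljh i j : (i <= j)%N -> L / (j + 3)%:R <= L / (i + 3)%:R.
  by move=> ij; rewrite ler_pM2l// lef_pV2 ?posrE// ler_nat leq_add2r.
have cL : L - L / (j + 3)%:R @[j --> \oo] --> L.
  rewrite -[X in _ --> X]subr0; apply: cvgB; first exact: cvg_cst.
  have := @cvg_invS_powR L 2 1 L0 ltr01.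
  by under eq_fun do rewrite powRr1 ?(ltW (andP (Lj _)).1)//.
transitivity (\int[mu]_(t in `]0%R, L[) (t `^ (k - 1) + 0)%:E)%E.
  by under [RHS]eq_integral do rewrite addr0.
have dF t : 0 < t -> is_derive t 1 (fun t => k^-1 * t `^ k) (t `^ (k - 1)).
  move=> t0; have h1 := is_derive1_powR k t0.
  have : is_derive t 1 (fun t => k^-1 * t `^ k) (k^-1 * (k * t `^ (k - 1))).
    exact: is_deriveZ.
  by rewrite mulKf// gt_eqF.
rewrite (@exhaustion_ftc_eq _ (fun j => L / (j + 3)%:R) (fun j => L - L / (j + 3)%:R)
  _ _ _ (fun t => k^-1 * t `^ k) _ (cst 0) _ (bigcup_itv_bounded L0) _ _ _ _ _ (L `^ k / k)).
- by rewrite integral0 adde0.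
- move=> j; have j3 : L / (j + 3)%:R <= L / 3.
    by rewrite ler_pM2l// lef_pV2 ?posrE// ler_nat leq_addl.
  by lra.
- by move=> i j /Ljh.
- by move=> i j ij; rewrite lerD2l lerN2 Ljh.
- by move=> t /IL/andP[t0 _]; exact: dF.
- by move=> t /IL/andP[t0 _]; exact: continuous_powR_gt0.
- by move=> t _; exact: cvg_cst.
- by [].
- by move=> t _; rewrite addr0 powR_ge0.
rewrite -[X in _ --> X]subr0; apply: cvgB.
  rewrite mulrC; apply: cvgMr.
  have cp : t `^ k @[t --> L] --> L `^ k := @continuous_powR_gt0 k L L0.
  by apply: cvg_comp cp; exact: cL.
by rewrite -(mulr0 k^-1); apply: cvgMr; exact: cvg_invS_powR.
Qed.

Lemma integral_powR_unbounded (L k : R) : 0 < L -> 0 < k ->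
  (\int[mu]_(t in `[L, +oo[) (t `^ (- k - 1))%:E = (L `^ (- k) / k)%:E)%E.
Proof.
move=> L0 k0.
have IL t : (`[L, +oo[%classic : set R) t <-> L <= t by rewrite /= in_itv/= andbT.
have IE : `[L, +oo[%classic = \bigcup_j `[L, L + j.+1%:R]%classic :> set R.
  apply/seteqP; split => t /=; last by move=> [j _ /=]; rewrite !in_itv/= andbT => /andP[].
  rewrite in_itv/= andbT => Lt; exists (Num.truncn (t - L)) => //=.
  by rewrite in_itv/= Lt/= -lerBlDl ltW// truncnS_gt.
transitivity (\int[mu]_(t in `[L, +oo[) (t `^ (- k - 1) + 0)%:E)%E.
  by under [RHS]eq_integral do rewrite addr0.
have dF t : 0 < t -> is_derive t 1 (fun t => - k^-1 * t `^ (- k)) (t `^ (- k - 1)).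
  move=> t0; have h1 := is_derive1_powR (- k) t0.
  have : is_derive t 1 (fun t => - k^-1 * t `^ (- k)) (- k^-1 * (- k * t `^ (- k - 1))).
    exact: is_deriveZ.
  by rewrite mulrA mulrNN mulVf ?mul1r// gt_eqF.
rewrite (@exhaustion_ftc_eq _ (fun=> L) (fun j => L + j.+1%:R)
  _ _ _ (fun t => - k^-1 * t `^ (- k)) _ (cst 0) _ IE _ _ _ _ _ (L `^ (- k) / k)).
- by rewrite integral0 adde0.
- by move=> j; rewrite ltrDl.
- by [].
- by move=> i j ij; rewrite lerD2l ler_nat ltnS.
- by move=> t /IL Lt; apply: dF; exact: lt_le_trans Lt.
- by move=> t /IL Lt; apply: continuous_powR_gt0; exact: lt_le_trans Lt.
- by move=> t _; exact: cvg_cst.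
- by [].
- by move=> t _; rewrite addr0 powR_ge0.
rewrite mulNr opprK [X in _ --> X]mulrC -[X in _ --> X]add0r.
apply: cvgD; last exact: cvg_cst.
rewrite -(mulr0 (- k^-1)); apply: cvgMr.
apply: (@squeeze_cvgr _ _ _ _ (fun=> 0) (fun j => (1 / (j + 1)%:R) `^ k)).
- apply: nearW => j; rewrite powR_ge0/=.
  have jp : 0 < (j + 1)%:R :> R by rewrite ltr0n addn1.
  have Lj : 0 < L + j.+1%:R by rewrite addr_gt0.
  rewrite div1r -powR_inv1 ?(ltW jp)// -powRrM mulN1r !powRN.
  rewrite lef_pV2 ?posrE ?powR_gt0// ge0_ler_powR ?nnegrE ?(ltW jp) ?(ltW Lj) ?(ltW k0)//.
  by rewrite addn1 lerDr ltW.
- exact: cvg_cst.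
- exact: cvg_invS_powR.
Qed.

End radial_integration_by_parts.

(** * A smooth ramp *)

Section flat_exponentials.
Context (R : realType).
Variable d : R.
Hypothesis d0 : 0 < d.
Implicit Types (k : nat) (u : R).

(** The factors u^-k close this family, up to linear combinations, under differentiation, so one
    derivative rule yields smoothness of everything built from it. *)
Definition flat k u : R := if 0 < u then u ^- k * expR (- (d / u)) else 0.

Lemma flat_ge0 k u : 0 <= flat k u.
Proof.
by rewrite /flat; case: ifP => // u0; rewrite mulr_ge0 ?expR_ge0// invr_ge0 exprn_ge0// ltW.
Qed.

Lemma flat_npos k u : u <= 0 -> flat k u = 0.
Proof. by move=> u0; rewrite /flat ltNge u0. Qed.

(** The term of order k+1 of the exponential series at d/u already dominates: exp(d/u) is at least
    (d/u)^(k+1) / (k+1)!. The linear bound gives continuity at 0. *)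
Lemma flat_le k u : 0 <= u -> flat k u <= k.+1`!%:R / d ^+ k.+1 * u.
Proof.
rewrite le_eqVlt => /predU1P[<-|u0]; first by rewrite /flat ltxx mulr0.
have := @expR_ge1Dxn _ (d / u) k (ltW (divr_gt0 d0 u0)).
rewrite /flat u0 expRN => H.
have e0 := expR_gt0 (d / u).
have {H} : (d / u) ^+ k.+1 / k.+1`!%:R <= expR (d / u) by lra.
have f0 : 0 < k.+1`!%:R :> R by rewrite ltr0n fact_gt0.
have dk : 0 < d ^+ k.+1 by rewrite exprn_gt0.
have uk : 0 < u ^+ k by rewrite exprn_gt0.
rewrite expr_div_n ler_pdivrMr// ler_pdivrMr ?exprn_gt0// => H.
rewrite ler_pdivrMr// -[X in X <= _]mul1r ler_pdivrMr//.
rewrite (_ : _ * u ^+ k = expR (d / u) * k.+1`!%:R * u ^+ k.+1 / d ^+ k.+1).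
  by rewrite ler_pdivlMr// mul1r.
by rewrite [u ^+ k.+1]exprS; field; rewrite gt_eqF.
Qed.

Lemma continuous_flat0 k : {for 0, continuous (flat k)}.
Proof.
have f0 : flat k 0 = 0 by rewrite /flat ltxx.
rewrite /prop_for /continuous_at f0.
apply: (@squeeze_cvgr _ _ _ _ (fun=> 0) (fun u => k.+1`!%:R / d ^+ k.+1 * `|u|)).
- apply: nearW => u; rewrite flat_ge0/=; have [u0|u0] := leP 0 u.
    by rewrite (ger0_norm u0) flat_le.
  rewrite /flat ltNge (ltW u0)/= mulr_ge0// divr_ge0// ?exprn_ge0 ?ler0n//.
  exact: ltW.
- exact: cvg_cst.
- rewrite -[X in _ --> X](mulr0 (k.+1`!%:R / d ^+ k.+1)); apply: cvgMr.
  by rewrite -[X in _ --> X](@normr0 _ R); exact: norm_continuous.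
Qed.

Lemma is_derive_flat k u :
  is_derive u 1 (flat k) (- k%:R * flat k.+1 u + d * flat k.+2 u).
Proof.
have [u0|u0|u0] := ltgtP 0 u; last rewrite -{u}u0.
- have un : u != 0 by rewrite gt_eqF.
  have E j (w : R) : 0 < w -> flat j w = w `^ (- j%:R) * expR (- d * w `^ (- 1)).
    by move=> w0; rewrite /flat w0 powR_invn ?ltW// powR_inv1 ?ltW// mulNr.
  pose q (w : R) := - d * w `^ (- 1).
  apply: (@near_eq_is_derive _ _ _ ((fun w : R => w `^ (- k%:R)) * (expR \o q))) => //.
  + by near=> w; rewrite E//; near: w; exact: lt_nbhsr.
  + have hp a : is_derive u 1 (fun w : R => w `^ a) (a * u `^ (a - 1)).
      exact: is_derive1_powR.
    have hq : is_derive u 1 q (- d * (- 1 * u `^ (- 1 - 1))).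
      exact: is_deriveZ.
    have he := @is_derive1_comp _ expR q u _ _ (is_derive_expR (q u)) hq.
    apply: is_derive_eq.
    rewrite !E// -![_ *: _]/(_ * _) /=.
    have -> : (- 1 - 1 : R) = - 2%:R by lra.
    have -> : (- k%:R - 1 : R) = - k.+1%:R by rewrite -natr1 opprD.
    rewrite !powR_invn ?ltW// /q [u ^+ k.+2]exprS [u ^+ k.+1]exprS.
    have Xn : u ^+ k != 0 by rewrite expf_neq0.
    by set X := u ^+ k in Xn *; set Y := expR _; field; rewrite ?Xn ?un.
- rewrite !flat_npos ?(ltW u0)// !mulr0 addr0.
  apply: (@near_eq_is_derive _ _ _ (cst 0)) => //.
  by near=> w; rewrite flat_npos// ltW//; near: w; exact: lt_nbhsl.
- rewrite !flat_npos// !mulr0 addr0.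
  have c0 := @continuous_flat0 k.+1.
  (* At 0 the difference quotient of one member is the next member, so continuity of the latter at 0
     is differentiability of the former. *)
  have E : (fun h => h^-1 *: ((flat k \o shift 0) (h *: 1) - flat k 0)) = flat k.+1.
    apply/funext => h /=; rewrite addr0 [h *: 1]mulr1 /flat ltxx subr0.
    rewrite -[_ *: _]/(_ * _); case: ifP => h0; last by rewrite mulr0.
    by rewrite mulrA -invfM -exprS.
  have f0 : flat k.+1 0 = 0 by rewrite /flat ltxx.
  have c1 : flat k.+1 h @[h --> 0^'] --> 0.
    by rewrite -{2}f0; exact: cvg_within_filter c0.
  apply: DeriveDef; last by rewrite /derive E; exact: cvg_lim.
  by rewrite /derivable E; apply/cvg_ex; exists 0.
Unshelve. all: by end_near. Qed.

End flat_exponentials.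

Section ramp.
Context (R : realType).
Implicit Types (d u : R).

(** For u > 0 this is u exp(-d/u), a smooth approximation from below of the positive part, off by at
    most [d]. Its slope (1 + d/u) exp(-d/u) is at most 1 because 1 + x <= exp x. *)
Definition ramp d u := u * flat d 0 u.

Definition dramp d u := flat d 0 u + d * flat d 1 u.

Lemma ramp_npos d u : u <= 0 -> ramp d u = 0.
Proof. by move=> u0; rewrite /ramp flat_npos// mulr0. Qed.

Lemma dramp_npos d u : u <= 0 -> dramp d u = 0.
Proof. by move=> u0; rewrite /dramp !flat_npos// mulr0 addr0. Qed.

Lemma rampE d u : 0 < u -> ramp d u = u * expR (- (d / u)).
Proof. by move=> u0; rewrite /ramp /flat u0 expr0 invr1 mul1r. Qed.

Lemma drampE d u : 0 < u -> dramp d u = (1 + d / u) * expR (- (d / u)).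
Proof. by move=> u0; rewrite /dramp /flat u0 expr0 invr1 expr1 mulrDl mulrA. Qed.

Lemma ramp_ge0 d u : 0 <= ramp d u.
Proof.
have [u0|u0] := leP u 0; first by rewrite ramp_npos.
by rewrite mulr_ge0 ?flat_ge0// ltW.
Qed.

Lemma dramp_ge0 d u : 0 <= d -> 0 <= dramp d u.
Proof. by move=> d0; rewrite addr_ge0 ?mulr_ge0 ?flat_ge0. Qed.

Lemma dramp_le1 d u : dramp d u <= 1.
Proof.
have [u0|u0] := leP u 0; first by rewrite dramp_npos.
by rewrite drampE// expRN ler_pdivrMr ?expR_gt0// mul1r expR_ge1Dx.
Qed.

Lemma ramp_le d u : 0 <= d -> 0 <= u -> ramp d u <= u.
Proof.
move=> d0; rewrite le_eqVlt => /predU1P[<-|u0]; first by rewrite ramp_npos.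
rewrite rampE// ger_pMr// expR_le1 oppr_le0 divr_ge0// ltW//.
Qed.

Lemma ramp_ge d u : 0 <= d -> u - d <= ramp d u.
Proof.
move=> d0; have [u0|u0] := leP u 0; first by rewrite ramp_npos// subr_le0 (le_trans u0).
rewrite rampE//; have := expR_ge1Dx (- (d / u)).
rewrite -(ler_pM2l u0); apply: le_trans.
by rewrite mulrDr mulr1 mulrN mulrCA divff ?gt_eqF// mulr1.
Qed.

Lemma is_derive_ramp d u : 0 < d -> is_derive u 1 (ramp d) (dramp d u).
Proof.
move=> d0; have hf := is_derive_flat d0 0 u.
have -> : ramp d = id * flat d 0 by [].
apply: is_derive_eq; rewrite -![_ *: _]/(_ * _) /dramp mulr1 oppr0 mul0r add0r.
rewrite addrC; congr (_ + _); rewrite mulrCA; congr (_ * _).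
have [u0|u0] := leP u 0; first by rewrite !flat_npos// mulr0.
by rewrite /flat u0 mulrA expr2 invfM mulrA divff ?gt_eqF// mul1r expr1.
Qed.

Lemma continuous_dramp d : 0 < d -> continuous (dramp d).
Proof.
move=> d0 u; apply: continuousD; first exact: is_derive_continuous (is_derive_flat d0 0 u).
by apply: continuousM; [exact: cvg_cst|exact: is_derive_continuous (is_derive_flat d0 1 u)].
Qed.

Lemma ramp_homo d : 0 < d -> {homo ramp d : u v / u <= v}.
Proof.
move=> d0 u v; rewrite le_eqVlt => /predU1P[->//|uv].
have [w w1 E] := @MVT R (ramp d) (dramp d) u v uv (fun w _ => is_derive_ramp w d0)
  (continuous_subspaceT (fun w => is_derive_continuous (is_derive_ramp w d0))).
by rewrite -subr_ge0 E mulr_ge0 ?dramp_ge0 ?subr_ge0 ?ltW.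
Qed.

Lemma ramp_lipschitz d u v : 0 < d -> u <= v -> ramp d v - ramp d u <= v - u.
Proof.
move=> d0; rewrite le_eqVlt => /predU1P[->|uv]; first by rewrite !subrr.
have [w w1 E] := @MVT R (ramp d) (dramp d) u v uv (fun w _ => is_derive_ramp w d0)
  (continuous_subspaceT (fun w => is_derive_continuous (is_derive_ramp w d0))).
by rewrite E ler_piMl ?dramp_le1// subr_ge0 ltW.
Qed.

Lemma ramp_anti d d' u : d' <= d -> ramp d u <= ramp d' u.
Proof.
move=> dd; have [u0|u0] := leP u 0; first by rewrite !ramp_npos.
by rewrite !rampE// ler_pM2l// ler_expR lerN2 ler_pM2r ?invr_gt0.
Qed.

End ramp.

(** * Directional derivatives *)

Lemma cvg_sum_seq (R : realType) (T I : Type) (F : set_system T) {FF : Filter F}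
    (s : seq I) (f : T -> I -> R) (l : I -> R) :
  (forall i, f t i @[t --> F] --> l i) ->
  \sum_(i <- s) f t i @[t --> F] --> \sum_(i <- s) l i.
Proof.
move=> fl; elim: s => [|i s IH].
  by under eq_fun do rewrite big_nil; rewrite big_nil; exact: cvg_cst.
by under eq_fun do rewrite big_cons; rewrite big_cons; exact: cvgD.
Qed.

Section rays.
Context (R : realType) (n : nat).
Implicit Types (f : 'rV[R]_n -> R) (x v : 'rV[R]_n).

Lemma is_derive_ray f x v (t d : R) :
  is_derive (x + t *: v) v f d <-> is_derive t 1 (fun t => f (x + t *: v)) d.
Proof.
have E : (fun h => h^-1 *: ((f \o shift (x + t *: v)) (h *: v) - f (x + t *: v))) =
    (fun h => h^-1 *: (((fun t => f (x + t *: v)) \o shift t) (h *: 1) - f (x + t *: v))).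
  apply/funext => h /=; congr (_ *: (f _ - _)).
  by rewrite [h *: 1]mulr1 scalerDl addrCA.
split=> -[].
  rewrite /derivable E => h1 h2; apply: DeriveDef => //.
  by rewrite -h2 /derive E.
rewrite /derivable -E => h1 h2; apply: DeriveDef => //.
by rewrite -h2 /derive E.
Qed.

Lemma partial_MVT f x (i : 'I_n) (c : R) :
  (forall t : R, `|t| <= `|c| -> derivable f (x + t *: delta_mx 0 i) (delta_mx 0 i)) ->
  exists2 t : R, `|t| <= `|c| &
    f (x + c *: delta_mx 0 i) - f x = c * partial i f (x + t *: delta_mx 0 i).
Proof.
move=> df; set e := delta_mx 0 i.
pose phi (t : R) := f (x + t *: e).
pose dphi (t : R) : R := partial i f (x + t *: e).
have dphiE (t : R) : `|t| <= `|c| -> is_derive t 1 phi (dphi t).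
  by move=> tc; apply/is_derive_ray; apply: derivableP; exact: df.
have cphi (t : R) : `|t| <= `|c| -> {for t, continuous phi}.
  by move=> tc; exact: is_derive_continuous (dphiE t tc).
have phi0 : phi 0 = f x by rewrite /phi scale0r addr0.
have [c0|c0] := leP 0 c.
- have [t||t tc E] := @MVT_segment R phi dphi 0 c c0.
  + rewrite in_itv/= => /andP[t0 tc]; apply: dphiE.
    by rewrite !ger0_norm// ltW.
  + apply: continuous_in_subspaceT => t; rewrite inE/= in_itv/= => /andP[t0 tc].
    by apply: cphi; rewrite !ger0_norm.
  exists t; first by move: tc; rewrite in_itv/= => /andP[t0 tc]; rewrite !ger0_norm.
  by rewrite -phi0 -/(phi c) E subr0 mulrC.
- have [t||t tc E] := @MVT_segment R phi dphi c 0 (ltW c0).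
  + rewrite in_itv/= => /andP[t0 tc]; apply: dphiE.
    by rewrite !ler0_norm ?lerN2// ltW.
  + apply: continuous_in_subspaceT => t; rewrite inE/= in_itv/= => /andP[t0 tc].
    by apply: cphi; rewrite !ler0_norm ?lerN2// ltW.
  exists t.
    by move: tc; rewrite in_itv/= => /andP[t0 tc]; rewrite !ler0_norm ?lerN2// ltW.
  by rewrite -phi0 -/(phi c) -opprB E sub0r mulrN opprK mulrC.
Qed.

(** The increment from x to x + h v is split into moves along one coordinate at a time. The mean
    value theorem turns each move into a partial derivative at a nearby point, and continuity of the
    partials at x gives the limit. *)
Lemma is_derive_partials f x v :
  (\forall y \near x, forall i, derivable f y (delta_mx 0 i)) ->
  (forall i, {for x, continuous (partial i f)}) ->
  is_derive x v f (\sum_i v 0 i * partial i f x).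
Proof.
move=> dfx cfx.
(* [tr k] keeps the first [k] coordinates of [v]; the increments [q h i] telescope. *)
pose tr (k : nat) : 'rV[R]_n := \row_i (if (i < k)%N then v 0 i else 0).
pose q (h : R) (i : 'I_n) := h^-1 * (f (x + h *: tr i.+1) - f (x + h *: tr i)).
have qE (h : R) : h^-1 *: ((f \o shift x) (h *: v) - f x) = \sum_i q h i.
  rewrite -mulr_sumr -(big_mkord xpredT (fun i => f (x + h *: tr i.+1) - f (x + h *: tr i))).
  rewrite telescope_sumr//= -[_ *: _]/(_ * _); congr (_ * (f _ - f _)).
    rewrite addrC; congr (_ + _ *: _); apply/rowP => i; rewrite mxE.
    by rewrite ltn_ord.
  by rewrite (_ : tr 0%N = 0) ?scaler0 ?addr0//; apply/rowP => i; rewrite !mxE.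
have cq i : q h i @[h --> 0^'] --> v 0 i * partial i f x.
  apply/cvgrPdist_lt => e e0.
  have ve0 : 0 < e / (`|v 0 i| + 1) by rewrite divr_gt0// ltr_wpDl.
  have /(cvgrPdist_lt _ _) /(_ _ ve0) cf := cfx i.
  have /nbhs_ballP[d /= d0 dP] : \forall y \near x,
      (forall i, derivable f y (delta_mx 0 i)) /\
      `|partial i f x - partial i f y| < e / (`|v 0 i| + 1).
    by apply: filterI.
  (* [V] strictly exceeds every coordinate of [v], so |h| V < d keeps the whole broken path in the
     sup-norm ball of radius [d]. *)
  pose V := \sum_j `|v 0 j| + 1.
  have V0 : 0 < V by rewrite ltr_wpDl// sumr_ge0.
  have vV j : `|v 0 j| < V.
    by rewrite /V (bigD1 j)//= -addrA ltrDl ltr_wpDl// sumr_ge0.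
  near=> h.
  have hV : `|h| * V < d.
    rewrite -ltr_pdivlMr//; near: h; apply: dnbhs0_lt; exact: divr_gt0.
  have h0 : h != 0 by near: h; exact: nbhs_dnbhs_neq.
  pose y := x + h *: tr i.
  have inb (t : R) : `|t| <= `|h * v 0 i| -> ball x d (y + t *: delta_mx 0 i).
    move=> tc; split=> // a b; rewrite -ball_normE/= /y !mxE ord1 eqxx/=.
    have [->|bi] := eqVneq b i.
      rewrite ltnn mulr0 addr0 mulr1 opprD addrA subrr sub0r normrN.
      apply: le_lt_trans tc _; apply: le_lt_trans hV.
      by rewrite normrM ler_wpM2l// ltW.
    rewrite mulr0 addr0 opprD addrA subrr sub0r normrN normrM.
    apply: le_lt_trans hV; rewrite ler_wpM2l//.
    by case: ifP => _; rewrite ?normr0 ?(ltW V0)// ltW.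
  have [t tc E] : exists2 t : R, `|t| <= `|h * v 0 i| &
      f (y + (h * v 0 i) *: delta_mx 0 i) - f y =
      h * v 0 i * partial i f (y + t *: delta_mx 0 i).
    by apply: partial_MVT => t tc; have [] := dP _ (inb t tc).
  have -> : q h i = v 0 i * partial i f (y + t *: delta_mx 0 i).
    rewrite /q -/y (_ : x + h *: tr i.+1 = y + (h * v 0 i) *: delta_mx 0 i).
      by rewrite E -mulrA mulKf.
    apply/rowP => j; rewrite !mxE eqxx/= ltnS leq_eqVlt -addrA; congr (_ + _).
    have [<-|ij] := eqVneq i j; first by rewrite eqxx ltnn mulr0 add0r mulr1.
    by rewrite -val_eqE eq_sym in ij; rewrite (negbTE ij)/= mulr0 addr0.
  rewrite -mulrBr normrM.
  have [_ pt] := dP _ (inb t tc).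
  apply: (@le_lt_trans _ _ (`|v 0 i| * (e / (`|v 0 i| + 1)))).
    by rewrite ler_wpM2l// ltW.
  rewrite mulrCA -[X in _ < X]mulr1 ltr_pM2l// ltr_pdivrMr ?ltr_wpDl// mul1r.
  by rewrite ltrDl.
have cs : \sum_i q h i @[h --> 0^'] --> \sum_i v 0 i * partial i f x.
  by apply: cvg_sum_seq => i; exact: cq.
apply: DeriveDef.
  rewrite /derivable; under eq_fun do rewrite qE.
  by apply/cvg_ex; eexists; exact: cs.
rewrite /derive; under eq_fun do rewrite qE.
exact: cvg_lim.
Unshelve. all: by end_near. Qed.

End rays.

(** * The inequality *)

(** [U] is the union of the cubes contained in it with rational centre and radius 1/(k+1); these are
    enumerated by [pickle]. *)
Lemma open_measurable_rV (R : realType) n (U : set 'rV[R]_n) :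
  open U -> measurable U.
Proof.
move=> oU.
pose box (q : 'rV[rat]_n * nat) : set 'rV[R]_n :=
  [set x | forall i, `](ratr (q.1 0 i) - q.2.+1%:R^-1), (ratr (q.1 0 i) + q.2.+1%:R^-1)[%classic (x 0 i)].
pose F k := if unpickle k is Some q then if `[< box q `<=` U >] then box q else set0
            else set0.
have -> : U = \bigcup_k F k.
  apply/seteqP; split => x; last first.
    by move=> [k _]; rewrite /F; case: unpickle => // q; case: asboolP => // + xq; apply.
  (* The radius [a] is below e/2 and the rational centre is within [a] of x, so every point of the
     cube is within 2a < e of x. *)
  move=> Ux; have /nbhs_ballP[e /= e0 eU] : nbhs x U by exact: open_nbhs_nbhs.
  pose m := Num.truncn (2 / e).
  have [a [a0 ae aE]] : exists a : R, [/\ 0 < a, a < e / 2 & a = m.+1%:R^-1].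
    exists m.+1%:R^-1; split => //.
    by rewrite -[e / 2]invrK ltf_pV2 ?posrE ?invr_gt0 ?divr_gt0// invf_div truncnS_gt.
  have /choice[q qP] : forall i, exists q : rat,
      (ratr q : R) \in `](x 0 i - a), (x 0 i + a)[.
    by move=> i; apply: rat_in_itvoo; lra.
  exists (pickle (\row_i q i, m)) => //; rewrite /F pickleK.
  case: asboolP => [_|].
    by move=> i; have := qP i; rewrite /= -aE mxE !in_itv/= => /andP[? ?]; apply/andP; split; lra.
  case=> y yq; apply: eU; split => // k i; rewrite ord1.
  have := yq i; have := qP i; rewrite /= -aE mxE !in_itv/= => /andP[? ?] /andP[? ?].
  by rewrite -ball_normE/= ltr_norml; apply/andP; split; lra.
apply: bigcup_measurable => k _; rewrite /F; case: unpickle => // q.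
case: asboolP => // _; apply: (measurable_coords (B := fun i =>
  `](ratr (q.1 0 i) - q.2.+1%:R^-1), (ratr (q.1 0 i) + q.2.+1%:R^-1)[%classic)) => i.
exact: measurable_itv.
Qed.

Lemma open_continuous_measurable_rV (R : realType) n (U : set 'rV[R]_n)
    (f : 'rV[R]_n -> R) :
  open U -> (forall x, U x -> {for x, continuous f}) -> measurable_fun U f.
Proof.
move=> oU cf; apply: (measurability _ (RGenOpens.measurableE R)).
move=> _ [_ [a [b ->] <-]]; apply: open_measurable_rV.
rewrite openE => x [Ux fx]; rewrite /interior.
apply: filterI; first exact: open_nbhs_nbhs.
by apply: cf => //; apply: open_nbhs_nbhs; split => //; exact: interval_open.
Qed.

Lemma powRD_gt0 (R : realType) (x a b : R) : 0 < x -> x `^ (a + b) = x `^ a * x `^ b.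
Proof. by move=> x0; rewrite powRD//; apply/implyP => _; rewrite gt_eqF. Qed.

Lemma invr_powR (R : realType) (x a : R) : 0 <= x -> (x^-1) `^ a = (x `^ a)^-1.
Proof. by move=> x0; rewrite -powR_inv1// powRAC powR_inv1// powR_ge0. Qed.

Section le_integral_nomeas.
Local Open Scope ereal_scope.
Context d (T : measurableType d) (R : realType).
Variable mu : {measure set T -> \bar R}.

Lemma ge0_le_integral_nomeasD (D : set T) (f g : T -> \bar R) :
  (forall x, D x -> 0 <= f x) -> (forall x, D x -> f x <= g x) ->
  \int[mu]_(x in D) f x <= \int[mu]_(x in D) g x.
Proof.
move=> f0 fg; rewrite integral_mkcond [leRHS]integral_mkcond.
apply: ge0_le_integral_nomeas => x; rewrite !patchE; case: ifPn => // /set_mem Dx.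
  exact: f0.
exact: fg.
Qed.

End le_integral_nomeas.

Section truncated_power.
Context (R : realType).
Variables (r d : R).
Hypotheses (r0 : 0 < r) (d0 : 0 < d).
Implicit Types y : R.

(* [ramp d] vanishes to the left of 0, so this truncation of [|y|^r] vanishes
   near 0 and is C^1. *)
Definition tpow y := ramp d (`|y| `^ r - d).

Definition dtpow y := dramp d (`|y| `^ r - d) * (r * `|y| `^ (r - 1) * Num.sg y).

Lemma norm_powR_near0 : \forall y \near (0 : R), `|y| `^ r <= d.
Proof.
have d1 : 0 < d `^ r^-1 by rewrite powR_gt0.
have : \forall y \near (0 : R), `|y| < d `^ r^-1.
  by have := @nbhs0_lt R R _ d1.
apply: filterS => y yd.
have -> : d = (d `^ r^-1) `^ r.
  by rewrite -powRrM mulVf ?gt_eqF// powRr1// ltW.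
by rewrite ge0_ler_powR ?nnegrE ?powR_ge0// ltW.
Qed.

Lemma is_derive_norm_powR y : y != 0 ->
  is_derive y 1 (fun y => `|y| `^ r) (r * `|y| `^ (r - 1) * Num.sg y).
Proof.
rewrite neq_lt => /orP[y0|y0].
- apply: (@near_eq_is_derive _ _ _ ((fun y => y `^ r) \o -%R)).
    near=> z; rewrite /= ltr0_norm//; near: z; exact: lt_nbhsl.
  have ny : 0 < - y by rewrite oppr_gt0.
  have h1 := is_derive1_powR r ny.
  have h2 : is_derive y 1 (-%R : R -> R) (- 1) by exact: is_deriveNid.
  by have := is_derive1_comp h1 h2; rewrite ltr0_norm// ltr0_sg.
- apply: (@near_eq_is_derive _ _ _ (fun y => y `^ r)).
    near=> z; rewrite /= gtr0_norm//; near: z; exact: lt_nbhsr.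
  by rewrite gtr0_norm// gtr0_sg// mulr1; exact: is_derive1_powR.
Unshelve. all: by end_near. Qed.

Lemma tpow_eq0 y : `|y| `^ r <= d -> tpow y = 0 /\ dtpow y = 0.
Proof.
by move=> yd; rewrite /tpow /dtpow ramp_npos ?dramp_npos ?mul0r// subr_le0.
Qed.

Lemma is_derive_tpow y : y != 0 -> is_derive y 1 tpow (dtpow y).
Proof.
move=> y0; have h1 := is_derive_norm_powR y0.
have h2 : is_derive y 1 (fun y => `|y| `^ r - d) (r * `|y| `^ (r - 1) * Num.sg y).
  have -> : (fun y => `|y| `^ r - d) = (fun y => `|y| `^ r) - cst d by [].
  by apply: is_derive_eq; rewrite subr0.
exact: (is_derive1_comp (is_derive_ramp _ d0) h2).
Qed.

Lemma continuous_dtpow y : y != 0 -> {for y, continuous dtpow}.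
Proof.
move=> y0; apply: continuousM.
  apply: continuous_comp; last exact: continuous_dramp.
  apply: continuousB; last exact: cvg_cst.
  exact: is_derive_continuous (is_derive_norm_powR y0).
have ny : 0 < `|y| by rewrite normr_gt0.
apply: continuousM.
  apply: continuousM; first exact: cvg_cst.
  apply: (@continuous_comp _ _ _ (@Num.norm _ R) (fun z => z `^ (r - 1))).
    exact: norm_continuous.
  exact: continuous_powR_gt0.
rewrite /prop_for /continuous_at; move: y0; rewrite neq_lt => /orP[y0|y0].
  rewrite ltr0_sg//; apply: (@cvg_trans _ ((fun=> -1 : R) @ nbhs y)); last exact: cvg_cst.
  by apply: near_eq_cvg; near=> z; rewrite ltr0_sg//; near: z; exact: lt_nbhsl.
rewrite gtr0_sg//; apply: (@cvg_trans _ ((fun=> 1 : R) @ nbhs y)); last exact: cvg_cst.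
by apply: near_eq_cvg; near=> z; rewrite gtr0_sg//; near: z; exact: lt_nbhsr.
Unshelve. all: by end_near. Qed.

(** The slope of the ramp is at most 1, so the bound does not depend on [d] and the truncation is
    removed later without loss in the constant. *)
Lemma norm_dtpow_le y : `|dtpow y| <= r * `|y| `^ (r - 1).
Proof.
have rp : 0 <= r * `|y| `^ (r - 1) by rewrite mulr_ge0 ?powR_ge0 ?ltW.
rewrite normrM (ger0_norm (dramp_ge0 _ (ltW d0))) normrM (ger0_norm rp).
apply: (@le_trans _ _ (r * `|y| `^ (r - 1) * `|Num.sg y|)).
  by rewrite ler_piMl ?dramp_le1// mulr_ge0.
by rewrite ler_piMr// normr_sg; case: (y != 0).
Qed.

Lemma tpow_le y : tpow y <= `|y| `^ r.
Proof.
rewrite /tpow; have [h|h] := leP (`|y| `^ r - d) 0.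
  by rewrite ramp_npos// powR_ge0.
by rewrite (le_trans (ramp_le (ltW d0) (ltW h)))// gerBl ltW.
Qed.

Lemma tpow_ge y : `|y| `^ r - 2 * d <= tpow y.
Proof.
have := ramp_ge (`|y| `^ r - d) (ltW d0); rewrite /tpow; lra.
Qed.

End truncated_power.

Section weak_inequality.
Context (R : realType) (n : nat).
Variables (p r alpha beta gamma : R).
Hypothesis n0 : (0 < n)%N.
Hypothesis p1 : 1 < p.
Hypothesis r0 : 0 < r.
Hypothesis r1 : r != 1.
Hypothesis gammaE : gamma * r = 1 + alpha + (p - 1) / p * beta.
Hypothesis m0 : 0 < n%:R - gamma * r.
Variable f : 'rV[R]_n -> R.
Hypothesis wf : weak_test_fun f.

Let m := n%:R - gamma * r.
Let mu := lebesgue_rV R n.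
Let cf : continuous f. Proof. by case: wf. Qed.
Let U := [set x | f x != 0].

Let oU : open U.
Proof.
rewrite (_ : U = f @^-1` [set y | y != 0])//; apply: open_comp => //.
Qed.

Let smoothU : smooth_on U f. Proof. by case: wf. Qed.

Let cpartial i x : U x -> {for x, continuous (partial i f)}.
Proof. by move=> Ux; have [] := smoothU [:: i] Ux. Qed.

Let is_derive_U x v : U x -> is_derive x v f (\sum_i v 0 i * partial i f x).
Proof.
move=> Ux; apply: is_derive_partials; last by move=> i; exact: cpartial.
have : nbhs x U by exact: open_nbhs_nbhs.
by apply: filterS => y Uy i; have [_] := smoothU [::] Uy; exact.
Qed.

(** A measurable minorant of the modulus of the radial derivative. It is set to 0 at the zeros of
    [f], where a weak test function need not be differentiable. *)
Let W x : R := if f x != 0 then `|\sum_i dir x 0 i * partial i f x| else 0.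

Let W_ge0 x : 0 <= W x. Proof. by rewrite /W; case: ifP. Qed.

Let W_le x : W x <= `|radial_derive f x|.
Proof.
rewrite /W; case: ifPn => // fx; rewrite /radial_derive.
by have [_ ->] := is_derive_U (dir x) fx.
Qed.

Let mf : measurable_fun setT f.
Proof. by apply: open_continuous_measurable_rV => [|x _]; [exact: openT|exact: cf]. Qed.

Let mU : measurable U. Proof. exact: open_measurable_rV. Qed.

Let mUb : measurable_fun setT (fun x => f x != 0).
Proof.
apply: (measurable_fun_bool true); rewrite setTI.
by rewrite (_ : _ @^-1` _ = U).
Qed.

Let mW : measurable_fun setT W.
Proof.
apply: measurable_fun_if => //.
rewrite setTI (_ : _ @^-1` _ = U)//.
apply: measurableT_comp => //; apply: measurable_sum => i.
apply: measurable_funM.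
  apply: measurable_funTS.
  exact: (measurableT_comp (measurable_coord i) (@measurable_dir R n)).
by apply: open_continuous_measurable_rV => // x; exact: cpartial.
Qed.

Let menorm a : measurable_fun setT (fun x : 'rV[R]_n => enorm x `^ a).
Proof. by apply: (measurableT_comp (measurable_powR _)); exact: measurable_enorm. Qed.

Let mpow (g : 'rV[R]_n -> R) a :
  measurable_fun setT g -> measurable_fun setT (fun x => g x `^ a).
Proof. by move=> mg; exact: (measurableT_comp (measurable_powR _)). Qed.

Let minv (g : 'rV[R]_n -> R) :
  measurable_fun setT g -> (forall x, 0 <= g x) -> measurable_fun setT (fun x => (g x)^-1).
Proof.
by move=> mg g0; under eq_fun do rewrite -powR_inv1//; exact: mpow.
Qed.

(** [A] and [B] are the Hoelder factors: A^p is bounded by the gradient integrand, and B^(p/(p-1))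
    is the potential integrand. *)
Let A x := W x / enorm x `^ alpha.
Let B x := (if f x != 0 then `|f x| `^ (r - 1) else 0) / enorm x `^ ((p - 1) / p * beta).

Let mA : measurable_fun setT A.
Proof. by apply: measurable_funM => //; apply: minv => // x; exact: powR_ge0. Qed.

Let mB : measurable_fun setT B.
Proof.
apply: measurable_funM; last by apply: minv => // x; exact: powR_ge0.
by apply: measurable_fun_ifT => //; apply: mpow; exact: measurableT_comp.
Qed.

Let A_ge0 x : 0 <= A x. Proof. by rewrite divr_ge0 ?powR_ge0. Qed.

Let B_ge0 x : 0 <= B x.
Proof. by rewrite divr_ge0 ?powR_ge0//; case: ifP => // _; rewrite powR_ge0. Qed.

Let ray_hardy (d : R) w : 0 < d -> @usphere R n w ->
  (\int[@lebesgue_measure R]_(t in `]0%R, +oo[)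
     (tpow r d (f (t *: w)) * t `^ (m - 1))%:E <=
   \int[@lebesgue_measure R]_(t in `]0%R, +oo[)
     (m^-1 * (r * ((if f (t *: w) != 0 then `|f (t *: w)| `^ (r - 1) else 0) *
       W (t *: w))) * t `^ m)%:E)%E.
Proof.
move=> d0 w1.
pose g t := f (t *: w).
pose dg t := \sum_i w 0 i * partial i f (t *: w).
have cray (t : R) : {for t, continuous (fun t : R => t *: w)}.
  by apply: scalel_continuous.
have cg (t : R) : {for t, continuous g}.
  by apply: continuous_comp; [exact: cray|exact: cf].
have gdg t : g t != 0 -> is_derive t 1 g (dg t).
  move=> gt; have := is_derive_U w gt; rewrite -[t *: w]add0r => /is_derive_ray.
  rewrite (_ : (fun t0 => f (0 + t0 *: w)) = g).
    by rewrite add0r.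
  by apply/funext => u; rewrite add0r.
have cdg t : g t != 0 -> {for t, continuous dg}.
  move=> gt; apply: cvg_sum_seq => i; apply: cvgMr.
  apply: (@continuous_comp _ _ _ (fun t : R => t *: w) (partial i f)); first exact: cray.
  exact: cpartial.
(* At a zero of [g] no derivative of [g] is needed: by continuity |g|^r is at most [d] nearby, so
   the truncated power vanishes identically there. *)
pose dh t := if g t != 0 then m^-1 * (dtpow r d (g t) * dg t) else 0.
have near0 t : g t = 0 -> \forall s \near t, `|g s| `^ r <= d.
  by move=> gt; have := norm_powR_near0 r0 d0; rewrite -gt => /(cg t).
have nearn t : g t != 0 -> \forall s \near t, g s != 0.
  move=> gt; have : nbhs (g t) [set y | y != 0].
    by apply: open_nbhs_nbhs; split => //; exact: open_neq.
  by move=> /(cg t).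
have [M gM] : exists M, forall t, M <= t -> g t = 0.
  have [_ cs _] := wf; have [M0 [_ M0P']] := compact_bounded cs.
  have M01 : M0 < M0 + 1 by rewrite ltrDl.
  have M0P := M0P' _ M01.
  have w0 : 0 < `|w|.
    rewrite normr_gt0; apply: contraPneq w1 => ->.
    by rewrite /usphere/= => /esym/eqP; rewrite (eqP (_ : enorm 0 == 0)) ?oner_eq0// enorm_eq0.
  exists (`|M0 + 1| / `|w| + 1) => t tM; apply: contrapT => /eqP gt.
  have t0 : 0 <= t by apply: le_trans tM; rewrite addr_ge0 ?divr_ge0.
  have : `|t *: w| <= M0 + 1 by apply: M0P; exact: subset_closure.
  rewrite normrZ ger0_norm// leNgt => /negP; apply.
  apply: le_lt_trans (ler_norm _) _.
  by rewrite -ltr_pdivrMr// (lt_le_trans _ tM)// ltrDl.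
have H := @radial_hardy R m M (fun t => m^-1 * tpow r d (g t)) dh m0.
have {}H : (\int[@lebesgue_measure R]_(t in `]0%R, +oo[)
     (m * (m^-1 * tpow r d (g t) * t `^ (m - 1)))%:E <=
   \int[@lebesgue_measure R]_(t in `]0%R, +oo[) (`|dh t| * t `^ m)%:E)%E.
  apply: H.
  - move=> t t0; rewrite /dh; case: ifPn => [gt|/negPn/eqP gt].
      apply: is_deriveZ.
      have h1 := is_derive_tpow r d0 gt; have h2 := gdg _ gt.
      exact: is_derive1_comp.
    apply: (@near_eq_is_derive _ _ _ (cst 0)) => //.
    near=> s; have /tpow_eq0[-> _] : `|g s| `^ r <= d by near: s; exact: near0.
    by rewrite mulr0.
  - move=> t t0; rewrite /prop_for /continuous_at.
    have [gt|gt] := eqVneq (g t) 0.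
      rewrite {2}/dh gt eqxx/=.
      apply: (@cvg_trans _ ((fun=> 0 : R) @ nbhs t)); last exact: cvg_cst.
      apply: near_eq_cvg; near=> s.
      have /tpow_eq0[_ E] : `|g s| `^ r <= d by near: s; exact: near0.
      by rewrite /dh E mul0r mulr0; case: ifP.
    rewrite {2}/dh gt/=.
    apply: (@cvg_trans _ ((fun s => m^-1 * (dtpow r d (g s) * dg s)) @ nbhs t)).
      apply: near_eq_cvg; near=> s; rewrite /dh ifT//.
      by near: s; exact: nearn.
    apply: cvgMr; apply: cvgM; last exact: cdg.
    by apply: continuous_comp; [exact: cg|exact: continuous_dtpow].
  - by move=> t t0; rewrite mulr_ge0 ?invr_ge0 ?(ltW m0)// ramp_ge0.
  - move=> t /gM ->.
    by have [->] := @tpow_eq0 R r d 0 (nbhs_singleton (norm_powR_near0 r0 d0)); rewrite mulr0.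
rewrite (_ : (\int[_]_(t in _) (m * _)%:E)%E = (\int[@lebesgue_measure R]_(t in `]0%R, +oo[)
     (tpow r d (f (t *: w)) * t `^ (m - 1))%:E)%E) in H; last first.
  by apply: eq_integral => t _; rewrite mulrA mulrA divff ?mul1r// gt_eqF.
apply: le_trans H _; apply: ge0_le_integral_nomeasD => t; rewrite /= in_itv/= andbT => t0.
  by rewrite lee_fin mulr_ge0 ?powR_ge0.
rewrite lee_fin ler_wpM2r ?powR_ge0// /dh /W -/(g t); case: ifPn => gt; last first.
  by rewrite normr0 !mulr0.
rewrite dir_ray// normrM ger0_norm ?invr_ge0 ?(ltW m0)// ler_pM2l ?invr_gt0//.
by rewrite normrM mulrA ler_wpM2r// norm_dtpow_le.
Unshelve. all: by end_near. Qed.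

Let powR_nat_mulE a (t : R) : 0 < t -> t `^ a * t ^+ n.-1 = t `^ (a + n%:R - 1).
Proof.
move=> t0; rewrite -powR_mulrn ?(ltW t0)// -powRD_gt0//.
by congr (_ `^ _); rewrite -[in RHS](prednK n0) -natr1; ring.
Qed.

Let tpow_hardy d : 0 < d ->
  (\int[mu]_x (tpow r d (f x) / enorm x `^ (gamma * r))%:E <=
   \int[mu]_x (m^-1 * (r * (A x * B x)))%:E)%E.
Proof.
move=> d0.
have mtr : measurable_fun setT (tpow r d).
  rewrite /tpow; apply: (@measurableT_comp _ _ _ _ _ _ (ramp d)).
    by apply: continuous_measurable_fun => u; exact: is_derive_continuous (is_derive_ramp u d0).
  apply: measurable_funB => //.
  by apply: (measurableT_comp (measurable_powR r)).
rewrite (@ge0_integral_polar _ _ (fun x => (tpow r d (f x) / enorm x `^ (gamma * r))%:E))//; last 2 first.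
- apply/measurable_EFinP; apply: measurable_funM; first exact: measurableT_comp.
  by apply: minv => // x; exact: powR_ge0.
- by move=> x; rewrite lee_fin divr_ge0 ?ramp_ge0 ?powR_ge0.
rewrite (@ge0_integral_polar _ _ (fun x => (m^-1 * (r * (A x * B x)))%:E))//; last 2 first.
- apply/measurable_EFinP; apply: measurable_funM => //.
  by apply: measurable_funM => //; exact: measurable_funM.
- by move=> x; rewrite lee_fin mulr_ge0 ?invr_ge0 ?(ltW m0)// mulr_ge0 ?(ltW r0)// mulr_ge0.
apply: ge0_le_integral_nomeasD => w w1.
  apply: integral_ge0 => t /=; rewrite in_itv/= andbT => t0.
  rewrite -EFinM lee_fin mulr_ge0 ?divr_ge0 ?ramp_ge0 ?powR_ge0//.
  by rewrite exprn_ge0// ltW.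
apply: (@le_trans _ _ (\int[@lebesgue_measure R]_(t in `]0%R, +oo[)
     (tpow r d (f (t *: w)) * t `^ (m - 1))%:E)%E).
  rewrite le_eqVlt; apply/orP; left; apply/eqP; apply: eq_integral => t.
  rewrite inE/= in_itv/= andbT => t0; rewrite -EFinM; congr EFin.
  rewrite enorm_ray ?(ltW t0)// -mulrA -powRN powR_nat_mulE//.
  by congr (_ * _ `^ _); rewrite /m; ring.
apply: le_trans (ray_hardy d0 w1) _.
rewrite le_eqVlt; apply/orP; left; apply/eqP; apply: eq_integral => t.
rewrite inE/= in_itv/= andbT => t0; rewrite -EFinM; congr EFin.
rewrite /A /B enorm_ray ?(ltW t0)// -!powRN.
(* The relation between gamma, alpha and beta says exactly that t^m splits into the two Hoelder
   weights and the Jacobian. *)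
have -> : t `^ m = t `^ (- alpha) * t `^ (- ((p - 1) / p * beta)) * t ^+ n.-1.
  by rewrite -powRD_gt0// powR_nat_mulE//; congr (_ `^ _); rewrite /m gammaE; ring.
move: (W _) (if _ then _ else _) (t `^ (- alpha)) (t `^ _) (t ^+ _) => a b c e g.
ring.
Qed.

(** The truncation level runs through 1/(k+1). The ramp increases in its argument and decreases in
    its parameter, so the truncated powers increase to |f|^r and monotone convergence applies. *)
Let hardy : (\int[mu]_x (`|f x| `^ r / enorm x `^ (gamma * r))%:E <=
   (m^-1 * r)%:E * \int[mu]_x (A x * B x)%:E)%E.
Proof.
rewrite -ge0_integralZl//; last 3 first.
- by apply/measurable_EFinP; exact: measurable_funM.
- by move=> x _; rewrite lee_fin mulr_ge0.
- by rewrite lee_fin mulr_ge0 ?invr_ge0 ?(ltW m0)// ltW.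
under [leRHS]eq_integral do rewrite -EFinM -mulrA.
pose g k x := (tpow r k.+1%:R^-1 (f x) / enorm x `^ (gamma * r))%:E.
have d0 k : 0 < k.+1%:R^-1 :> R by rewrite invr_gt0.
have mg k : measurable_fun setT (g k).
  apply/measurable_EFinP; apply: measurable_funM; last by apply: minv => // x; exact: powR_ge0.
  rewrite /tpow; apply: (@measurableT_comp _ _ _ _ _ _ (ramp k.+1%:R^-1)).
    by apply: continuous_measurable_fun => u; exact: is_derive_continuous (is_derive_ramp u (d0 k)).
  by apply: measurable_funB => //; apply: mpow; exact: measurableT_comp.
have g0 k x : setT x -> (0 <= g k x)%E.
  by move=> _; rewrite lee_fin divr_ge0 ?ramp_ge0 ?powR_ge0.
have ndg x : setT x -> {homo g^~ x : k l / (k <= l)%N >-> (k <= l)%E}.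
  move=> _ k l kl; rewrite lee_fin ler_wpM2r ?invr_ge0 ?powR_ge0// /tpow.
  have kl' : l.+1%:R^-1 <= k.+1%:R^-1 :> R by rewrite lef_pV2 ?posrE// ler_nat ltnS.
  by rewrite (le_trans (ramp_anti _ kl'))// ramp_homo// lerB.
have limg x : limn (g^~ x) = (`|f x| `^ r / enorm x `^ (gamma * r))%:E.
  apply/cvg_lim => //; apply/fine_cvgP; split; first exact: nearW.
  apply: cvgMl.
  apply: (@squeeze_cvgr _ _ _ _ (fun k => `|f x| `^ r - 2 * k.+1%:R^-1) (fun=> `|f x| `^ r)).
  - by apply: nearW => k; rewrite tpow_ge// tpow_le.
  - rewrite -[X in _ --> X]subr0; apply: cvgB; first exact: cvg_cst.
    by rewrite -(mulr0 2); apply: cvgMr; exact: cvg_harmonic.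
  - exact: cvg_cst.
rewrite [leLHS](_ : _ = \int[mu]_x limn (g^~ x))%E; last first.
  by apply: eq_integral => x _; rewrite limg.
rewrite (monotone_convergence _ measurableT mg g0 ndg).
apply: lime_le.
  apply: ereal_nondecreasing_is_cvgn => k l kl; apply: ge0_le_integral => //.
    by move=> x _; exact: g0.
  by move=> x _; exact: ndg.
by apply: nearW => k; exact: tpow_hardy.
Qed.

Theorem ckn_ineq_weak (D : set 'rV[R]_n) : (forall x, f x != 0 -> D x) ->
  ckn_ineq p r alpha beta gamma D (r / (n%:R - gamma * r)) f.
Proof.
move=> fD; rewrite /ckn_ineq /ckn_lhs /ckn_rhs.
have p0 : 0 < p by exact: lt_trans p1.
apply: le_trans hardy _.
rewrite [in leLHS]mulrC; apply: lee_wpmul2l; first by rewrite lee_fin divr_ge0// ltW.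
have q0 : 0 < p / (p - 1) by rewrite divr_gt0// subr_gt0.
have pq : p^-1 + (p / (p - 1))^-1 = 1.
  by rewrite invf_div; field; rewrite gt_eqF.
have := hoelder mu mA mB p0 q0 pq.
rewrite Lnorm1 unlock /=.
rewrite (_ : (\int[mu]_x `|A x * B x|%:E)%E = (\int[mu]_x (A x * B x)%:E)%E); last first.
  by apply: eq_integral => x _; rewrite ger0_norm// mulr_ge0.
move=> /le_trans; apply; rewrite invf_div; apply: lee_pmul.
- exact: poweR_ge0.
- exact: poweR_ge0.
- apply: gt0_ler_poweR.
  + by rewrite invr_ge0 ltW.
  + by rewrite in_itv/= leey andbT; apply: integral_ge0 => x _; rewrite lee_fin powR_ge0.
  + by rewrite in_itv/= leey andbT; apply: integral_ge0 => x _; rewrite lee_fin divr_ge0 ?powR_ge0.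
  (* The upper integrand contains the radial derivative, so monotonicity without measurability is
     used. *)
  apply: ge0_le_integral_nomeas => x; first by rewrite lee_fin powR_ge0.
  rewrite lee_fin ger0_norm// /A powRM ?invr_ge0 ?powR_ge0// invr_powR ?powR_ge0// -powRrM.
  rewrite ler_wpM2r ?invr_ge0 ?powR_ge0// ge0_ler_powR ?nnegrE ?(ltW p0)//.
- rewrite le_eqVlt; apply/orP; left; apply/eqP; congr (_ `^ _)%E.
  rewrite /ckn_pot [RHS]integral_mkcond; apply: eq_integral => x _.
  have e0 : p * (r - 1) / (p - 1) != 0.
    rewrite !mulf_eq0 invr_eq0 !negb_or !subr_eq0 r1 !andbT.
    by rewrite !gt_eqF.
  rewrite patchE; have [fx|fx] := eqVneq (f x) 0.
    rewrite /B fx eqxx/= mul0r normr0 powR0 ?gt_eqF//.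
    by rewrite powR0// mul0r; case: ifP.
  rewrite mem_set; last exact: fD.
  rewrite ger0_norm// /B fx.
  rewrite powRM ?invr_ge0 ?powR_ge0// invr_powR ?powR_ge0// -!powRrM; congr (_ `^ _ / _ `^ _)%:E.
    by rewrite mulrA [(r - 1) * p]mulrC.
  by field; rewrite ?gt_eqF// ?subr_gt0.
Qed.

End weak_inequality.

(** * Extremal profiles on a ray *)

Lemma continuous_comp_powR (R : realType) (T : topologicalType) (G : T -> R) (k : R) t :
  0 < G t -> {for t, continuous G} -> {for t, continuous (fun t => G t `^ k)}.
Proof.
move=> G0 cG; apply: (@continuous_comp _ _ _ G (fun z => z `^ k)); first exact: cG.
exact: continuous_powR_gt0.
Qed.

Lemma powRB1_mulr (R : realType) (t m : R) : 0 < t -> t `^ (m - 1) * t = t `^ m.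
Proof. by move=> t0; rewrite -[X in _ * X](powRr1 (ltW t0)) -powRD_gt0// subrK. Qed.

Section ray_estimates.
Context (R : realType).
Local Notation mu := (@lebesgue_measure R).
Variables (p r s m a : R).
Hypotheses (p1 : 1 < p) (r0 : 0 < r) (r1 : r != 1) (m0 : 0 < m) (a0 : 0 <= a).
Let sigma := (r - 1) / (p - 1).
Let e0 := p * (r - 1) / (p - 1).
Implicit Types G : R -> R.

(** Inserting the ODE into (G^r)' turns G^(r-1) G^sigma into the power of the potential term. *)
Let e0E : e0 = r - 1 + sigma.
Proof. by rewrite /e0 /sigma; field; rewrite gt_eqF// subr_gt0. Qed.

Let sigma0 : sigma != 0.
Proof. by rewrite mulf_neq0 ?invr_eq0 ?subr_eq0// gt_eqF. Qed.

Let e00 : e0 != 0.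
Proof. by rewrite /e0 -mulrA mulf_neq0// gt_eqF// (lt_trans ltr01). Qed.

Let is_derive_u G t : 0 < t -> 0 < G t ->
  is_derive t 1 G (- (a * t `^ (s - 1) * G t `^ sigma)) ->
  is_derive t 1 (fun t => m^-1 * G t `^ r) (- (r / m * a * G t `^ e0 * t `^ (s - 1))).
Proof.
move=> t0 G0 dG; have h1 := is_derive1_powR r G0.
have h2 := is_derive1_comp h1 dG.
have : is_derive t 1 (fun t => m^-1 * G t `^ r)
  (m^-1 * (r * G t `^ (r - 1) * - (a * t `^ (s - 1) * G t `^ sigma))).
  exact: is_deriveZ.
congr (is_derive _ _ _ _); rewrite e0E [_ `^ (_ + sigma)]powRD_gt0//.
by move: (_ `^ (r - 1)) (_ `^ sigma) (_ `^ (s - 1)) => x y z; ring.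
Qed.

Let continuous_v G t : 0 < t -> 0 < G t -> {for t, continuous G} ->
  {for t, continuous (fun t => r / m * a * G t `^ e0 * t `^ (s - 1))}.
Proof.
move=> t0 G0 cG; apply: continuous_mul_powR => //.
apply: continuousM; first exact: cvg_cst.
exact: continuous_comp_powR.
Qed.

Let cst_ge0 : 0 <= r / m * a.
Proof. by rewrite mulr_ge0// divr_ge0// ltW. Qed.

(** The first part is integration by parts for G^r / m. The second integrates the bound G^r t^(m-1)
    <= C t^(k-1); being explicit in [C] and [L], it can later be integrated over the sphere. *)
Lemma ray_bounded G (L C k : R) : 0 < L -> 0 < k ->
  (forall t : R, 0 < t < L -> 0 < G t) -> (forall t, L <= t -> G t = 0) ->
  (forall t : R, 0 < t < L -> is_derive t 1 G (- (a * t `^ (s - 1) * G t `^ sigma))) ->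
  G t @[t --> L^'-] --> 0 ->
  (forall t : R, 0 < t < L -> G t `^ r * t `^ m <= C * t `^ k) ->
  (\int[mu]_(t in `]0%R, +oo[) (G t `^ r * t `^ (m - 1))%:E =
   \int[mu]_(t in `]0%R, +oo[) (r / m * a * G t `^ e0 * t `^ (s - 1) * t `^ m)%:E)%E /\
  (\int[mu]_(t in `]0%R, +oo[) (G t `^ r * t `^ (m - 1))%:E <= (C * (L `^ k / k))%:E)%E.
Proof.
move=> L0 k0 G0 GL dG GL0 GC.
have GrL : G t `^ r @[t --> L^'-] --> 0.
  apply/cvgrPdist_le => e epos.
  have /cvgrPdist_le /(_ (e `^ r^-1)) := GL0.
  rewrite powR_gt0// => /(_ isT) H.
  near=> t; rewrite sub0r normrN ger0_norm ?powR_ge0//.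
  have tL : 0 < t < L by apply/andP; split; near: t; [exact: nbhs_left_gt|exact: nbhs_left_lt].
  have -> : e = (e `^ r^-1) `^ r by rewrite -powRrM mulVf ?gt_eqF// powRr1// ltW.
  rewrite ge0_ler_powR ?nnegrE ?powR_ge0 ?(ltW r0) ?(ltW (G0 _ tL))//.
  have : `|0 - G t| <= e `^ r^-1 by near: t.
  by rewrite sub0r normrN gtr0_norm// G0.
have onL (h : R -> R) : (forall t, L <= t -> h t = 0) ->
    (\int[mu]_(t in `]0%R, +oo[) (h t)%:E = \int[mu]_(t in `]0%R, L[) (h t)%:E)%E.
  move=> hL; rewrite integral_mkcond [RHS]integral_mkcond; apply: eq_integral => t _.
  rewrite !patchE !mem_setE !in_itv/= andbT; case: (0 < t) => //=.
  by case: ltP => // /hL ->.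
rewrite !onL; last 2 first.
- by move=> t /GL ->; rewrite powR0// mulr0 !mul0r.
- by move=> t /GL ->; rewrite powR0 ?gt_eqF// mul0r.
have cG t : 0 < t < L -> {for t, continuous G}.
  by move=> tL; exact: is_derive_continuous (dG t tL).
split.
  have E t : G t `^ r * t `^ (m - 1) = m * (m^-1 * G t `^ r * t `^ (m - 1)).
    by rewrite !mulrA divff ?mul1r// gt_eqF.
  under eq_integral do rewrite E.
  apply: (@radial_by_parts_bounded R L (m^-1 * C) k m (fun t => m^-1 * G t `^ r)
    (fun t => r / m * a * G t `^ e0 * t `^ (s - 1))) => //.
  - by move=> t tL; apply: is_derive_u; [case/andP: tL|exact: G0|exact: dG].
  - by move=> t tL; apply: continuous_v; [case/andP: tL|exact: G0|exact: cG].
  - by move=> t tL; rewrite mulr_ge0 ?powR_ge0// invr_ge0 ltW.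
  - by move=> t tL; rewrite mulr_ge0 ?powR_ge0// mulr_ge0 ?powR_ge0.
  - by move=> t tL; rewrite -!mulrA ler_pM2l ?invr_gt0// GC.
  - by rewrite -[X in _ --> X](mulr0 m^-1); apply: cvgMr.
rewrite EFinM -integral_powR_bounded// -ge0_integralZl//; last 3 first.
- apply/measurable_EFinP; apply: open_continuous_measurable_fun => // t.
  by rewrite inE/= in_itv/= => /andP[t0 _]; exact: continuous_powR_gt0.
- by move=> t _; rewrite lee_fin powR_ge0.
(* Any point of the interval shows that [C] is nonnegative; the midpoint is taken. *)
- have tL : 0 < L / 2 < L by apply/andP; split; lra.
  have := GC _ tL; rewrite lee_fin; have : 0 < (L / 2) `^ k by rewrite powR_gt0//; lra.
  move=> Lk H; rewrite -(pmulr_lge0 _ Lk); apply: le_trans H.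
  by rewrite mulr_ge0 ?powR_ge0.
apply: ge0_le_integral_nomeasD => t; rewrite /= in_itv/= => tL.
  by rewrite lee_fin mulr_ge0 ?powR_ge0.
have t0 : 0 < t by case/andP: tL.
rewrite -EFinM lee_fin -(ler_pM2r t0).
have := GC t tL; rewrite -(powRB1_mulr m t0) mulrA => /le_trans; apply.
by rewrite -mulrA powRB1_mulr.
Unshelve. all: by end_near. Qed.

(** [L] is a free radius: the bound by [C1] is integrated below it and the bound by [C2] above
    it. *)
Lemma ray_unbounded G (L C1 C2 k1 k2 : R) : 0 < L -> 0 < k1 -> 0 < k2 ->
  (forall t : R, 0 < t -> 0 < G t) ->
  (forall t : R, 0 < t -> is_derive t 1 G (- (a * t `^ (s - 1) * G t `^ sigma))) ->
  (forall t : R, 0 < t -> G t `^ r * t `^ m <= C1 * t `^ k1) ->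
  (forall t : R, 0 < t -> G t `^ r * t `^ m <= C2 * t `^ (- k2)) ->
  (\int[mu]_(t in `]0%R, +oo[) (G t `^ r * t `^ (m - 1))%:E =
   \int[mu]_(t in `]0%R, +oo[) (r / m * a * G t `^ e0 * t `^ (s - 1) * t `^ m)%:E)%E /\
  (\int[mu]_(t in `]0%R, +oo[) (G t `^ r * t `^ (m - 1))%:E <=
    (C1 * (L `^ k1 / k1) + C2 * (L `^ (- k2) / k2))%:E)%E.
Proof.
move=> L0 k10 k20 G0 dG GC1 GC2.
have cG t : 0 < t -> {for t, continuous G}.
  by move=> t0; exact: is_derive_continuous (dG t t0).
have Cpos C k : (forall t : R, 0 < t -> G t `^ r * t `^ m <= C * t `^ k) -> 0 <= C.
  move=> /(_ 1 ltr01); rewrite !powR1 !mulr1; apply: le_trans; exact: powR_ge0.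
split.
  have E t : G t `^ r * t `^ (m - 1) = m * (m^-1 * G t `^ r * t `^ (m - 1)).
    by rewrite !mulrA divff ?mul1r// gt_eqF.
  under eq_integral do rewrite E.
  apply: (@radial_by_parts_unbounded R (m^-1 * C1) (m^-1 * C2) k1 k2 m
    (fun t => m^-1 * G t `^ r) (fun t => r / m * a * G t `^ e0 * t `^ (s - 1))) => //.
  - by move=> t t0; apply: is_derive_u; [|exact: G0|exact: dG].
  - by move=> t t0; apply: continuous_v; [|exact: G0|exact: cG].
  - by move=> t t0; rewrite mulr_ge0 ?powR_ge0// invr_ge0 ltW.
  - by move=> t t0; rewrite mulr_ge0 ?powR_ge0// mulr_ge0 ?powR_ge0.
  - by move=> t t0; rewrite -!mulrA ler_pM2l ?invr_gt0// GC1.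
  - by move=> t t0; rewrite -!mulrA ler_pM2l ?invr_gt0// GC2.
have -> : (`]0%R, +oo[%classic : set R) = `]0%R, L[%classic `|` `[L, +oo[%classic.
  apply/seteqP; split => t /=; rewrite !in_itv/= ?andbT.
    by move=> t0; case: (ltP t L) => tL; [left; rewrite t0|right].
  by case=> [/andP[]//|]; exact: lt_le_trans.
rewrite ge0_integral_setU//=; last 3 first.
- rewrite (_ : _ `|` _ = `]0%R, +oo[%classic).
    apply/measurable_EFinP; apply: measurable_fun_gt0_continuous => t t0.
    apply: continuous_mul_powR => //.
    by apply: continuous_comp_powR; [exact: G0|exact: cG].
  apply/seteqP; split => t /=; rewrite !in_itv/= ?andbT.
    by case=> [/andP[]//|]; exact: lt_le_trans.
  by move=> t0; case: (ltP t L) => tL; [left; rewrite t0|right].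
- by move=> t _; rewrite lee_fin mulr_ge0 ?powR_ge0.
- apply/disj_set2P; apply/seteqP; split => t //= [].
  by rewrite !in_itv/= andbT leNgt => /andP[_ ->].
rewrite EFinD; apply: leeD.
- rewrite EFinM -integral_powR_bounded// -ge0_integralZl//; last 3 first.
  + apply/measurable_EFinP; apply: open_continuous_measurable_fun => // t.
    by rewrite inE/= in_itv/= => /andP[t0 _]; exact: continuous_powR_gt0.
  + by move=> t _; rewrite lee_fin powR_ge0.
  + by rewrite lee_fin; exact: Cpos GC1.
  apply: ge0_le_integral_nomeasD => t; rewrite /= in_itv/= => /andP[t0 tL].
    by rewrite lee_fin mulr_ge0 ?powR_ge0.
  rewrite -EFinM lee_fin -(ler_pM2r t0).
  have := GC1 t t0; rewrite -(powRB1_mulr m t0) mulrA => /le_trans; apply.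
  by rewrite -mulrA powRB1_mulr.
- rewrite EFinM -integral_powR_unbounded// -ge0_integralZl//; last 3 first.
  + apply/measurable_EFinP; apply: measurable_funTS.
    by apply: (measurableT_comp (measurable_powR _)).
  + by move=> t _; rewrite lee_fin powR_ge0.
  + by rewrite lee_fin; exact: Cpos GC2.
  apply: ge0_le_integral_nomeasD => t; rewrite /= in_itv/= andbT => tL.
    by rewrite lee_fin mulr_ge0 ?powR_ge0.
  have t0 : 0 < t by exact: lt_le_trans tL.
  rewrite -EFinM lee_fin -(ler_pM2r t0).
  have := GC2 t t0; rewrite -(powRB1_mulr m t0) mulrA => /le_trans; apply.
  by rewrite -mulrA powRB1_mulr.
Qed.

End ray_estimates.

(** * Extremal functions *)

(** The equality case of Hoelder as it is used: [X] is the potential integral and the gradient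
    integral is a^p X. Infinite [X] is allowed, so no finiteness has to be shown beforehand. *)
Lemma holder_scale (R : realType) (a p : R) (X : \bar R) :
  0 <= a -> 1 < p -> (0 <= X)%E ->
  (((a `^ p)%:E * X) `^ p^-1 * X `^ ((p - 1) / p) = a%:E * X)%E.
Proof.
move=> a0 p1; have p0 : 0 < p by exact: lt_trans p1.
have q0 : (p - 1) / p != 0 by rewrite mulf_neq0 ?invr_eq0 ?gt_eqF// subr_gt0.
have pV0 : p^-1 != 0 by rewrite invr_eq0 gt_eqF.
case: X => [t|_|//]; last first.
  move: a0; rewrite le_eqVlt => /predU1P[<-|a0].
    by rewrite powR0 ?gt_eqF// !mul0e poweR0r// mul0e.
  by rewrite !gt0_muley ?lte_fin ?powR_gt0// !poweRyr// mulyy.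
rewrite lee_fin => t0; rewrite -(EFinM (a `^ p) t) !poweR_EFin -!EFinM; congr EFin.
rewrite powRM ?powR_ge0// -powRrM mulfV ?gt_eqF// powRr1// -mulrA; congr (_ * _).
move: t0; rewrite le_eqVlt => /predU1P[<-|t0]; first by rewrite !powR0 ?mul0r.
by rewrite -powRD_gt0// (_ : _ + _ = 1) ?powRr1// ?(ltW t0)//; field; rewrite gt_eqF.
Qed.

Section functions_of_direction.
Context (R : realType) (n : nat).
Hypothesis n0 : (0 < n)%N.
Let mu := lebesgue_rV R n.

Lemma measurable_fun_dir (h : 'rV[R]_n -> R) (c : R) :
  measurable_fun (@usphere R n) h ->
  measurable_fun setT (fun x : 'rV[R]_n => if x == 0 then c else h (dir x)).
Proof.
move=> mh.
have m0 := @measurable_rV0 R n.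
apply: measurable_fun_if => //.
- apply: (measurable_fun_bool true); rewrite setTI (_ : _ @^-1` _ = [set 0])//.
  by apply/seteqP; split => x /eqP.
rewrite setTI.
apply: (@measurable_comp _ _ _ _ _ _ (@usphere R n)) => //.
- exact: measurable_usphere.
- move=> _ [x /= x0 <-]; apply: usphere_dir.
  by apply: contraFneq x0 => ->.
- apply: measurable_funTS; exact: measurable_dir.
Qed.

(** In polar coordinates each ray meets the graph of [L] in at most one point. The graph is the set
    of radii where a profile reaches 0 and may have a corner. *)
Lemma negligible_radial_graph (L : 'rV[R]_n -> R) :
  measurable_fun (@usphere R n) L ->
  {ae mu, forall x, x != 0 /\ enorm x != L (dir x)}.
Proof.
move=> mL; pose La (x : 'rV[R]_n) := if x == 0 then 0 else L (dir x).
have mLa : measurable_fun setT La by exact: measurable_fun_dir.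
pose M := [set x : 'rV[R]_n | enorm x - La x = 0] `\ (0 : 'rV[R]_n).
have mM : measurable M.
  apply: measurableD; last exact: measurable_rV0.
  rewrite -[X in measurable X]setTI.
  exact: (measurable_funB (@measurable_enorm R n) mLa measurableT (measurable_set1 (0 : R))).
have M0 : mu M = 0%E.
  rewrite -[M]setIT -integral_indic// ge0_integral_polar//; last first.
    by apply/measurable_EFinP; exact: measurable_indic.
  rewrite integral0_eq// => w w1.
  rewrite (_ : \int[_]_(t in _) _ =
    \int[@lebesgue_measure R]_(t in `]0%R, +oo[ `&` [set L w])
      ((\1_M (t *: w))%:E * (t ^+ n.-1)%:E))%E; last first.
    rewrite integral_mkcondr; apply: eq_integral => t; rewrite inE/= in_itv/= andbT => t0.
    rewrite patchE; case: ifPn => // tL; rewrite indicE memNset ?mul0e// => -[/= + _].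
    rewrite enorm_ray ?(ltW t0)// /La -enorm_eq0 enorm_ray ?(ltW t0)// gt_eqF// dir_ray//.
    move=> /eqP; rewrite subr_eq0 => /eqP E.
    by move: tL; rewrite notin_setE; apply.
  by apply: integral_Sset1; exact: subIsetr.
exists (M `|` [set (0 : 'rV[R]_n)]); split.
- by apply: measurableU => //; exact: measurable_rV0.
- have := lebesgue_rV_set0 R n0; rewrite -/mu => m00.
  by rewrite null_set_setU//; exact: measurable_rV0.
- move=> x /= H; have [->|x0] := eqVneq x 0; first by right.
  left; split => //=; last exact/eqP.
  apply/eqP; rewrite /La (negbTE x0) subr_eq0; apply: contrapT => /negP xL.
  by apply: H; split.
Qed.

End functions_of_direction.

Lemma measurable_div_enorm (R : realType) n (u : 'rV[R]_n -> R) (e : R) :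
  measurable_fun setT u -> measurable_fun setT (fun x => u x / enorm x `^ e).
Proof.
move=> mu; apply: measurable_funM => //; under eq_fun do rewrite -powRN.
by apply: (measurableT_comp (measurable_powR _)); exact: measurable_enorm.
Qed.

Lemma ckn_pot_domain (R : realType) n (p r beta : R) (f : 'rV[R]_n -> R) :
  1 < p -> r != 1 -> ckn_pot p r beta (ckn_domain r f) f = ckn_pot p r beta setT f.
Proof.
move=> p1 r1; have e00 : p * (r - 1) / (p - 1) != 0.
  by rewrite !mulf_neq0 ?invr_eq0 ?subr_eq0 ?(gt_eqF p1) ?(gt_eqF (lt_trans ltr01 p1)).
rewrite /ckn_pot integral_mkcond; apply: eq_integral => x _; rewrite patchE.
case: ifPn => // /negP xD.
have fx : f x = 0.
  apply: contrapT => /eqP fx; apply: xD; rewrite inE /ckn_domain.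
  by case: ifP => // _; exact: subset_closure.
by rewrite fx normr0 powR0// mul0r.
Qed.

Section extremal_core.
Context (R : realType) (n : nat).
Variables (p r alpha beta gamma : R).
Hypothesis n0 : (0 < n)%N.
Hypothesis p1 : 1 < p.
Hypothesis r0 : 0 < r.
Hypothesis r1 : r != 1.
Hypothesis gammaE : gamma * r = 1 + alpha + (p - 1) / p * beta.
Hypothesis m0 : 0 < n%:R - gamma * r.
Let m := n%:R - gamma * r.
Let s := 1 + alpha - beta / p.
Let sigma := (r - 1) / (p - 1).
Let e0 := p * (r - 1) / (p - 1).
Let mu := lebesgue_rV R n.
Local Notation S := (@usphere R n).
Local Notation nu := (@surface_measure R n).

Variable a : R.
Hypothesis a0 : 0 <= a.
Variables (f : 'rV[R]_n -> R) (L C : 'rV[R]_n -> R).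
Hypothesis mf : measurable_fun setT f.
Hypothesis mL : measurable_fun S L.
Hypothesis df : forall w t, S w -> 0 < t -> t != L w ->
  exists2 d, is_derive t 1 (fun t : R => f (t *: w)) d &
    `|d| = a * t `^ (s - 1) * `|f (t *: w)| `^ sigma.
Hypothesis ray_eq : forall w, S w ->
  (\int[@lebesgue_measure R]_(t in `]0%R, +oo[) (`|f (t *: w)| `^ r * t `^ (m - 1))%:E =
   \int[@lebesgue_measure R]_(t in `]0%R, +oo[)
     (r / m * a * `|f (t *: w)| `^ e0 * t `^ (s - 1) * t `^ m)%:E)%E.
Hypothesis ray_le : forall w, S w ->
  (\int[@lebesgue_measure R]_(t in `]0%R, +oo[)
    (`|f (t *: w)| `^ r * t `^ (m - 1))%:E <= (C w)%:E)%E.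
Hypothesis C_fin : (\int[nu]_(w in S) (C w)%:E < +oo)%E.

Let p0 : 0 < p. Proof. exact: lt_trans p1. Qed.

Let e00 : e0 != 0.
Proof.
rewrite /e0 mulf_neq0 ?invr_eq0 ?subr_eq0//; last by rewrite gt_eqF.
by rewrite mulf_neq0 ?subr_eq0// gt_eqF.
Qed.

Let mE : m = n%:R - beta - s.
Proof. by rewrite /m gammaE /s; field; rewrite gt_eqF. Qed.

Lemma ae_radial_derive :
  {ae mu, forall x, derivable f x (dir x) /\
    `|radial_derive f x| = a * enorm x `^ (s - 1) * `|f x| `^ sigma}.
Proof.
apply: filterS (negligible_radial_graph n0 mL) => x [x0 xL].
have ex : 0 < enorm x by rewrite enorm_gt0.
have [d dd dE] := df (usphere_dir x0) ex xL.
have {}dd : is_derive x (dir x) f d.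
  rewrite -{1}[x]enormK -[enorm x *: dir x]add0r; apply/is_derive_ray.
  by under eq_fun do rewrite add0r.
have [dx dxE] := dd; split => //.
by rewrite /radial_derive dxE dE enormK.
Qed.

Let mpow (g : 'rV[R]_n -> R) c : measurable_fun setT g -> measurable_fun setT (fun x => `|g x| `^ c).
Proof. by move=> mg; apply: (measurableT_comp (measurable_powR _)); exact: measurableT_comp. Qed.

Let mquot c e : measurable_fun setT (fun x => `|f x| `^ c / enorm x `^ e).
Proof. by apply: measurable_div_enorm; exact: mpow. Qed.

Local Notation pot := (ckn_pot p r beta setT f).

Let pot_ge0 : (0 <= pot)%E.
Proof. by apply: integral_ge0 => x _; rewrite lee_fin divr_ge0 ?powR_ge0. Qed.

Let scale_pot c : 0 <= c ->
  (c%:E * pot = \int[mu]_x (c * (`|f x| `^ e0 / enorm x `^ beta))%:E)%E.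
Proof.
move=> c0; under eq_integral do rewrite EFinM.
rewrite ge0_integralZl//.
- by apply/measurable_EFinP; exact: mquot.
- by move=> x _; rewrite lee_fin divr_ge0 ?powR_ge0.
Qed.

(** This explains the choice of [s]: as (s-1) p = alpha p - beta, the ODE makes the gradient
    integrand a fixed multiple of the potential integrand. *)
Let grad_powE x t : 0 < t ->
  (a * t `^ (s - 1) * `|f x| `^ sigma) `^ p / t `^ (alpha * p) =
  a `^ p * (`|f x| `^ e0 / t `^ beta).
Proof.
move=> t0.
rewrite powRM ?mulr_ge0 ?powR_ge0// powRM ?powR_ge0// -!powRrM.
rewrite (_ : sigma * p = e0); last by rewrite /sigma /e0 mulrC mulrA.
rewrite (_ : (s - 1) * p = alpha * p - beta); last first.
  by rewrite /s; field; rewrite gt_eqF.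
rewrite powRD_gt0// powRN; field.
by rewrite !gt_eqF ?powR_gt0.
Qed.

(** Stated for a second function [g]: besides [f] itself it serves the cutoffs of an extremal, whose
    radial derivatives are only smaller. *)
Lemma ckn_grad_le_pot (g : 'rV[R]_n -> R) :
  {ae mu, forall x, `|radial_derive g x| <= a * enorm x `^ (s - 1) * `|f x| `^ sigma} ->
  (ckn_grad p alpha g <= (a `^ p)%:E * pot)%E.
Proof.
move=> gP; rewrite scale_pot ?powR_ge0//.
apply: ae_le_integral_measurabler.
- by apply/measurable_EFinP; apply: measurable_funM => //; exact: mquot.
- by move=> x; rewrite lee_fin divr_ge0 ?powR_ge0.
- by move=> x; rewrite lee_fin mulr_ge0 ?divr_ge0 ?powR_ge0.
have n00 := negligible_radial_graph n0 mL.
apply: filterS2 n00 gP => x [x0 _] gx.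
have ex : 0 < enorm x by rewrite enorm_gt0.
rewrite lee_fin -grad_powE// ler_pM2r ?invr_gt0 ?powR_gt0//.
by rewrite ge0_ler_powR ?nnegrE ?(ltW p0)// mulr_ge0 ?powR_ge0// mulr_ge0 ?powR_ge0.
Qed.

Let polar_powE w : S w ->
  (\int[@lebesgue_measure R]_(t in `]0%R, +oo[) (`|f (t *: w)| `^ r * t `^ (m - 1))%:E =
   \int[@lebesgue_measure R]_(t in `]0%R, +oo[)
     ((`|f (t *: w)| `^ r / enorm (t *: w) `^ (gamma * r))%:E * (t ^+ n.-1)%:E))%E.
Proof.
move=> w1; apply: eq_integral => t; rewrite inE/= in_itv/= andbT => t0.
rewrite enorm_ray ?(ltW t0)// -EFinM; congr EFin.
rewrite -mulrA; congr (_ * _).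
rewrite -powRN -powR_mulrn ?(ltW t0)// -powRD_gt0//; congr (_ `^ _).
by rewrite -subn1 natrB// /m; ring.
Qed.

(** The identity on rays integrated over the sphere; the factor comes out because [a] is the same on
    every ray. *)
Lemma ckn_lhs_ray_identity : ckn_lhs r gamma f = ((r / m * a)%:E * pot)%E.
Proof.
have c0 : 0 <= r / m * a by rewrite mulr_ge0// divr_ge0// ltW.
have inv_ge0 c e x : 0 <= `|f x| `^ c / enorm x `^ e by rewrite divr_ge0 ?powR_ge0.
rewrite scale_pot// /ckn_lhs.
rewrite (@ge0_integral_polar _ _ (fun x => (`|f x| `^ r / enorm x `^ (gamma * r))%:E))//; last 2 first.
- by apply/measurable_EFinP; exact: mquot.
- by move=> x; rewrite lee_fin.
rewrite (@ge0_integral_polar _ _ (fun x : 'rV[R]_n => (r / m * a * (`|f x| `^ e0 / enorm x `^ beta))%:E))//; last 2 first.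
- by apply/measurable_EFinP; apply: measurable_funM => //; exact: mquot.
- by move=> x; rewrite lee_fin mulr_ge0.
apply: eq_integral => w; rewrite inE => w1.
rewrite -(polar_powE w1) ray_eq//; apply: eq_integral => t; rewrite inE/= in_itv/= andbT => t0.
rewrite enorm_ray ?(ltW t0)// -!EFinM; congr EFin.
rewrite -!mulrA; congr (_ * (_ * (_ * (_ * _)))).
rewrite -powRN -powR_mulrn ?(ltW t0)// -!powRD_gt0//; congr (_ `^ _).
by rewrite -subn1 natrB// mE; ring.
Qed.

Let lhs_fin : (ckn_lhs r gamma f < +oo)%E.
Proof.
apply: le_lt_trans C_fin.
rewrite /ckn_lhs.
rewrite (@ge0_integral_polar _ _ (fun x => (`|f x| `^ r / enorm x `^ (gamma * r))%:E))//; last 2 first.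
- by apply/measurable_EFinP; exact: mquot.
- by move=> x; rewrite lee_fin divr_ge0 ?powR_ge0.
apply: ge0_le_integral_nomeasD => w w1.
  apply: integral_ge0 => t; rewrite /= in_itv/= andbT => t0.
  by rewrite -EFinM lee_fin mulr_ge0 ?divr_ge0 ?powR_ge0// exprn_ge0// ltW.
by rewrite -(polar_powE w1); exact: ray_le.
Qed.

Theorem ckn_extremal_core : ckn_extremal p r alpha beta gamma (r / (n%:R - gamma * r)) f.
Proof.
split.
- by apply: filterS ae_radial_derive => x [].
- exact: lhs_fin.
rewrite /ckn_rhs ckn_pot_domain//.
(* Two inequalities instead of an a.e. equality of integrands, since only the potential side is
   known to be measurable. *)
have gradE : ckn_grad p alpha f = ((a `^ p)%:E * pot)%E.
  apply/eqP; rewrite eq_le; apply/andP; split.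
    by apply: ckn_grad_le_pot; apply: filterS ae_radial_derive => x [_ ->].
  rewrite scale_pot ?powR_ge0//; apply: ae_le_integral_measurablel.
  - by apply/measurable_EFinP; apply: measurable_funM => //; exact: mquot.
  - by move=> x; rewrite lee_fin mulr_ge0 ?divr_ge0 ?powR_ge0.
  - by move=> x; rewrite lee_fin divr_ge0 ?powR_ge0.
  apply: filterS2 (negligible_radial_graph n0 mL) ae_radial_derive => x [x0 _] [_ ->].
  by rewrite grad_powE ?enorm_gt0.
by rewrite gradE ckn_lhs_ray_identity (holder_scale a0 p1 pot_ge0) muleA -EFinM.
Qed.

End extremal_core.

(** * Radial profiles and their scaling *)

Section radial_profiles.
Context (R : realType).
Local Notation leb := (@lebesgue_measure R).
Variables (p r s m : R).
Hypotheses (p1 : 1 < p) (r0 : 0 < r) (r1 : r != 1) (m0 : 0 < m).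
Let sigma := (r - 1) / (p - 1).
Let e0 := p * (r - 1) / (p - 1).
Implicit Types G : R -> R.

Record decay_bounded (a L C k : R) G : Prop := DecayBounded {
  decay_bounded_L : 0 < L;
  decay_bounded_k : 0 < k;
  decay_bounded_gt0 : forall t : R, 0 < t < L -> 0 < G t;
  decay_bounded_eq0 : forall t, L <= t -> G t = 0;
  decay_bounded_derive : forall t : R, 0 < t < L ->
    is_derive t 1 G (- (a * t `^ (s - 1) * G t `^ sigma));
  decay_bounded_cvg : G t @[t --> L^'-] --> 0;
  decay_bounded_le : forall t : R, 0 < t < L -> G t `^ r * t `^ m <= C * t `^ k
}.

Record decay_unbounded (a C1 k1 C2 k2 : R) G : Prop := DecayUnbounded {
  decay_unbounded_k1 : 0 < k1;
  decay_unbounded_k2 : 0 < k2;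
  decay_unbounded_gt0 : forall t : R, 0 < t -> 0 < G t;
  decay_unbounded_derive : forall t : R, 0 < t ->
    is_derive t 1 G (- (a * t `^ (s - 1) * G t `^ sigma));
  decay_unbounded_le1 : forall t : R, 0 < t -> G t `^ r * t `^ m <= C1 * t `^ k1;
  decay_unbounded_le2 : forall t : R, 0 < t -> G t `^ r * t `^ m <= C2 * t `^ (- k2)
}.

(* [L] is the radius, if any, where the profile reaches 0. *)
Record radial_profile (a L C : R) G : Prop := RadialProfile {
  radial_profile_ge0 : forall t, 0 < t -> 0 <= G t;
  radial_profile_derive : forall t : R, 0 < t -> t != L ->
    is_derive t 1 G (- (a * t `^ (s - 1) * G t `^ sigma));
  radial_profile_eq :
    (\int[leb]_(t in `]0%R, +oo[) (G t `^ r * t `^ (m - 1))%:E =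
     \int[leb]_(t in `]0%R, +oo[) (r / m * a * G t `^ e0 * t `^ (s - 1) * t `^ m)%:E)%E;
  radial_profile_le :
    (\int[leb]_(t in `]0%R, +oo[) (G t `^ r * t `^ (m - 1))%:E <= C%:E)%E
}.

(** The ODE is homogeneous of degree sigma in [G], so a factor [b] changes [a] into a b^(1-sigma).
    Unless sigma = 1, a factor depending on the ray would spoil the common [a]. *)
Let derive_scale a b G t : 0 < b -> 0 <= G t ->
  is_derive t 1 G (- (a * t `^ (s - 1) * G t `^ sigma)) ->
  is_derive t 1 (fun t => b * G t)
    (- (a * b `^ (1 - sigma) * t `^ (s - 1) * (b * G t) `^ sigma)).
Proof.
move=> b0 G0 dG; have : is_derive t 1 (fun t => b * G t) (b * - (a * t `^ (s - 1) * G t `^ sigma)).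
  exact: is_deriveZ.
congr (is_derive _ _ _ _); rewrite (powRM _ (ltW b0) G0).
have : b = b `^ (1 - sigma) * b `^ sigma by rewrite -powRD_gt0// subrK powRr1// ltW.
move: (_ `^ (1 - sigma)) (b `^ sigma) (_ `^ (s - 1)) (_ `^ sigma) => x y z w ->; ring.
Qed.

Lemma decay_bounded_scale a L C k b G : 0 < b -> decay_bounded a L C k G ->
  decay_bounded (a * b `^ (1 - sigma)) L (b `^ r * C) k (fun t => b * G t).
Proof.
move=> b0 [L0 k0 G0 GL dG GL0 GC]; split => //.
- by move=> t tL; rewrite mulr_gt0// G0.
- by move=> t tL; rewrite GL// mulr0.
- by move=> t tL; apply: derive_scale => //; [exact/ltW/G0|exact: dG].
- by rewrite -[X in _ --> X](mulr0 b); apply: cvgMr.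
- move=> t tL; rewrite powRM ?(ltW b0) ?(ltW (G0 _ tL))// -!mulrA.
  by rewrite ler_pM2l ?powR_gt0// GC.
Qed.

Lemma decay_unbounded_scale a C1 k1 C2 k2 b G : 0 < b -> decay_unbounded a C1 k1 C2 k2 G ->
  decay_unbounded (a * b `^ (1 - sigma)) (b `^ r * C1) k1 (b `^ r * C2) k2 (fun t => b * G t).
Proof.
move=> b0 [k10 k20 G0 dG GC1 GC2]; split => //.
- by move=> t t0; rewrite mulr_gt0// G0.
- by move=> t t0; apply: derive_scale => //; [exact/ltW/G0|exact: dG].
- move=> t t0; rewrite powRM ?(ltW b0) ?(ltW (G0 _ t0))// -!mulrA.
  by rewrite ler_pM2l ?powR_gt0// GC1.
- move=> t t0; rewrite powRM ?(ltW b0) ?(ltW (G0 _ t0))// -!mulrA.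
  by rewrite ler_pM2l ?powR_gt0// GC2.
Qed.

Let sigma0 : sigma != 0.
Proof. by rewrite mulf_neq0 ?invr_eq0 ?subr_eq0// gt_eqF. Qed.

Lemma decay_bounded_profile a L C k G : 0 <= a -> decay_bounded a L C k G ->
  radial_profile a L (C * (L `^ k / k)) G.
Proof.
move=> a0 [L0 k0 G0 GL dG GL0 GC].
have [GE Gle] := ray_bounded p1 r0 r1 m0 a0 L0 k0 G0 GL dG GL0 GC.
split; [move=> t t0|move=> t t0 /eqP tL|exact: GE|exact: Gle]; clear GE Gle.
  by case: (ltP t L) => tL; [apply/ltW/G0; rewrite t0|rewrite GL].
have [{}tL|{}tL|//] := ltgtP t L; first by apply: dG; rewrite t0.
rewrite (GL _ (ltW tL)) powR0// mulr0 oppr0.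
apply: (@near_eq_is_derive _ _ _ (fun=> 0)).
by near=> u; rewrite GL//; apply/ltW; near: u; exact: lt_nbhsr.
Unshelve. all: by end_near. Qed.

(** The exceptional radius of the profile is put at 0, which no positive t meets; [L] is only the
    radius separating the two bounds. *)
Lemma decay_unbounded_profile a C1 k1 C2 k2 L G : 0 <= a -> 0 < L ->
  decay_unbounded a C1 k1 C2 k2 G ->
  radial_profile a 0 (C1 * (L `^ k1 / k1) + C2 * (L `^ (- k2) / k2)) G.
Proof.
move=> a0 L0 [k10 k20 G0 dG GC1 GC2].
have [GE Gle] := ray_unbounded p1 r0 m0 a0 L0 k10 k20 G0 dG GC1 GC2.
by split; [move=> t t0; exact/ltW/G0|move=> t t0 _; exact: dG|exact: GE|exact: Gle].
Qed.

(** Needed when the constant in front is 0, or on rays where lambda vanishes; the scaling lemmas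
    require a positive factor. *)
Lemma radial_profile0 a L C : 0 <= C -> radial_profile a L C (fun=> 0).
Proof.
move=> C0; have z : (fun t : R => ((0 : R) `^ r * t `^ (m - 1))%:E) = cst 0%E.
  by apply/funext => t; rewrite powR0 ?gt_eqF// mul0r.
have e00 : e0 != 0.
  by rewrite /e0 -mulrA mulf_neq0// gt_eqF// (lt_trans ltr01).
split; [by []| | | ].
- move=> t _ _; rewrite powR0// mulr0 oppr0; exact: is_derive_cst.
- by rewrite z; apply: eq_integral => t _; rewrite powR0// mulr0 !mul0r.
- by rewrite z integral0 lee_fin.
Qed.

End radial_profiles.

Section extremal_families.
Context (R : realType) (n : nat).
Variables (p r alpha beta gamma : R).
Hypothesis n0 : (0 < n)%N.
Hypothesis p1 : 1 < p.
Hypothesis r0 : 0 < r.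
Hypothesis r1 : r != 1.
Hypothesis gammaE : gamma * r = 1 + alpha + (p - 1) / p * beta.
Hypothesis m0 : 0 < n%:R - gamma * r.
Let m := n%:R - gamma * r.
Let s := 1 + alpha - beta / p.
Let sigma := (r - 1) / (p - 1).
Local Notation S := (@usphere R n).
Local Notation nu := (@surface_measure R n).
Local Notation extremal := (ckn_extremal p r alpha beta gamma (r / (n%:R - gamma * r))).

(** The unimodular [b] is a sign constant on each ray: profiles are nonnegative, whereas the
    constant or lambda in an extremal may be negative. *)
Lemma ckn_extremal_profile (a : R) (f L C : 'rV[R]_n -> R) (G : 'rV[R]_n -> R -> R) :
  0 <= a -> measurable_fun setT f -> measurable_fun S L ->
  (forall w, S w -> exists2 b, `|b| = 1 & forall t, 0 < t -> f (t *: w) = b * G w t) ->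
  (forall w, S w -> radial_profile p r s m a (L w) (C w) (G w)) ->
  (\int[nu]_(w in S) (C w)%:E < +oo)%E -> extremal f.
Proof.
move=> a0 mf mL fG GP Cfin.
have absf w t : S w -> 0 < t -> `|f (t *: w)| = G w t.
  move=> w1 t0; have [b b1 ->//] := fG w w1.
  by rewrite normrM b1 mul1r ger0_norm//; apply: radial_profile_ge0 (GP w w1) _ t0.
apply: (ckn_extremal_core n0 p1 r0 r1 gammaE m0 a0 (L := L) (C := C) mf mL _ _ _ Cfin).
- move=> w t w1 t0 tL; have [b b1 fb] := fG w w1.
  exists (b * - (a * t `^ (s - 1) * G w t `^ sigma)).
    apply: (@near_eq_is_derive _ _ _ (fun t => b * G w t)); last first.
      apply: is_deriveZ; exact: radial_profile_derive (GP w w1) _ t0 tL.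
    by near=> u; rewrite fb//; near: u; exact: lt_nbhsr.
  rewrite normrM b1 mul1r normrN absf// ger0_norm//.
  by rewrite mulr_ge0 ?powR_ge0// mulr_ge0 ?powR_ge0.
- move=> w w1; have := radial_profile_eq (GP w w1).
  rewrite -/m -/s => H.
  transitivity (\int[@lebesgue_measure R]_(t in `]0%R, +oo[) (G w t `^ r * t `^ (m - 1))%:E)%E.
    by apply: eq_integral => t; rewrite inE/= in_itv/= andbT => t0; rewrite absf.
  rewrite H; apply: eq_integral => t; rewrite inE/= in_itv/= andbT => t0.
  by rewrite absf.
- move=> w w1; have := radial_profile_le (GP w w1); apply: le_trans.
  by apply: ge0_le_integral_nomeasD => t; rewrite /= in_itv/= andbT => t0;
    rewrite lee_fin ?mulr_ge0 ?powR_ge0// absf.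
Unshelve. all: by end_near. Qed.

End extremal_families.

(** * The five explicit profiles *)

Lemma gt0_ler_npowR (R : realType) (a x y : R) : a <= 0 -> 0 < x -> x <= y -> y `^ a <= x `^ a.
Proof.
move=> a0 x0 xy; have y0 := lt_le_trans x0 xy.
rewrite -[a]opprK powRN [leRHS]powRN lef_pV2 ?posrE ?powR_gt0//.
by rewrite ge0_ler_powR ?nnegrE ?oppr_ge0// ltW.
Qed.

Lemma powR_lt_gt0 (R : realType) (s t l : R) : 0 < s -> 0 < t -> 0 < l ->
  (t `^ s < l) = (t < l `^ s^-1).
Proof.
move=> s0 t0 l0; rewrite -[LHS]ltr_ln ?posrE ?powR_gt0// -[RHS]ltr_ln ?posrE ?powR_gt0//.
by rewrite !ln_powR mulrC -ltr_pdivlMr// [_ / s]mulrC.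
Qed.

Lemma powR_gt_lt0 (R : realType) (s t l : R) : s < 0 -> 0 < t -> 0 < l ->
  (l < t `^ s) = (t < l `^ s^-1).
Proof.
move=> s0 t0 l0; rewrite -[LHS]ltr_ln ?posrE ?powR_gt0// -[RHS]ltr_ln ?posrE ?powR_gt0//.
by rewrite !ln_powR mulrC -ltr_ndivlMr// [_ / s]mulrC.
Qed.

(** The bound x <= exp x at x = d y / N, raised to the power [N]. *)
Lemma powR_le_expR (R : realType) (N d y : R) : 0 < N -> 0 < d -> 0 <= y ->
  y `^ N <= (N / d) `^ N * expR (d * y).
Proof.
move=> N0 d0 y0.
have -> : expR (d * y) = expR (d / N * y) `^ N.
  by rewrite -expRM; congr expR; field; rewrite gt_eqF.
have Nd : 0 < N / d by rewrite divr_gt0.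
rewrite -powRM ?expR_ge0 ?(ltW Nd)//.
have yE : y <= N / d * expR (d / N * y).
  rewrite -ler_pdivrMl// invf_div; apply: le_trans (expR_ge1Dx _); lra.
by apply: ge0_ler_powR => //; rewrite ?nnegrE ?(ltW N0)//; exact: le_trans yE.
Qed.

Section decay_families.
Context (R : realType).
Variables (p r s m : R).
Hypotheses (p1 : 1 < p) (r0 : 0 < r) (m0 : 0 < m).
Let sigma := (r - 1) / (p - 1).
Let theta := (p - 1) / (p - r).
Implicit Types (q : R -> R) (lambda c kappa : R).

(** As theta * sigma = theta - 1, the power theta turns q' = -kappa t^(s-1) into the ODE:
    integrating t^(s-1) then gives the profiles with r != p. *)
Let is_derive_powR_theta kappa q t : r != p -> 0 < q t ->
  is_derive t 1 q (- (kappa * t `^ (s - 1))) ->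
  is_derive t 1 (fun t => q t `^ theta)
    (- (theta * kappa * t `^ (s - 1) * (q t `^ theta) `^ sigma)).
Proof.
move=> rp q0 dq; have := is_derive1_comp (is_derive1_powR theta q0) dq.
congr (is_derive _ _ _ _); rewrite -powRrM.
have -> : theta * sigma = theta - 1.
  rewrite /theta /sigma; field.
  by rewrite !subr_eq0 (eq_sym p) rp gt_eqF.
ring.
Qed.

(** Common to (ii), (iii) and (iv). Since q(L) <= 0, the positive part of q(t) is at most |q(L) -
    q(t)|, which gives the limit 0 at [L]. *)
Lemma truncated_decay kappa q L C k : 0 < L -> 0 < k -> r < p ->
  (forall t, 0 < t < L -> 0 < q t) -> (forall t, L <= t -> q t <= 0) ->
  {for L, continuous q} ->
  (forall t, 0 < t < L -> is_derive t 1 q (- (kappa * t `^ (s - 1)))) ->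
  (forall t, 0 < t < L -> q t `^ (theta * r) * t `^ m <= C * t `^ k) ->
  decay_bounded p r s m (theta * kappa) L C k (fun t => Num.max (q t) 0 `^ theta).
Proof.
move=> L0 k0 rp q0 qL cq dq qC.
have theta0 : 0 < theta by rewrite divr_gt0 ?subr_gt0.
have maxq t : 0 < t < L -> Num.max (q t) 0 = q t by move=> tL; rewrite max_l// ltW// q0.
split => //.
- by move=> t tL; rewrite maxq// powR_gt0// q0.
- by move=> t /qL qt; rewrite max_r// powR0// gt_eqF.
- move=> t tL; rewrite maxq//.
  apply: (@near_eq_is_derive _ _ _ (fun t => q t `^ theta)).
    near=> u; rewrite maxq//; apply/andP; split; near: u.
    + by apply: lt_nbhsr; case/andP: tL.
    + by apply: lt_nbhsl; case/andP: tL.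
  apply: is_derive_powR_theta => //; [by rewrite lt_eqF|exact: q0|exact: dq].
- have /cvgrPdist_le ql := cvg_at_left_filter cq.
  apply/cvgrPdist_le => e e0; near=> t.
  rewrite sub0r normrN ger0_norm ?powR_ge0//.
  have -> : e = (e `^ theta^-1) `^ theta by rewrite -powRrM mulVf ?gt_eqF// powRr1// ltW.
  rewrite ge0_ler_powR ?nnegrE ?powR_ge0 ?(ltW theta0)// ?le_max ?lexx ?orbT//.
  rewrite ge_max powR_ge0 andbT.
  suff : `|q L - q t| <= e `^ theta^-1.
    rewrite distrC => /(le_trans (ler_norm _)); apply: le_trans.
    by rewrite lerDl oppr_ge0 qL.
  by near: t; apply: ql; rewrite powR_gt0.
- by move=> t tL; rewrite maxq// -powRrM qC.
Unshelve. all: by end_near. Qed.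

Let derive_rpow (t : R) : 0 < t -> is_derive t 1 (fun t : R => t `^ s) (s * t `^ (s - 1)).
Proof. by move=> t0; exact: is_derive1_powR. Qed.

(** As theta is negative, either summand of lambda + t^s bounds the profile: lambda gives the decay
    at 0, t^s the decay at infinity. *)
Lemma decay_family_i lambda : p < r -> 0 < s -> s * (theta * r) + m < 0 -> 0 < lambda ->
  decay_unbounded p r s m (- (theta * s)) (lambda `^ (theta * r)) m
    1 (- (s * (theta * r) + m)) (fun t => (lambda + t `^ s) `^ theta).
Proof.
move=> pr s0 k0 l0; rewrite -mulrN.
have theta0 : theta * r <= 0.
  rewrite mulr_le0_ge0 ?(ltW r0)// /theta mulr_ge0_le0// ?invr_le0 ?subr_le0 ?subr_ge0; exact: ltW.
have q0 (t : R) : 0 < lambda + t `^ s by rewrite ltr_pwDl// powR_ge0.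
split => //; first by rewrite oppr_gt0.
- by move=> t _; rewrite powR_gt0.
- move=> t t0; have dq : is_derive t 1 (fun t : R => lambda + t `^ s) (- (- s * t `^ (s - 1))).
    rewrite mulNr opprK -[X in is_derive _ _ _ X]add0r.
    by apply: is_deriveD; exact: derive_rpow.
  have rp : r != p by rewrite gt_eqF.
  exact: is_derive_powR_theta.
- move=> t t0; rewrite -powRrM ler_pM2r ?powR_gt0//.
  by apply: gt0_ler_npowR => //; rewrite lerDl powR_ge0.
- move=> t t0; rewrite opprK mul1r powRD_gt0// -powRrM ler_pM2r ?powR_gt0//.
  rewrite (powRrM t); apply: gt0_ler_npowR => //; rewrite ?powR_gt0// lerDr; exact: ltW.
Qed.

Lemma decay_family_ii lambda : r < p -> 0 < s -> 0 < lambda ->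
  decay_bounded p r s m (theta * s) (lambda `^ s^-1) (lambda `^ (theta * r)) m
    (fun t => Num.max (lambda - t `^ s) 0 `^ theta).
Proof.
move=> rp s0 l0.
have L0 : 0 < lambda `^ s^-1 by rewrite powR_gt0.
have theta0 : 0 < theta by rewrite divr_gt0 ?subr_gt0.
have q0 (t : R) : 0 < t < lambda `^ s^-1 -> 0 < lambda - t `^ s.
  by case/andP => t0 tL; rewrite subr_gt0 powR_lt_gt0.
have dq (t : R) : 0 < t -> is_derive t 1 (fun t : R => lambda - t `^ s) (- (s * t `^ (s - 1))).
  move=> t0; rewrite -[X in is_derive _ _ _ X]add0r.
  by apply: is_deriveB; exact: derive_rpow.
refine (truncated_decay (q := fun t : R => lambda - t `^ s) L0 m0 rp q0 _ _ _ _).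
- move=> t tL; have t0 := lt_le_trans L0 tL.
  by rewrite subr_le0 leNgt powR_lt_gt0// -leNgt.
- exact: is_derive_continuous (dq _ L0).
- by move=> t /andP[t0 _]; exact: dq.
- move=> t /[dup] /andP[t0 _] tL; rewrite ler_pM2r ?powR_gt0//.
  rewrite ge0_ler_powR ?nnegrE ?(ltW (q0 _ tL)) ?(ltW l0)//.
    by rewrite mulr_ge0 ?ltW.
  by rewrite gerBl powR_ge0.
Qed.

(** Half of the exponent [m] is spent on the logarithm: (lambda - ln t)^(theta r) is at most a
    constant times exp((m/2)(lambda - ln t)), which leaves t^(m/2). *)
Lemma decay_family_iii lambda : r < p -> s = 0 ->
  decay_bounded p r s m theta (expR lambda)
    ((theta * r / (m / 2)) `^ (theta * r) * expR (m / 2 * lambda)) (m / 2)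
    (fun t => Num.max (lambda - ln t) 0 `^ theta).
Proof.
move=> rp s0; rewrite -[X in decay_bounded _ _ _ _ X](mulr1 theta).
have L0 := expR_gt0 lambda.
have m20 : 0 < m / 2 by rewrite divr_gt0.
have theta0 : 0 < theta by rewrite divr_gt0 ?subr_gt0.
have q0 (t : R) : 0 < t < expR lambda -> 0 < lambda - ln t.
  case/andP => t0 tL; rewrite subr_gt0 -(expRK lambda) ltr_ln ?posrE ?expR_gt0//.
have dq (t : R) : 0 < t -> is_derive t 1 (fun t : R => lambda - ln t) (- (1 * t `^ (s - 1))).
  move=> t0; rewrite mul1r s0 sub0r powR_inv1 ?(ltW t0)// -[X in is_derive _ _ _ X]add0r.
  by apply: is_deriveB; exact: is_derive1_ln.
refine (truncated_decay (q := fun t : R => lambda - ln t) L0 m20 rp q0 _ _ _ _).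
- move=> t tL; have t0 := lt_le_trans L0 tL.
  by rewrite subr_le0 -(expRK lambda) ler_ln ?posrE ?expR_gt0//.
- exact: is_derive_continuous (dq _ L0).
- by move=> t /andP[t0 _]; exact: dq.
- move=> t /[dup] /andP[t0 _] tL.
  have := @powR_le_expR R (theta * r) (m / 2) (lambda - ln t).
  rewrite mulr_gt0// divr_gt0// (ltW (q0 _ tL)) => /(_ isT isT isT).
  rewrite -(ler_pM2r (powR_gt0 m t0)) => /le_trans; apply.
  have tE k : t `^ k = expR (k * ln t) by rewrite -{1}(lnK t0) -expRM mulrC.
  rewrite -[leLHS]mulrA -[leRHS]mulrA !tE -!expRD.
  rewrite (_ : m / 2 * (lambda - ln t) + m * ln t = m / 2 * lambda + m / 2 * ln t) ?lexx//.
  by field.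
Qed.

(** Dropping lambda leaves t^(s theta r + m); the second condition of (iv) makes this exponent
    positive. *)
Lemma decay_family_iv lambda : r < p -> s < 0 -> 0 < s * (theta * r) + m -> 0 < lambda ->
  decay_bounded p r s m (- (theta * s)) (lambda `^ s^-1) 1 (s * (theta * r) + m)
    (fun t => Num.max (t `^ s - lambda) 0 `^ theta).
Proof.
move=> rp s0 k0 l0; rewrite -mulrN.
have L0 : 0 < lambda `^ s^-1 by rewrite powR_gt0.
have theta0 : 0 < theta by rewrite divr_gt0 ?subr_gt0.
have q0 (t : R) : 0 < t < lambda `^ s^-1 -> 0 < t `^ s - lambda.
  by case/andP => t0 tL; rewrite subr_gt0 powR_gt_lt0.
have dq (t : R) : 0 < t -> is_derive t 1 (fun t : R => t `^ s - lambda) (- (- s * t `^ (s - 1))).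
  move=> t0; rewrite mulNr opprK -[X in is_derive _ _ _ X]subr0.
  by apply: is_deriveB; exact: derive_rpow.
refine (truncated_decay (q := fun t : R => t `^ s - lambda) L0 k0 rp q0 _ _ _ _).
- move=> t tL; have t0 := lt_le_trans L0 tL.
  by rewrite subr_le0 leNgt powR_gt_lt0// -leNgt.
- exact: is_derive_continuous (dq _ L0).
- by move=> t /andP[t0 _]; exact: dq.
- move=> t /[dup] /andP[t0 _] tL; rewrite mul1r powRD_gt0// ler_pM2r ?powR_gt0//.
  rewrite (powRrM t) ge0_ler_powR ?nnegrE ?(ltW (q0 _ tL)) ?powR_ge0//.
    by rewrite mulr_ge0 ?ltW.
  by rewrite gerBl ltW.
Qed.

(** Here sigma = 1 and the ODE is linear. The exponent (m+1)/s is chosen so that the exponential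
    absorbs t^(m+1), leaving decay 1/t at infinity. *)
Lemma decay_family_v c : r = p -> 0 < s -> 0 < c ->
  decay_unbounded p r s m (c * s) 1 m ((((m + 1) / s) / (c * r)) `^ ((m + 1) / s)) 1
    (fun t => expR (- c * t `^ s)).
Proof.
move=> rp s0 c0; split => //.
- by move=> t _; exact: expR_gt0.
- move=> t t0.
  have -> : expR (- c * t `^ s) `^ sigma = expR (- c * t `^ s).
    by rewrite /sigma rp divff ?powRr1 ?expR_ge0// gt_eqF// subr_gt0.
  have dq : is_derive t 1 (fun t : R => - c * t `^ s) (- c * (s * t `^ (s - 1))).
    by apply: is_deriveZ; exact: derive_rpow.
  have := is_derive1_comp (is_derive_expR _) dq.
  by congr (is_derive _ _ _ _); ring.
- move=> t t0; rewrite ler_pM2r ?powR_gt0// -expRM -expR0 ler_expR.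
  by rewrite mulr_le0_ge0 ?(ltW r0)// mulr_le0_ge0 ?powR_ge0// oppr_le0 ltW.
- move=> t t0; rewrite powR_inv1 ?(ltW t0)// -(ler_pM2r t0) -[leRHS]mulrA mulVf ?gt_eqF// mulr1.
  have := @powR_le_expR R ((m + 1) / s) (c * r) (t `^ s).
  rewrite divr_gt0 ?addr_gt0// mulr_gt0// powR_ge0 => /(_ isT isT isT).
  rewrite -(powRrM t) [s * _]mulrC divfK ?gt_eqF// powRD_gt0// powRr1 ?(ltW t0)//.
  move=> H; rewrite -(ler_pM2r (expR_gt0 (- c * t `^ s * r))) in H.
  move: H; rewrite -[leRHS]mulrA -expRD.
  rewrite (_ : c * r * t `^ s + - c * t `^ s * r = 0) ?expR0 ?mulr1; last by ring.
  by rewrite mulrC (expRM _ r) mulrA.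
Qed.

End decay_families.

(** * From profiles to extremal functions *)

Section extremal_functions.
Context (R : realType) (n : nat).
Variables (p r alpha beta gamma : R).
Hypothesis n0 : (0 < n)%N.
Hypothesis p1 : 1 < p.
Hypothesis r0 : 0 < r.
Hypothesis r1 : r != 1.
Hypothesis gammaE : gamma * r = 1 + alpha + (p - 1) / p * beta.
Hypothesis m0 : 0 < n%:R - gamma * r.
Let m := n%:R - gamma * r.
Let s := 1 + alpha - beta / p.
Let sigma := (r - 1) / (p - 1).
Let theta := (p - 1) / (p - r).
Let e := p * (r - 1) / (p - r) + (n%:R - beta) / s.
Local Notation S := (@usphere R n).
Local Notation nu := (@surface_measure R n).
Local Notation extremal := (ckn_extremal p r alpha beta gamma (r / (n%:R - gamma * r))).

Let mE : m = n%:R - beta - s.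
Proof. by rewrite /m gammaE /s; field; rewrite gt_eqF// (lt_trans ltr01). Qed.

Lemma theta_exponent : r != p -> theta * r = p * (r - 1) / (p - r) + 1.
Proof. by move=> rp; rewrite /theta; field; rewrite subr_eq0 eq_sym. Qed.

Lemma exponent_gt0_i : p < r -> 0 < n%:R - beta ->
  n%:R - beta < s * (p * (r - 1) / (r - p)) -> 0 < s.
Proof.
move=> pr nb0 nb; have := lt_trans nb0 nb.
rewrite pmulr_lgt0// divr_gt0 ?subr_gt0// mulr_gt0 ?subr_gt0//.
  exact: lt_trans p1.
exact: lt_trans pr.
Qed.

Lemma exponent_lt0_i : p < r ->
  n%:R - beta < s * (p * (r - 1) / (r - p)) -> s * (theta * r) + m < 0.
Proof.
move=> pr nb; rewrite theta_exponent ?gt_eqF// mE.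
rewrite (_ : p * (r - 1) / (p - r) = - (p * (r - 1) / (r - p))).
  by move: nb; set X := p * _ / _; rewrite mulrDr mulrN; lra.
by rewrite -mulrN -invrN opprB.
Qed.

Lemma exponent_gt0_iv : r < p ->
  0 < n%:R - beta + s * (p * (r - 1) / (p - r)) -> 0 < s * (theta * r) + m.
Proof.
move=> rp nb; rewrite theta_exponent ?lt_eqF// mE.
by move: nb; set X := p * _ / _; rewrite mulrDr; lra.
Qed.

Let eE : r != p -> s != 0 -> e = theta * r + m / s.
Proof.
by move=> rp s0; rewrite theta_exponent// mE /e; field; rewrite s0 subr_eq0 eq_sym rp.
Qed.

Lemma measurable_comp_dir (h : 'rV[R]_n -> R) :
  measurable_fun S h -> measurable_fun setT (fun x : 'rV[R]_n => h (dir x)).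
Proof.
move=> mh; rewrite (_ : (fun x : 'rV[R]_n => _) =
  fun x : 'rV[R]_n => if x == 0 then h (dir 0) else h (dir x)).
  exact: measurable_fun_dir.
by apply/funext => x; case: eqP => // ->.
Qed.

Lemma integral_sphere_scale_lty (K : R) (h : 'rV[R]_n -> R) :
  0 <= K -> measurable_fun S h -> (forall w, S w -> 0 <= h w) ->
  (\int[nu]_(w in S) (h w)%:E < +oo)%E ->
  (\int[nu]_(w in S) (K * h w)%:E < +oo)%E.
Proof.
move=> K0 mh h0 hoo; under eq_integral do rewrite EFinM.
rewrite ge0_integralZl//.
- by rewrite lte_mul_pinfty.
- exact: measurable_usphere.
- exact/measurable_EFinP.
Qed.

(** |c| is absorbed in the profile by scaling and the sign of [c] becomes the unimodular factor; c =
    0 falls back on the zero profile. *)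
Lemma ckn_extremal_scaled (a c : R) (f L C : 'rV[R]_n -> R) (G : 'rV[R]_n -> R -> R) :
  0 <= a -> measurable_fun setT f -> measurable_fun S L -> measurable_fun S C ->
  (forall w, S w -> 0 <= C w) ->
  (forall w (t : R), S w -> 0 < t -> f (t *: w) = c * G w t) ->
  (forall w (b : R), S w -> 0 < b ->
    radial_profile p r s m (a * b `^ (1 - sigma)) (L w) (b `^ r * C w) (fun t => b * G w t)) ->
  (\int[nu]_(w in S) (C w)%:E < +oo)%E -> extremal f.
Proof.
move=> a0 mf mL mC C0 fG GP Cfin.
have [c0|c0] := eqVneq c 0.
  apply: (ckn_extremal_profile n0 p1 r0 r1 gammaE m0 (a := a) (L := L) (C := cst 0)
    (G := fun=> cst 0)) => //.
  - move=> w w1; exists 1; first by rewrite normr1.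
    by move=> t t0; rewrite fG// c0 mul0r mulr0.
  - by move=> w w1; apply: radial_profile0.
  - by rewrite integral0.
apply: (ckn_extremal_profile n0 p1 r0 r1 gammaE m0 (a := a * `|c| `^ (1 - sigma))
  (L := L) (C := fun w => `|c| `^ r * C w) (G := fun w t => `|c| * G w t)) => //.
- by rewrite mulr_ge0 ?powR_ge0.
- move=> w w1; exists (Num.sg c); first by rewrite normr_sg c0.
  by move=> t t0; rewrite fG// mulrA -numEsg.
- by move=> w w1; apply: GP => //; rewrite normr_gt0.
- by apply: integral_sphere_scale_lty => //; exact: powR_ge0.
Qed.

Let mpow (h : 'rV[R]_n -> R) k : measurable_fun S h -> measurable_fun S (fun w => h w `^ k).
Proof. by move=> mh; apply: (measurableT_comp (measurable_powR _)). Qed.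

Let mmax (h : 'rV[R]_n -> R) k : measurable_fun setT h ->
  measurable_fun setT (fun x => Num.max (h x) 0 `^ k).
Proof.
move=> mh; apply: (measurableT_comp (measurable_powR _)).
exact: measurable_maxr.
Qed.

Let menorm_pow k : measurable_fun setT (fun x : 'rV[R]_n => enorm x `^ k).
Proof. by apply: (measurableT_comp (measurable_powR _)); exact: measurable_enorm. Qed.

(** With profile bound lambda^(theta r) and radius lambda^(1/s), the ray integral scales like
    lambda^e: this is the origin of the integrability condition. *)
Let Lm l : 0 < l -> r != p -> s != 0 -> l `^ (theta * r) * (l `^ s^-1) `^ m = l `^ e.
Proof. by move=> l0 rp s0; rewrite -powRrM -powRD_gt0// eE// [s^-1 * _]mulrC. Qed.

Section positive_lambda.
Variables (c : R) (lambda : 'rV[R]_n -> R).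
Hypothesis mlambda : measurable_fun S lambda.
Hypothesis lambda0 : forall w, S w -> 0 < lambda w.
Hypothesis lambda_fin : (\int[nu]_(w in S) (lambda w `^ e)%:E < +oo)%E.

Lemma extremal_i : p < r -> n%:R - beta < s * (p * (r - 1) / (r - p)) ->
  0 < n%:R - beta ->
  extremal (fun x => c * (lambda (dir x) + enorm x `^ s) `^ theta).
Proof.
move=> pr nb nb0.
have rp : r != p by rewrite gt_eqF.
have s0 := exponent_gt0_i pr nb0 nb.
have k0 := exponent_lt0_i pr nb.
have a0 : 0 <= - (theta * s).
  by rewrite oppr_ge0 mulr_le0_ge0 ?(ltW s0)// /theta mulr_ge0_le0// ?invr_le0 ?subr_le0 ?subr_ge0; exact: ltW.
pose k := - (s * (theta * r) + m).
(* The two summands come from the parts of the ray integral below and above the radius lambda^(1/s),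
   at which both are multiples of lambda^e. *)
pose K := m^-1 + k^-1.
have K0 : 0 <= K by rewrite /K addr_ge0// invr_ge0 ?oppr_ge0; exact: ltW.
refine (@ckn_extremal_scaled (- (theta * s)) c _ (cst 0) (fun w => K * lambda w `^ e)
  (fun w t => (lambda w + t `^ s) `^ theta) a0 _ _ _ _ _ _ _).
- apply: measurable_funM => //; apply: (measurableT_comp (measurable_powR _)).
  by apply: measurable_funD => //; exact: measurable_comp_dir.
- exact: measurable_cst.
- by apply: measurable_funM => //; exact: mpow.
- by move=> w w1; rewrite mulr_ge0 ?powR_ge0.
- by move=> w t w1 t0; rewrite (dir_ray t0 w1) (enorm_ray (ltW t0) w1).
- move=> w b w1 b0; have l0 := lambda0 w1.
  have := decay_unbounded_scale (b := b) b0 (decay_family_i p1 r0 m0 pr s0 k0 l0).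
  have L0 : 0 < lambda w `^ s^-1 by rewrite powR_gt0.
  move=> /(decay_unbounded_profile p1 r0 m0 (mulr_ge0 a0 (powR_ge0 _ _)) L0).
  congr (radial_profile _ _ _ _ _ _ _ _).
  rewrite -/theta -/m -/k /K mulrDl mulrDr; congr (_ + _).
    by rewrite -(Lm l0 rp (lt0r_neq0 s0)) -!mulrA [m^-1 * _]mulrCA [m^-1 * _]mulrC.
  rewrite mulr1 [k^-1 * _]mulrC; congr (_ * (_ / _)).
  by rewrite -powRrM eE ?lt0r_neq0//; congr (_ `^ _); rewrite /k; field; rewrite lt0r_neq0.
- by apply: integral_sphere_scale_lty => //; [exact: mpow|move=> w _; exact: powR_ge0].
Qed.

Lemma extremal_ii : r < p -> 0 < s ->
  extremal (fun x => c * Num.max (lambda (dir x) - enorm x `^ s) 0 `^ theta).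
Proof.
move=> rp s0; have rp' : r != p by rewrite lt_eqF.
have a0 : 0 <= theta * s by rewrite mulr_ge0 ?(ltW s0)// divr_ge0// subr_ge0 ltW.
have K0 : 0 <= m^-1 by rewrite invr_ge0 ltW.
refine (@ckn_extremal_scaled (theta * s) c _ (fun w => lambda w `^ s^-1)
  (fun w => m^-1 * lambda w `^ e)
  (fun w t => Num.max (lambda w - t `^ s) 0 `^ theta) a0 _ _ _ _ _ _ _).
- apply: measurable_funM => //; apply: mmax.
  by apply: measurable_funB => //; exact: measurable_comp_dir.
- exact: mpow.
- by apply: measurable_funM => //; exact: mpow.
- by move=> w w1; rewrite mulr_ge0 ?powR_ge0.
- by move=> w t w1 t0; rewrite (dir_ray t0 w1) (enorm_ray (ltW t0) w1).
- move=> w b w1 b0; have l0 := lambda0 w1.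
  have := decay_bounded_scale (b := b) b0 (decay_family_ii p1 r0 m0 rp s0 l0).
  move=> /(decay_bounded_profile p1 r0 r1 m0 (mulr_ge0 a0 (powR_ge0 _ _))).
  congr (radial_profile _ _ _ _ _ _ _ _).
  by rewrite -/theta -/m -(Lm l0 rp' (lt0r_neq0 s0)) -!mulrA [m^-1 * _]mulrCA [m^-1 * _]mulrC.
- by apply: integral_sphere_scale_lty => //; [exact: mpow|move=> w _; exact: powR_ge0].
Qed.

Lemma extremal_iv : r < p -> s < 0 -> 0 < n%:R - beta + s * (p * (r - 1) / (p - r)) ->
  extremal (fun x => c * Num.max (enorm x `^ s - lambda (dir x)) 0 `^ theta).
Proof.
move=> rp s0 nb; have rp' : r != p by rewrite lt_eqF.
have a0 : 0 <= - (theta * s).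
  by rewrite oppr_ge0 mulr_ge0_le0 ?(ltW s0)// divr_ge0// subr_ge0 ltW.
have k0 := exponent_gt0_iv rp nb.
have K0 : 0 <= (s * (theta * r) + m)^-1 by rewrite invr_ge0 ltW.
refine (@ckn_extremal_scaled (- (theta * s)) c _ (fun w => lambda w `^ s^-1)
  (fun w => (s * (theta * r) + m)^-1 * lambda w `^ e)
  (fun w t => Num.max (t `^ s - lambda w) 0 `^ theta) a0 _ _ _ _ _ _ _).
- apply: measurable_funM => //; apply: mmax.
  by apply: measurable_funB => //; exact: measurable_comp_dir.
- exact: mpow.
- by apply: measurable_funM => //; exact: mpow.
- by move=> w w1; rewrite mulr_ge0 ?powR_ge0.
- by move=> w t w1 t0; rewrite (dir_ray t0 w1) (enorm_ray (ltW t0) w1).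
- move=> w b w1 b0; have l0 := lambda0 w1.
  have := decay_bounded_scale (b := b) b0 (decay_family_iv p1 r0 rp s0 k0 l0).
  move=> /(decay_bounded_profile p1 r0 r1 m0 (mulr_ge0 a0 (powR_ge0 _ _))).
  congr (radial_profile _ _ _ _ _ _ _ _).
  rewrite -!powRrM mulr1; congr (_ * _); rewrite mulrC; congr (_ * _ `^ _).
  by rewrite -/theta eE ?ltr0_neq0//; field; rewrite ltr0_neq0.
- by apply: integral_sphere_scale_lty => //; [exact: mpow|move=> w _; exact: powR_ge0].
Qed.

End positive_lambda.

Lemma extremal_iii (c : R) (lambda : 'rV[R]_n -> R) : measurable_fun S lambda ->
  (\int[nu]_(w in S) (expR ((n%:R - beta) * lambda w))%:E < +oo)%E ->
  r < p -> s = 0 ->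
  extremal (fun x => c * Num.max (lambda (dir x) - ln (enorm x)) 0 `^ theta).
Proof.
move=> mlambda lambda_fin rp s0.
have a0 : 0 <= theta by rewrite divr_ge0// subr_ge0 ltW.
(* One factor exp((m/2) lambda) comes from the decay bound and another from the radius exp(lambda)
   to the power m/2; as s = 0 gives m = n - beta, their product is exp((n - beta) lambda). *)
pose K := (theta * r / (m / 2)) `^ (theta * r) / (m / 2).
have K0 : 0 <= K by rewrite divr_ge0 ?powR_ge0// divr_ge0// ltW.
have mexp k : measurable_fun S (fun w => expR (k * lambda w)).
  by apply: measurableT_comp => //; exact: measurable_funM.
refine (@ckn_extremal_scaled theta c _ (fun w => expR (lambda w))
  (fun w => K * expR ((n%:R - beta) * lambda w))
  (fun w t => Num.max (lambda w - ln t) 0 `^ theta) a0 _ _ _ _ _ _ _).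
- apply: measurable_funM => //; apply: mmax.
  apply: measurable_funB; first exact: measurable_comp_dir.
  by apply: (measurableT_comp (@measurable_ln R)); exact: measurable_enorm.
- exact: measurableT_comp.
- by apply: measurable_funM => //; exact: mexp.
- by move=> w w1; rewrite mulr_ge0 ?expR_ge0.
- by move=> w t w1 t0; rewrite (dir_ray t0 w1) (enorm_ray (ltW t0) w1).
- move=> w b w1 b0.
  have := decay_bounded_scale (b := b) b0 (decay_family_iii p1 r0 m0 (lambda w) rp s0).
  move=> /(decay_bounded_profile p1 r0 r1 m0 (mulr_ge0 a0 (powR_ge0 _ _))).
  congr (radial_profile _ _ _ _ _ _ _ _).
  rewrite -expRM -mulrA; congr (_ * _); rewrite /K mulrA -[LHS]mulrA -[RHS]mulrA -mulrA.
  congr (_ * _); rewrite mulrA -expRD mulrC; congr (_ * expR _).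
  by rewrite -/m mE s0; field.
- by apply: integral_sphere_scale_lty => // w _; exact: expR_ge0.
Qed.

Lemma extremal_v (c : R) (lambda : 'rV[R]_n -> R) : 0 < c -> measurable_fun S lambda ->
  (\int[nu]_(w in S) (`|lambda w| `^ p)%:E < +oo)%E ->
  r = p -> 0 < s ->
  extremal (fun x => lambda (dir x) * expR (- c * enorm x `^ s)).
Proof.
move=> c0 mlambda lambda_fin rp s0.
have a0 : 0 <= c * s by rewrite mulr_ge0 ?ltW.
pose K : R := m^-1 + (((m + 1) / s) / (c * r)) `^ ((m + 1) / s).
have K0 : 0 <= K by rewrite /K addr_ge0 ?powR_ge0// invr_ge0 ltW.
have mpowl : measurable_fun S (fun w => `|lambda w| `^ p).
  by apply: (measurableT_comp (measurable_powR _)); exact: measurableT_comp.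
apply: (ckn_extremal_profile n0 p1 r0 r1 gammaE m0 (a := c * s)
  (L := cst 0) (C := fun w => K * `|lambda w| `^ p)
  (G := fun w t => `|lambda w| * expR (- c * t `^ s))) => //.
- apply: measurable_funM; first exact: measurable_comp_dir.
  by apply: measurableT_comp => //; exact: measurable_funM.
- move=> w w1; have [l0|l0] := eqVneq (lambda w) 0.
    exists 1; rewrite ?normr1// => t t0.
    by rewrite (dir_ray t0 w1) l0 normr0 !mul0r mulr0.
  exists (Num.sg (lambda w)); first by rewrite normr_sg l0.
  by move=> t t0; rewrite (dir_ray t0 w1) (enorm_ray (ltW t0) w1) mulrA -numEsg.
- move=> w w1; have [l0|l0] := eqVneq (lambda w) 0.
    rewrite l0 normr0 (_ : (fun t => _) = fun=> 0).
      by apply: radial_profile0 => //; rewrite mulr_ge0 ?powR_ge0.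
    by apply/funext => t; rewrite mul0r.
  rewrite -normr_gt0 in l0.
  have := decay_unbounded_scale l0 (decay_family_v p1 r0 m0 rp s0 c0).
  (* With sigma = 1 the scaling factor b^(1-sigma) is 1, so a factor |lambda(w)| varying with the
     ray leaves [a] unchanged. *)
  rewrite (_ : (r - 1) / (p - 1) = 1); last by rewrite rp divff// gt_eqF// subr_gt0.
  rewrite subrr powRr0 !mulr1 => /(decay_unbounded_profile p1 r0 m0 a0 ltr01).
  congr (radial_profile _ _ _ _ _ _ _ _).
  by rewrite !powR1 divr1 mul1r !mulr1 -mulrDr mulrC -rp.
- by apply: integral_sphere_scale_lty => // w _; exact: powR_ge0.
Qed.

End extremal_functions.

(** * Smoothness *)

Lemma is_derive_ray0 (R : realType) n (f : 'rV[R]_n -> R) x v (d : R) :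
  is_derive x v f d <-> is_derive (0 : R) 1 (fun t : R => f (x + t *: v)) d.
Proof. by rewrite -is_derive_ray scale0r addr0. Qed.

Lemma is_derive_comp1 (R : realType) n (u : R -> R) (f : 'rV[R]_n -> R) x v (a b : R) :
  is_derive (f x) 1 u a -> is_derive x v f b -> is_derive x v (fun x => u (f x)) (a * b).
Proof.
move=> du /is_derive_ray0 H; apply/is_derive_ray0.
have du' : is_derive (f (x + 0 *: v)) 1 u a by rewrite scale0r addr0.
exact: (@is_derive1_comp _ u (fun t => f (x + t *: v)) 0 a b du' H).
Qed.

Section smooth_expressions.
Context (R : realType) (n : nat).
Implicit Types (U : set 'rV[R]_n) (f g : 'rV[R]_n -> R).

(* A class of explicit functions closed under partial derivatives, hence made
   of smooth functions. *)
Inductive smooth_expr U : ('rV[R]_n -> R) -> Prop :=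
| smooth_cst c : smooth_expr U (fun=> c)
| smooth_coord i : smooth_expr U (fun x => x 0 i)
| smooth_add f g : smooth_expr U f -> smooth_expr U g ->
    smooth_expr U (fun x => f x + g x)
| smooth_mul f g : smooth_expr U f -> smooth_expr U g ->
    smooth_expr U (fun x => f x * g x)
| smooth_powR a f : smooth_expr U f -> (forall x, U x -> 0 < f x) ->
    smooth_expr U (fun x => f x `^ a)
| smooth_ln f : smooth_expr U f -> (forall x, U x -> 0 < f x) ->
    smooth_expr U (fun x => ln (f x))
| smooth_expR f : smooth_expr U f -> smooth_expr U (fun x => expR (f x))
| smooth_flat d k f : 0 < d -> smooth_expr U f ->
    smooth_expr U (fun x => flat d k (f x)).

Lemma smooth_expr_continuous U f x :
  smooth_expr U f -> U x -> {for x, continuous f}.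
Proof.
move=> sf Ux; elim: sf => {f}.
- by move=> c; exact: cst_continuous.
- by move=> i; exact: coord_continuous.
- by move=> f g _ cf _ cg; exact: continuousD.
- by move=> f g _ cf _ cg; exact: continuousM.
- by move=> a f _ cf f0; apply: continuous_comp_powR => //; exact: f0.
- move=> f _ cf f0; apply: (@continuous_comp _ _ _ f (@ln R)) => //.
  exact: continuous_ln (f0 _ Ux).
- move=> f _ cf; apply: (@continuous_comp _ _ _ f (@expR R)) => //.
  exact: continuous_expR.
- move=> d k f d0 _ cf; apply: (@continuous_comp _ _ _ f (flat d k)) => //.
  exact: is_derive_continuous (is_derive_flat d0 k _).
Qed.

Lemma smooth_expr_partial U f i : smooth_expr U f ->
  exists2 f', smooth_expr U f' & forall x, U x -> is_derive x (delta_mx 0 i) f (f' x).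
Proof.
elim=> {f}.
- by move=> c; exists (fun=> 0); [exact: smooth_cst|move=> x _; exact: is_derive_cst].
- move=> j; exists (fun=> (j == i)%:R); first exact: smooth_cst.
  move=> x _; apply/is_derive_ray0.
  rewrite (_ : (fun t : R => _) = cst (x 0 j) + fun t : R => (j == i)%:R * t).
    have d0 : is_derive (0 : R) 1 (cst (x 0 j) : R -> R) 0 by exact: is_derive_cst.
    have d1 : is_derive (0 : R) 1 (fun t : R => (j == i)%:R * t) ((j == i)%:R * 1).
      apply: is_deriveZ; exact: is_derive_id.
    by have := is_deriveD d0 d1; rewrite add0r mulr1.
  by apply/funext => t; rewrite !mxE eqxx mulrC.
- move=> f g _ [f' sf' df] _ [g' sg' dg]; exists (fun x => f' x + g' x).
    exact: smooth_add.
  by move=> x Ux; apply: is_deriveD; [exact: df|exact: dg].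
- move=> f g sf [f' sf' df] sg [g' sg' dg]; exists (fun x => f x * g' x + g x * f' x).
    by apply: smooth_add; exact: smooth_mul.
  by move=> x Ux; apply: is_deriveM; [exact: df|exact: dg].
- move=> a f sf [f' sf' df] f0; exists (fun x => a * f x `^ (a - 1) * f' x).
    by do !apply: smooth_mul => //; [exact: smooth_cst|exact: smooth_powR].
  move=> x Ux; have H := df x Ux.
  exact: (is_derive_comp1 (is_derive1_powR a (f0 x Ux)) H).
- move=> f sf [f' sf' df] f0; exists (fun x => f x `^ (-1) * f' x).
    by apply: smooth_mul => //; exact: smooth_powR.
  move=> x Ux; have H := df x Ux.
  rewrite powR_inv1 ?(ltW (f0 _ Ux))//.
  exact: (is_derive_comp1 (is_derive1_ln (f0 x Ux)) H).
- move=> f sf [f' sf' df]; exists (fun x => expR (f x) * f' x).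
    by apply: smooth_mul => //; exact: smooth_expR.
  move=> x Ux; have H := df x Ux.
  exact: (is_derive_comp1 (is_derive_expR _) H).
- move=> d k f d0 sf [f' sf' df].
  exists (fun x => (- k%:R * flat d k.+1 (f x) + d * flat d k.+2 (f x)) * f' x).
    apply: smooth_mul => //; apply: smooth_add; apply: smooth_mul.
    + exact: smooth_cst.
    + exact: smooth_flat.
    + exact: smooth_cst.
    + exact: smooth_flat.
  move=> x Ux; have H := df x Ux.
  exact: (is_derive_comp1 (is_derive_flat d0 k _) H).
Qed.

Lemma near_eq_on U f g x : open U -> U x -> (forall y, U y -> f y = g y) ->
  \near x, f x = g x.
Proof. by move=> oU Ux fg; apply: filterS fg _; exact: open_nbhs_nbhs. Qed.

(** Partial derivatives at a point of the open set [U] depend only on values in [U], so those of [g]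
    are, by induction, again expressions on [U]. *)
Lemma smooth_expr_on U f g : open U -> smooth_expr U f ->
  (forall x, U x -> f x = g x) -> smooth_on U g.
Proof.
move=> oU sf fg s.
have [f' sf' fg'] : exists2 f', smooth_expr U f' & forall x, U x -> f' x = partials s g x.
  elim: s => [|i s [h sh hg]]; first by exists f.
  have [h' sh' dh] := smooth_expr_partial i sh; exists h' => // x Ux.
  have := dh x Ux => /(near_eq_is_derive (near_eq_on oU Ux hg)) [_ <-]//.
move=> x Ux; split.
  rewrite /prop_for /continuous_at -fg'//.
  apply: cvg_trans (smooth_expr_continuous sf' Ux).
  exact: (near_eq_cvg (near_eq_on oU Ux fg')).
move=> i; have [h' sh' dh] := smooth_expr_partial i sf'.
by have := dh x Ux => /(near_eq_is_derive (near_eq_on oU Ux fg')) [].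
Qed.

Lemma smooth_on_local U f :
  (forall x, U x -> exists2 V, V x & smooth_on V f) -> smooth_on U f.
Proof. by move=> UV s x /UV[V Vx Vf]; exact: Vf. Qed.

Lemma smooth_sub U f g : smooth_expr U f -> smooth_expr U g ->
  smooth_expr U (fun x => f x - g x).
Proof.
move=> sf sg; rewrite (_ : (fun x => _) = fun x => f x + (-1) * g x).
  by apply: smooth_add => //; apply: smooth_mul => //; exact: smooth_cst.
by apply/funext => x; rewrite mulN1r.
Qed.

Lemma smooth_ramp U d f : 0 < d -> smooth_expr U f -> smooth_expr U (fun x => ramp d (f x)).
Proof. by move=> d0 sf; apply: smooth_mul => //; exact: smooth_flat. Qed.

Lemma smooth_sum_sqr U (s : seq 'I_n) : smooth_expr U (fun x => \sum_(i <- s) x 0 i ^+ 2).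
Proof.
elim: s => [|i s IH].
  by rewrite (_ : (fun x => _) = fun=> 0); [exact: smooth_cst|apply/funext => x; rewrite big_nil].
rewrite (_ : (fun x => _) = fun x : 'rV[R]_n => x 0 i * x 0 i + \sum_(j <- s) x 0 j ^+ 2).
  by apply: smooth_add => //; apply: smooth_mul; exact: smooth_coord.
by apply/funext => x; rewrite big_cons expr2.
Qed.

Lemma smooth_enorm U : ~ U 0 -> smooth_expr U (@enorm R n).
Proof.
move=> U0; pose q (x : 'rV[R]_n) := \sum_i x 0 i ^+ 2.
have q0 x : 0 <= q x by apply: sumr_ge0 => i _; exact: sqr_ge0.
rewrite (_ : @enorm R n = fun x => q x `^ 2^-1).
  apply: smooth_powR; first exact: smooth_sum_sqr.
  move=> x Ux; rewrite lt_neqAle q0 andbT eq_sym.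
  have : enorm x != 0.
    by rewrite enorm_eq0; apply: contra_not_neq U0 => <-.
  by apply: contra_neq; rewrite /enorm -/(q x) => ->; exact: sqrtr0.
by apply/funext => x; rewrite powR12_sqrt.
Qed.

End smooth_expressions.

(** * Sharpness *)

Section cutoffs.
Context (R : realType).
Variables (d M : R).
Hypotheses (d0 : 0 < d) (M0 : 0 < M).
Implicit Types t : R.

(** A reflected ramp: a smooth version of the minimum of t and [M] that is exactly 0 at t = 0 and
    exactly constant for t >= M. *)
Definition soft_min t := ramp d M - ramp d (M - t).

(* For r > 1 the approximants must be smooth also where the extremal vanishes
   or is small, so the values below [d] are cut off. *)
Definition soft_cut t := ramp d (soft_min t - d).

Lemma is_derive_soft_min t : is_derive t 1 soft_min (dramp d (M - t)).
Proof.
have dM : is_derive t 1 (fun t => M - t) (0 - 1).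
  by apply: is_deriveB; exact: is_derive_id.
have h := @is_derive1_comp _ (ramp d) (fun t => M - t) t _ _ (is_derive_ramp _ d0) dM.
have : is_derive t 1 soft_min (0 - dramp d (M - t) * (0 - 1)).
  exact: is_deriveB.
by congr (is_derive _ _ _ _); ring.
Qed.

Lemma is_derive_soft_cut t : is_derive t 1 soft_cut (dramp d (soft_min t - d) * dramp d (M - t)).
Proof.
have h : is_derive t 1 (fun t => soft_min t - d) (dramp d (M - t) - 0).
  by apply: is_deriveB; exact: is_derive_soft_min.
have := @is_derive1_comp _ (ramp d) (fun t => soft_min t - d) t _ _ (is_derive_ramp _ d0) h.
by rewrite subr0.
Qed.

Lemma soft_min_const t : M <= t -> soft_min t = soft_min M.
Proof. by move=> Mt; rewrite /soft_min subrr [ramp d (M - t)]ramp_npos ?[ramp d 0]ramp_npos// subr_le0. Qed.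

Lemma soft_min_ge0 t : 0 <= t -> 0 <= soft_min t.
Proof. by move=> t0; rewrite subr_ge0; apply: ramp_homo => //; rewrite gerBl. Qed.

Lemma soft_min_le t : 0 <= t -> soft_min t <= t.
Proof.
move=> t0; have := @ramp_lipschitz _ d (M - t) M d0.
by rewrite gerBl subKr => /(_ t0).
Qed.

(* For [u <= M], [ramp d u <= u * expR (- (d / M))], with equality at [M]. *)
Lemma soft_min_ge t : 0 <= t -> expR (- (d / M)) * Num.min t M <= soft_min t.
Proof.
move=> t0; rewrite /soft_min (rampE _ M0) lerBrDr.
have [tM|Mt] := ltP t M; last by rewrite [ramp d (M - t)]ramp_npos ?subr_le0// addr0 mulrC.
have u0 : 0 < M - t by rewrite subr_gt0.
rewrite rampE// mulrC [leRHS]mulrC.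
rewrite (_ : expR (- (d / M)) * M = t * expR (- (d / M)) + (M - t) * expR (- (d / M))); last by ring.
by rewrite lerD2l ler_pM2l// ler_expR lerN2 ler_pM2l// lef_pV2 ?posrE// gerBl.
Qed.

Lemma soft_min_le_max t : soft_min t <= soft_min M.
Proof. by rewrite /soft_min subrr [ramp d 0]ramp_npos// subr0 gerBl ramp_ge0. Qed.

Lemma soft_cut_le t : 0 <= t -> soft_cut t <= t.
Proof.
move=> t0; have [c|c] := leP (soft_min t - d) 0; first by rewrite /soft_cut ramp_npos.
apply: le_trans (ramp_le (ltW d0) (ltW c)) _.
by rewrite lerBlDr (le_trans (soft_min_le t0))// lerDl ltW.
Qed.

Lemma soft_cut_ge t : soft_min t - d *+ 2 <= soft_cut t.
Proof. by apply: le_trans (ramp_ge _ (ltW d0)); rewrite mulr2n opprD addrA. Qed.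

Lemma soft_cut_eq0 t : 0 <= t <= d -> soft_cut t = 0.
Proof.
move=> /andP[t0 td]; rewrite /soft_cut ramp_npos// subr_le0; apply: le_trans td.
exact: soft_min_le.
Qed.

(** The properties shared by the cutoffs for r < 1 and r > 1. The loss in [cutoff_ge] is a factor
    exp(-d/M) and a term 2d, both harmless once [d] tends to 0 with [M] bounded below. *)
Record cutoff (N : R -> R) : Prop := Cutoff {
  cutoff_derive : forall t, exists2 D, is_derive t 1 N D & 0 <= D <= 1;
  cutoff_const : forall t, M <= t -> N t = N M;
  cutoff_ge0 : forall t, 0 <= t -> 0 <= N t;
  cutoff_le : forall t, 0 <= t -> N t <= t;
  cutoff_ge : forall t, 0 <= t -> expR (- (d / M)) * Num.min t M - d *+ 2 <= N t;
  cutoff_max : forall t, N t <= N M;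
  cutoff_smooth : forall n (U : set 'rV[R]_n) f, smooth_expr U f ->
    smooth_expr U (fun x => N (f x))
}.

Lemma cutoff_soft_min : cutoff soft_min.
Proof.
split.
- move=> t; exists (dramp d (M - t)); first exact: is_derive_soft_min.
  by rewrite dramp_ge0 ?dramp_le1 ?ltW.
- exact: soft_min_const.
- exact: soft_min_ge0.
- exact: soft_min_le.
- move=> t t0; apply: le_trans (soft_min_ge t0).
  by rewrite gerBl mulrn_wge0// ltW.
- exact: soft_min_le_max.
- move=> n U f sf; apply: smooth_sub; first exact: smooth_cst.
  by apply: smooth_ramp => //; apply: smooth_sub => //; exact: smooth_cst.
Qed.

Lemma cutoff_soft_cut : cutoff soft_cut.
Proof.
split.
- move=> t; exists (dramp d (soft_min t - d) * dramp d (M - t)); first exact: is_derive_soft_cut.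
  rewrite mulr_ge0 ?dramp_ge0 ?(ltW d0)//=.
  by rewrite mulr_ile1 ?dramp_le1 ?dramp_ge0 ?(ltW d0).
- by move=> t Mt; rewrite /soft_cut soft_min_const.
- by move=> t t0; exact: ramp_ge0.
- exact: soft_cut_le.
- by move=> t t0; apply: le_trans (soft_cut_ge t); rewrite lerB// soft_min_ge.
- by move=> t; apply: ramp_homo => //; rewrite lerB// soft_min_le_max.
- move=> n U f sf; apply: smooth_ramp => //; apply: smooth_sub; last exact: smooth_cst.
  exact: (cutoff_smooth cutoff_soft_min).
Qed.

End cutoffs.

(** * Smooth approximants of a radial extremal *)

Section enorm_topology.
Context (R : realType) (n : nat).

Lemma continuous_enorm : continuous (@enorm R n : 'rV[R]_n -> R).
Proof.
move=> x.
apply: (@continuous_comp _ _ _ (fun x : 'rV[R]_n => \sum_i x 0 i ^+ 2) (@Num.sqrt R)).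
  exact: (smooth_expr_continuous (smooth_sum_sqr setT _)).
exact: sqrt_continuous.
Qed.

Lemma open_enorm_lt (e : R) : open [set x : 'rV[R]_n | enorm x < e].
Proof.
apply: (@open_comp _ _ (@enorm R n) [set t | t < e]); last exact: open_lt.
by move=> x _; exact: continuous_enorm.
Qed.

Lemma open_neq0 : open [set x : 'rV[R]_n | x != 0].
Proof.
rewrite (_ : [set x | _] = [set x : 'rV[R]_n | 0 < enorm x]).
  apply: (@open_comp _ _ (@enorm R n) [set t | 0 < t]); last exact: open_gt.
  by move=> x _; exact: continuous_enorm.
by apply/seteqP; split => x /=; rewrite enorm_gt0.
Qed.

Lemma compact_supp_bounded (f : 'rV[R]_n -> R) (B : R) :
  (forall x, B < enorm x -> f x = 0) -> compact (supp f).
Proof.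
move=> fB.
have cB : closed [set x : 'rV[R]_n | enorm x <= B].
  apply: (@closed_comp _ _ (@enorm R n) [set t | t <= B]); last exact: closed_le.
  by move=> x _; exact: continuous_enorm.
have bB : bounded_set [set x : 'rV[R]_n | enorm x <= B].
  exists B; split; first exact: num_real.
  move=> b Bb x /= xB; rewrite (le_trans _ (ltW Bb))// (le_trans _ xB)//.
  have [x0|/mx_norm_neq0[[i j] /= xij]] := eqVneq (mx_norm x) 0.
    by rewrite [`|x|]x0 sqrtr_ge0.
  by rewrite [`|x|]xij ord1 coord_le_enorm.
apply: (subclosed_compact _ (bounded_closed_compact bB cB)); first exact: closed_closure.
rewrite /supp closureE; apply: smallest_sub => // x /=.
by rewrite leNgt; apply: contra_neqN => /fB.
Qed.

End enorm_topology.

Section approximants.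
Context (R : realType) (n : nat).
Variables (d M delta : R) (F : R -> R).
Hypotheses (d0 : 0 < d) (M0 : 0 < M) (delta0 : 0 < delta).
Hypothesis F0 : forall t, 0 < t -> 0 <= F t.
Hypothesis cF : forall t, 0 < t -> {for t, continuous F}.
Hypothesis FM : forall t, 0 < t < delta -> M <= F t.
Hypothesis sF : forall U : set 'rV[R]_n,
  (forall x, U x -> x != 0 /\ 0 < F (enorm x)) ->
  exists2 f, smooth_expr U f & forall x, U x -> f x = F (enorm x).

(** As [F] is at least [M] near 0, the composition is constantly [N M] on a punctured ball; this
    value at the origin makes it smooth there, whatever [F] does at 0. *)
Definition approximant (N : R -> R) (x : 'rV[R]_n) : R :=
  if x == 0 then N M else N (F (enorm x)).

Let open_profile (A : set R) : open A ->
  open [set x : 'rV[R]_n | x != 0 /\ A (F (enorm x))].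
Proof.
move=> oA; rewrite openE => x [x0 Ax]; rewrite /interior.
have ex : 0 < enorm x by rewrite enorm_gt0.
apply: filterI; first exact: (open_nbhs_nbhs (conj (@open_neq0 R n) x0)).
have : {for x, continuous (fun x : 'rV[R]_n => F (enorm x))}.
  apply: (@continuous_comp _ _ _ (fun x : 'rV[R]_n => enorm x) F); first exact: continuous_enorm.
  exact: cF.
by apply; exact: open_nbhs_nbhs.
Qed.

Section cutoff_approximant.
Variable N : R -> R.
Hypothesis cN : cutoff d M N.

Let N0 : N 0 = 0.
Proof.
by apply: le_anti; rewrite (cutoff_ge0 cN (lexx _)) (cutoff_le cN (lexx _)).
Qed.

Lemma approximant_near0 x : enorm x < delta -> approximant N x = N M.
Proof.
rewrite /approximant; case: eqVneq => // x0 xd.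
by rewrite (cutoff_const cN)// FM// enorm_gt0 x0.
Qed.

Lemma approximant_neq0 x : x != 0 -> approximant N x = N (F (enorm x)).
Proof. by rewrite /approximant => /negbTE ->. Qed.

Lemma approximant_smooth0 : smooth_on [set x | enorm x < delta] (approximant N).
Proof.
apply: (@smooth_expr_on _ _ _ (fun=> N M)).
- exact: open_enorm_lt.
- exact: smooth_cst.
- by move=> x xd; rewrite approximant_near0.
Qed.

Lemma approximant_smooth_gt0 :
  smooth_on [set x | x != 0 /\ 0 < F (enorm x)] (approximant N).
Proof.
set U := [set x : 'rV[R]_n | _].
have [f sf fF] := sF (U := U) (fun x Ux => Ux).
apply: (@smooth_expr_on _ _ _ (fun x => N (f x))).
- exact: (open_profile (@open_gt R 0)).
- exact: (cutoff_smooth cN).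
- by move=> x [x0 Fx]; rewrite fF// approximant_neq0.
Qed.

Lemma approximant_weak_test_fun (B : R) :
  (forall t, 0 < t -> B < t -> F t = 0) -> weak_test_fun (approximant N).
Proof.
move=> FB; split.
- move=> x; have [x0|x0] := eqVneq x 0.
    have xd : enorm x < delta by rewrite x0 (_ : enorm 0 = 0)//; apply/eqP; rewrite enorm_eq0.
    by have [] := approximant_smooth0 [::] xd.
  have ex : 0 < enorm x by rewrite enorm_gt0.
  have : {for x, continuous (fun x : 'rV[R]_n => N (F (enorm x)))}.
    apply: (@continuous_comp _ _ _ (fun x : 'rV[R]_n => F (enorm x)) N).
      apply: (@continuous_comp _ _ _ (fun x : 'rV[R]_n => enorm x) F); first exact: continuous_enorm.
      exact: cF.
    by have [D dN _] := cutoff_derive cN (F (enorm x)); exact: is_derive_continuous dN.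
  rewrite /prop_for /continuous_at -(approximant_neq0 x0); apply: cvg_trans.
  have E (y : 'rV[R]_n) : y != 0 -> N (F (enorm y)) = approximant N y.
    by move=> y0; rewrite approximant_neq0.
  exact: (near_eq_cvg (near_eq_on (@open_neq0 R n) x0 E)).
- apply: (@compact_supp_bounded _ _ _ (Num.max B 0)) => x; rewrite gt_max => /andP[xB x0].
  by rewrite approximant_neq0 -?enorm_gt0// FB.
- apply: smooth_on_local => x /= gx; have [x0|x0] := eqVneq x 0.
    exists [set x | enorm x < delta]; last exact: approximant_smooth0.
    by rewrite /= x0 (_ : enorm 0 = 0)//; apply/eqP; rewrite enorm_eq0.
  exists [set x | x != 0 /\ 0 < F (enorm x)]; last exact: approximant_smooth_gt0.
  split=> //; rewrite lt_neqAle F0 ?enorm_gt0// andbT eq_sym.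
  by apply: contra_neq gx => Fx; rewrite approximant_neq0// Fx N0.
Qed.

End cutoff_approximant.

(** Where F < d the lower cut makes the function vanish identically, which covers the zeros of [F],
    and compactness of the support follows from [F] being at most [d] far away. Elsewhere [F] is
    positive and smooth. *)
Lemma approximant_test_fun (B : R) :
  (forall t, 0 < t -> B < t -> F t <= d) -> test_fun (approximant (soft_cut d M)).
Proof.
move=> FB; have cN := cutoff_soft_cut d0 M0; split.
- apply: smooth_on_local => x _; have [x0|x0] := eqVneq x 0.
    exists [set x | enorm x < delta]; last exact: approximant_smooth0.
    by rewrite /= x0 (_ : enorm 0 = 0)//; apply/eqP; rewrite enorm_eq0.
  have [Fd|Fd] := ltP (F (enorm x)) d.
    exists [set x | x != 0 /\ F (enorm x) < d] => //.
    apply: (@smooth_expr_on _ _ _ (fun=> 0)).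
    + exact: (open_profile (@open_lt R d)).
    + exact: smooth_cst.
    + by move=> y [y0 Fy]; rewrite approximant_neq0// soft_cut_eq0// F0 ?enorm_gt0//= ltW.
  exists [set x | x != 0 /\ 0 < F (enorm x)]; last exact: approximant_smooth_gt0.
  by split=> //; exact: lt_le_trans Fd.
- apply: (@compact_supp_bounded _ _ _ (Num.max B 0)) => x; rewrite gt_max => /andP[xB x0].
  by rewrite approximant_neq0 -?enorm_gt0// soft_cut_eq0// F0//= FB.
Qed.

End approximants.

Lemma measurable_radial (R : realType) n (F : R -> R) :
  (forall t, 0 < t -> {for t, continuous F}) ->
  measurable_fun setT (fun x : 'rV[R]_n => F (enorm x)).
Proof.
move=> cF.
rewrite (_ : setT = [set x : 'rV[R]_n | x != 0] `|` [set 0]); last first.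
  by apply/seteqP; split => x // _; have [->|x0] := eqVneq x 0; [right|left].
apply/measurable_funU.
- by apply: open_measurable_rV; exact: open_neq0.
- exact: measurable_rV0.
split; last exact: measurable_fun_set1.
apply: open_continuous_measurable_rV; first exact: open_neq0.
move=> x x0; apply: (@continuous_comp _ _ _ (fun x : 'rV[R]_n => enorm x) F).
  exact: continuous_enorm.
by apply: cF; rewrite enorm_gt0.
Qed.

Lemma cvg_div_nondecreasing (R : realType) (d M : nat -> R) :
  (forall j, 0 < d j) -> (forall j, 0 < M j) -> nondecreasing_seq M ->
  d j @[j --> \oo] --> 0 -> d j / M j @[j --> \oo] --> 0.
Proof.
move=> d0 M0 dM d_cvg.
apply: (@squeeze_cvgr _ _ _ _ (fun=> 0) (fun j => d j / M 0%N)).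
- apply: nearW => j; rewrite divr_ge0 ?(ltW (d0 _)) ?(ltW (M0 _))//=.
  by rewrite ler_pM2l// lef_pV2 ?posrE// dM.
- exact: cvg_cst.
- by rewrite -(mul0r (M 0%N)^-1); apply: cvgMl.
Qed.

(** * Optimality of the constant *)

Section optimality.
Context (R : realType) (n : nat).
Variables (p r alpha beta gamma : R).
Hypothesis n0 : (0 < n)%N.
Hypothesis p1 : 1 < p.
Hypothesis r0 : 0 < r.
Hypothesis r1 : r != 1.
Hypothesis gammaE : gamma * r = 1 + alpha + (p - 1) / p * beta.
Hypothesis m0 : 0 < n%:R - gamma * r.
Let m := n%:R - gamma * r.
Let s := 1 + alpha - beta / p.
Let sigma := (r - 1) / (p - 1).
Let e0 := p * (r - 1) / (p - 1).
Let mu := lebesgue_rV R n.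
Let K := r / (n%:R - gamma * r).
Local Notation lhs := (ckn_lhs r gamma).
Local Notation grad := (ckn_grad p alpha).
Local Notation pot := (ckn_pot p r beta setT).

Variables (a L C : R) (F : R -> R).
Hypothesis a0 : 0 < a.
Hypothesis FP : radial_profile p r s m a L C F.
Hypothesis F0 : forall t, 0 <= F t.
Hypothesis cF : forall t, 0 < t -> {for t, continuous F}.

Let f (x : 'rV[R]_n) := F (enorm x).

Variables (d M : nat -> R) (N : nat -> R -> R).
Hypotheses (d0 : forall j, 0 < d j) (M0 : forall j, 0 < M j).
Hypotheses (dd : nonincreasing_seq d) (dM : nondecreasing_seq M).
Hypothesis d_cvg : d j @[j --> \oo] --> 0.
Hypothesis M_cvg : forall t, Num.min (F t) (M j) @[j --> \oo] --> F t.
Hypothesis M_near : forall j, \forall t \near 0^'+, M j <= F t.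
Hypothesis cN : forall j, cutoff (d j) (M j) (N j).

Let g j : 'rV[R]_n -> R := approximant (M j) F (N j).
Let q j := expR (- (d j / M j)).
(** The approximants [g j] are not shown to be monotone in j. Their lower bound [h j] increases to
    [f], since [q] and [M] increase and [d] decreases, so monotone convergence is applied to it. *)
Let h j (x : 'rV[R]_n) : R := Num.max (q j * Num.min (f x) (M j) - d j *+ 2) 0.

Let p0 : 0 < p. Proof. exact: lt_trans p1. Qed.

Let mf : measurable_fun setT f.
Proof. exact: measurable_radial. Qed.

Let fE w (t : R) : usphere w -> 0 < t -> f (t *: w) = F t.
Proof. by move=> w1 t0; rewrite /f enorm_ray ?(ltW t0). Qed.

Let absf x : `|f x| = f x. Proof. by rewrite ger0_norm ?F0. Qed.

Let extremal_f : ckn_extremal p r alpha beta gamma K f.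
Proof.
apply: (ckn_extremal_profile n0 p1 r0 r1 gammaE m0 (a := a) (L := cst L) (C := cst C)
  (G := fun=> F)).
- exact: ltW.
- exact: mf.
- exact: measurable_cst.
- by move=> w w1; exists 1; [exact: normr1|move=> t t0; rewrite fE// mul1r].
- by move=> w _; exact: FP.
have -> := integral_cst (@surface_measure R n) (@measurable_usphere R n) C%:E.
have := surface_measure_fin (@measurable_usphere R n).
have /= := measure_ge0 (@surface_measure R n) (@usphere R n).
by case: surface_measure => //= x _ _; rewrite -EFinM ltry.
Qed.

Let lhs_fin : (lhs f < +oo)%E. Proof. by have [] := extremal_f. Qed.

Let lhs_f : lhs f = ((K * a)%:E * pot f)%E.
Proof.
apply: (ckn_lhs_ray_identity n0 p1 r0 gammaE m0 (ltW a0) mf) => w w1.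
have := radial_profile_eq FP; rewrite -/m -/s -/e0 => H.
transitivity (\int[@lebesgue_measure R]_(t in `]0%R, +oo[) (F t `^ r * t `^ (m - 1))%:E)%E.
  by apply: eq_integral => t; rewrite inE/= in_itv/= andbT => t0; rewrite absf fE.
rewrite H; apply: eq_integral => t; rewrite inE/= in_itv/= andbT => t0.
by rewrite absf fE.
Qed.

Let grad_g j : (grad (g j) <= (a `^ p)%:E * pot f)%E.
Proof.
apply: (ckn_grad_le_pot n0 p1 (ltW a0) mf (measurable_cst L)).
have := @negligible_radial_graph R n n0 (cst L) (measurable_cst L).
apply: filterS => x [x0 xL].
have ex : 0 < enorm x by rewrite enorm_gt0.
have [D dN /andP[D0 D1]] := cutoff_derive (cN j) (F (enorm x)).
have dF := radial_profile_derive FP ex xL.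
have dNF := is_derive1_comp dN dF.
have dg : is_derive x (dir x) (g j) (D * - (a * enorm x `^ (s - 1) * F (enorm x) `^ sigma)).
  rewrite -{1}[x]enormK -[enorm x *: dir x]add0r; apply/is_derive_ray.
  apply: near_eq_is_derive dNF; near=> t.
  have t0 : 0 < t by near: t; exact: lt_nbhsr.
  have tw : t *: dir x != 0 by rewrite -enorm_gt0 (enorm_ray (ltW t0) (usphere_dir x0)).
  by rewrite /= add0r /g approximant_neq0// (enorm_ray (ltW t0) (usphere_dir x0)).
rewrite /radial_derive -/s -/sigma; have [_ ->] := dg.
have Y0 : 0 <= a * enorm x `^ (s - 1) * F (enorm x) `^ sigma.
  by rewrite mulr_ge0 ?powR_ge0// mulr_ge0 ?powR_ge0// ltW.
by rewrite mulrN normrN absf normrM !ger0_norm// ler_piMl.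
Unshelve. all: by end_near. Qed.

Let h_le j x : h j x <= g j x.
Proof.
have N0 t : 0 <= t -> Num.max (q j * Num.min t (M j) - d j *+ 2) 0 <= N j t.
  by move=> t0; rewrite ge_max (cutoff_ge (cN j))// (cutoff_ge0 (cN j)).
apply: (le_trans (N0 _ (F0 (enorm x)))).
rewrite /g /approximant; case: eqP => // _; exact: cutoff_max (cN j) _.
Qed.

Let h_ge0 j x : 0 <= h j x. Proof. by rewrite le_max lexx orbT. Qed.

Let lhs_g j : (lhs (h j) <= lhs (g j))%E.
Proof.
apply: ge0_le_integral_nomeas => x; first by rewrite lee_fin divr_ge0 ?powR_ge0.
rewrite lee_fin ler_wpM2r ?invr_ge0 ?powR_ge0//.
rewrite ge0_ler_powR ?nnegrE ?(ltW r0)// (ger0_norm (h_ge0 j x)).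
exact: le_trans (h_le j x) (ler_norm _).
Qed.

Let h_homo j k x : (j <= k)%N -> h j x <= h k x.
Proof.
move=> jk; rewrite /h ge_max le_max; apply/andP; split; last by rewrite le_max lexx orbT.
apply/orP; left; rewrite lerB//; last by rewrite lerMn2r dd// orbT.
rewrite ler_pM ?expR_ge0//.
- by rewrite le_min F0 ltW.
- rewrite ler_expR lerN2 ler_pM ?invr_ge0 ?(ltW (d0 _)) ?(ltW (M0 _)) ?dd//.
  by rewrite lef_pV2 ?posrE ?M0// dM.
- by rewrite le_min ge_min lexx/= ge_min dM ?orbT.
Qed.

Let h_le_f j x : h j x <= f x.
Proof.
rewrite ge_max F0 andbT lerBlDr; apply: (@le_trans _ _ (f x)); last first.
  by rewrite lerDl mulrn_wge0// ltW.
apply: (@le_trans _ _ (1 * f x)); last by rewrite mul1r.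
rewrite ler_pM ?expR_ge0//.
- by rewrite le_min F0 ltW.
- by rewrite expR_le1 oppr_le0 divr_ge0 ?ltW.
- by rewrite ge_min lexx.
Qed.

Let h_cvg x : h j x @[j --> \oo] --> f x.
Proof.
have q_cvg : q j @[j --> \oo] --> (1 : R).
  rewrite -(@expR0 R); apply: (@continuous_cvg _ _ _ _ _ _ (@expR R)).
    exact: continuous_expR.
  by rewrite -oppr0; apply: cvgN; exact: cvg_div_nondecreasing.
apply: (@squeeze_cvgr _ _ _ _ (fun j => q j * Num.min (f x) (M j) - d j *+ 2) (fun=> f x)).
- by apply: nearW => j; rewrite h_le_f le_max lexx.
- rewrite -[X in _ --> X]subr0 -[X in _ --> X - _]mul1r -(mul0rn _ 2).
  apply: cvgB; last exact: cvgMn.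
  by apply: cvgM => //; exact: M_cvg.
- exact: cvg_cst.
Qed.

Let lhs_h_cvg : lhs (h j) @[j --> \oo] --> lhs f.
Proof.
have H := @cvg_monotone_convergence _ _ _ mu setT measurableT
  (fun j x => (`|h j x| `^ r / enorm x `^ (gamma * r))%:E).
have mh j : measurable_fun setT (fun x => (`|h j x| `^ r / enorm x `^ (gamma * r))%:E).
  apply/measurable_EFinP; apply: measurable_div_enorm.
  apply: (measurableT_comp (measurable_powR _)); apply: measurableT_comp => //.
  apply: measurable_maxr => //; apply: measurable_funB => //.
  by apply: measurable_funM => //; exact: measurable_minr.
have hge0 j x : setT x -> (0 <= (`|h j x| `^ r / enorm x `^ (gamma * r))%:E)%E.
  by move=> _; rewrite lee_fin divr_ge0 ?powR_ge0.
have hnd x : setT x ->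
    nondecreasing_seq (fun j => (`|h j x| `^ r / enorm x `^ (gamma * r))%:E).
  move=> _ j k jk; rewrite lee_fin ler_wpM2r ?invr_ge0 ?powR_ge0//.
  by rewrite ge0_ler_powR ?nnegrE ?(ltW r0)// !(ger0_norm (h_ge0 _ _)) h_homo.
have {H} := H mh hge0 hnd.
congr (_ --> _); apply: eq_integral => x _; apply/cvg_lim => //.
apply: cvg_EFin; first exact: nearW.
apply: cvgMl; rewrite absf; under eq_fun do rewrite (ger0_norm (h_ge0 _ _)).
have [fx|fx] := eqVneq (f x) 0.
  rewrite fx (_ : (fun j => _) = fun=> 0 `^ r); first exact: cvg_cst.
  apply/funext => j; congr (_ `^ _); apply: le_anti; rewrite h_ge0 andbT.
  by rewrite -fx h_le_f.
apply: (@continuous_cvg _ _ _ _ _ _ (fun z => z `^ r)).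
  by apply: continuous_powR_gt0; rewrite lt_neqAle eq_sym fx F0.
exact: h_cvg.
Qed.

Hypothesis g_class : forall j, ckn_class r (g j).
Variables c b : nat -> R.
Hypothesis c_cvg : c j @[j --> \oo] --> (1 : R).
Hypothesis b_cvg : b j @[j --> \oo] --> 0.
Hypothesis pot_g : forall j, (pot (g j) <= (c j)%:E * pot f + (b j)%:E)%E.

(** Needed to divide by the potential integral of [f], which is proportional to the left side. *)
Let lhs_gt0 : (0 < lhs f)%E.
Proof.
rewrite lt_neqAle; apply/andP; split; last first.
  by apply: integral_ge0 => x _; rewrite lee_fin divr_ge0 ?powR_ge0.
apply/eqP => lhs0.
have mI : measurable_fun setT (fun x : 'rV[R]_n => (`|f x| `^ r / enorm x `^ (gamma * r))%:E).
  apply/measurable_EFinP; apply: measurable_div_enorm.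
  by apply: (measurableT_comp (measurable_powR _)); exact: measurableT_comp.
have [delta /= delta0 FM] := M_near 0.
(* On the box the squared norm is at most n e^2, which is below delta^2 for this [e]; so [F] is at
   least [M 0] there. *)
pose e : R := delta / n.+1%:R.
have e_gt0 : 0 < e by rewrite divr_gt0.
pose box : set 'rV[R]_n := [set x : 'rV[R]_n | forall i, e / 2 < x 0 i <= e].
have e2 : e / 2 < e by rewrite ltr_pdivrMr// ltr_pMr// ltr1n.
have box_gt0 x : box x -> (`|f x| `^ r / enorm x `^ (gamma * r))%:E != 0%E.
  move=> bx.
  have xi i : 0 < x 0 i by have /andP[+ _] := bx i; apply: lt_trans; rewrite divr_gt0.
  have ex : 0 < enorm x.
    rewrite enorm_gt0; apply/eqP => x0.
    by have := xi (Ordinal n0); rewrite x0 mxE ltxx.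
  have exd : enorm x < delta.
    rewrite -(@ltr_pXn2r _ 2)// ?nnegrE ?(ltW ex) ?(ltW delta0)// enorm_sqr.
    apply: (@le_lt_trans _ _ (\sum_(i < n) e ^+ 2)).
      apply: ler_sum => i _; have /andP[_ xe] := bx i.
      by rewrite ler_pXn2r ?nnegrE ?(ltW (xi i)) ?(ltW e_gt0).
    rewrite sumr_const card_ord /e expr_div_n -mulrnAr -[ltRHS]mulr1 ltr_pM2l ?exprn_gt0//.
    by rewrite -mulr_natr mulrC ltr_pdivrMr ?exprn_gt0// mul1r -natrX ltr_nat -mulnn leq_pmulr.
  have fx : 0 < f x.
    apply: lt_le_trans (M0 0) _; apply: FM => //=.
    by rewrite sub0r normrN gtr0_norm.
  by rewrite eqe gt_eqF// absf divr_gt0 ?powR_gt0.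
have /(ae_eq_integral_abs _ measurableT mI) [Z [mZ Z0 HZ]] :
    (\int[mu]_x `|(`|f x| `^ r / enorm x `^ (gamma * r))%:E| = 0)%E.
  rewrite [RHS]lhs0; apply: eq_integral => x _.
  by rewrite gee0_abs// lee_fin divr_ge0 ?powR_ge0.
have boxZ : box `<=` Z.
  by move=> x bx; apply: HZ => /= /(_ Logic.I) E; have := box_gt0 x bx; rewrite E eqxx.
have : (mu box <= mu Z)%E.
  apply: le_measure => //; rewrite inE//.
  exact: measurable_box.
rewrite [mu Z]Z0 [mu box]lebesgue_rV_box ?(ltW e2)// lee_fin leNgt => /negP; apply.
by rewrite exprn_gt0// subr_gt0.
Qed.

Theorem ckn_constant_optimal C' :
  (forall u : 'rV[R]_n -> R, ckn_class r u -> ckn_ineq p r alpha beta gamma (ckn_domain r u) C' u) ->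
  K <= C'.
Proof.
move=> C'P.
have K0 : 0 < K by rewrite divr_gt0.
have [x x0 potx] : exists2 x : R, 0 < x & pot f = x%:E.
  have pot0 : (0 <= pot f)%E by apply: integral_ge0 => x _; rewrite lee_fin divr_ge0 ?powR_ge0.
  have Ka : 0 < K * a by rewrite mulr_gt0.
  move: pot0 lhs_fin lhs_gt0; rewrite lhs_f; case: (pot f) => [x|_|//].
    by rewrite -EFinM !lte_fin pmulr_rgt0// => _ _ x0; exists x.
  by rewrite gt0_muley ?lte_fin.
(* A negative [C'] would reverse the upper bounds for the right side; its positive part may replace
   it, since [K] is positive. *)
pose c' := Num.max C' 0.
have c'0 : 0 <= c' by rewrite le_max lexx orbT.
(* The right side for [g j], bounded through gradient <= a^p x and potential <= c_j x + b_j. It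
   tends to c' a x, while the left sides of the [h j] tend to K a x. *)
pose v j := c' * (a * x `^ p^-1 * (c j * x + b j) `^ ((p - 1) / p)).
have le_v j : (lhs (h j) <= (v j)%:E)%E.
  apply: le_trans (lhs_g j) _; apply: le_trans (C'P _ (g_class j)) _.
  rewrite /ckn_rhs ckn_pot_domain// /v [X in (_ <= X)%E]EFinM.
  apply: (@le_trans _ _ (c'%:E * (grad (g j) `^ p^-1 * pot (g j) `^ ((p - 1) / p)))%E).
    by apply: lee_wpmul2r; rewrite ?mule_ge0 ?poweR_ge0// lee_fin le_max lexx.
  apply: lee_wpmul2l; first by rewrite lee_fin.
  have grad0 : (0 <= grad (g j))%E by apply: integral_ge0 => y _; rewrite lee_fin divr_ge0 ?powR_ge0.
  have pot0 : (0 <= pot (g j))%E by apply: integral_ge0 => y _; rewrite lee_fin divr_ge0 ?powR_ge0.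
  have := grad_g j; have := pot_g j; rewrite potx -!EFinM -EFinD => pj gj.
  rewrite EFinM; apply: lee_pmul; rewrite ?poweR_ge0//.
    rewrite [leRHS](_ : _ = (a `^ p * x)%:E `^ p^-1)%E; last first.
      rewrite poweR_EFin powRM ?powR_ge0 ?(ltW x0)// -powRrM mulfV ?gt_eqF//.
      by rewrite powRr1// ltW.
    apply: gt0_ler_poweR; rewrite ?in_itv/= ?leey ?andbT// ?invr_ge0 ?(ltW p0)//.
    exact: le_trans gj.
  rewrite -poweR_EFin; apply: gt0_ler_poweR; rewrite ?in_itv/= ?leey ?andbT//.
    by rewrite divr_ge0// ?(ltW p0)// subr_ge0 ltW.
  exact: le_trans pj.
have v_cvg : v j @[j --> \oo] --> c' * (a * x `^ p^-1 * (1 * x + 0) `^ ((p - 1) / p)).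
  apply: cvgMr; apply: cvgMr.
  apply: (@continuous_cvg _ _ _ _ _ _ (fun z => z `^ ((p - 1) / p))).
    by apply: continuous_powR_gt0; rewrite mul1r addr0.
  by apply: cvgD => //; exact: cvgMl.
have vE : c' * (a * x `^ p^-1 * (1 * x + 0) `^ ((p - 1) / p)) = c' * (a * x).
  rewrite mul1r addr0 -mulrA -powRD_gt0// (_ : _ + _ = 1) ?powRr1 ?(ltW x0)//.
  by field; rewrite gt_eqF.
have KC : K * a * x <= c' * (a * x).
  apply/ler_addgt0Pr => e e_gt0; rewrite -lee_fin EFinM -potx -lhs_f.
  apply: cvge_to_le lhs_h_cvg _.
  move/cvgrPdist_le : v_cvg => /(_ e e_gt0); rewrite vE; apply: filterS => j vj.
  apply: le_trans (le_v j) _; rewrite lee_fin.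
  by move: vj; rewrite distrC => /(le_trans (ler_norm _)); rewrite lerBlDl.
have : K <= c' by rewrite -(ler_pM2r (mulr_gt0 a0 x0)) mulrA.
by rewrite le_max => /orP[//|]; rewrite leNgt K0.
Qed.

End optimality.

(** For r < 1 the truncation at height [M] adds a constant to the potential power on the unit ball;
    this makes the added integral finite. *)
Lemma ball_weight_fin (R : realType) n (beta : R) : (0 < n)%N -> 0 < n%:R - beta ->
  (\int[lebesgue_rV R n]_x (\1_[set x : 'rV[R]_n | (enorm x < 1)%R] x / enorm x `^ beta)%:E < +oo)%E.
Proof.
move=> n0 nb; set I := \1__.
have mI : measurable_fun setT I.
  apply: measurable_indic; apply: open_measurable_rV; exact: open_enorm_lt.
rewrite (@ge0_integral_polar _ _ (fun x => (I x / enorm x `^ beta)%:E))//; last 2 first.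
- by apply/measurable_EFinP; exact: measurable_div_enorm.
- by move=> x; rewrite lee_fin divr_ge0 ?powR_ge0.
rewrite (eq_integral (cst ((1 `^ (n%:R - beta) / (n%:R - beta))%:E))); last first.
  move=> w; rewrite inE => w1 /=; rewrite -integral_powR_bounded//.
  rewrite integral_mkcond [RHS]integral_mkcond; apply: eq_integral => t _.
  rewrite !patchE !mem_setE !in_itv/= andbT.
  have [t0|//] := boolP (0 < t).
  rewrite -EFinM /I indicE (_ : (t *: w \in _) = (t < 1)); last first.
    by apply/idP/idP; rewrite inE/= (enorm_ray (ltW t0) w1).
  have [t1|t1] := ltP t 1; last by rewrite !mul0r.
  rewrite (enorm_ray (ltW t0) w1) mul1r -powRN -powR_mulrn ?(ltW t0)// -powRD_gt0//.
  by congr (_ `^ _)%:E; rewrite -subn1 natrB//; ring.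
have -> := integral_cst (@surface_measure R n) (@measurable_usphere R n)
  (1 `^ (n%:R - beta) / (n%:R - beta))%:E.
rewrite lte_mul_pinfty ?lee_fin ?divr_ge0 ?powR_ge0 ?ltW//.
exact: surface_measure_fin (@measurable_usphere R n).
Qed.

Section sharpness.
Context (R : realType) (n : nat).
Variables (p r alpha beta gamma : R).
Hypothesis n0 : (0 < n)%N.
Hypothesis p1 : 1 < p.
Hypothesis r0 : 0 < r.
Hypothesis r1 : r != 1.
Hypothesis gammaE : gamma * r = 1 + alpha + (p - 1) / p * beta.
Hypothesis m0 : 0 < n%:R - gamma * r.
Let m := n%:R - gamma * r.
Let s := 1 + alpha - beta / p.
Let e0 := p * (r - 1) / (p - 1).
Let mu := lebesgue_rV R n.
Let K := r / (n%:R - gamma * r).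
Local Notation pot := (ckn_pot p r beta setT).
Local Notation sharp := (ckn_best_constant n p r alpha beta gamma K).

Lemma ckn_class_ineq (f : 'rV[R]_n -> R) : ckn_class r f ->
  ckn_ineq p r alpha beta gamma (ckn_domain r f) K f.
Proof.
move=> fc; apply: (ckn_ineq_weak n0 p1 r0 r1 gammaE m0).
  move: fc; rewrite /ckn_class; case: ifP => // _ [sf kf]; split=> //.
    by move=> x; have [] := sf [::] x Logic.I.
  by move=> s0 x _; exact: sf.
by move=> x fx; rewrite /ckn_domain; case: ifP => // _; exact: subset_closure.
Qed.

Variables (a L C : R) (F : R -> R) (M : nat -> R).
Hypothesis a0 : 0 < a.
Hypothesis FP : radial_profile p r s m a L C F.
Hypothesis F0 : forall t, 0 <= F t.
Hypothesis cF : forall t, 0 < t -> {for t, continuous F}.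
Hypothesis sF : forall U : set 'rV[R]_n,
  (forall x, U x -> x != 0 /\ 0 < F (enorm x)) ->
  exists2 f, smooth_expr U f & forall x, U x -> f x = F (enorm x).
Hypothesis M0 : forall j, 0 < M j.
Hypothesis dM : nondecreasing_seq M.
Hypothesis M_cvg : forall t, Num.min (F t) (M j) @[j --> \oo] --> F t.
Hypothesis M_near : forall j, \forall t \near 0^'+, M j <= F t.

Let d : nat -> R := @harmonic R.
Let f (x : 'rV[R]_n) := F (enorm x).

Let d0 j : 0 < d j. Proof. by rewrite /d /harmonic invr_gt0. Qed.

Let dd : nonincreasing_seq d.
Proof. by move=> i j ij; rewrite /d /harmonic lef_pV2 ?posrE// ler_nat. Qed.

Let delta_near j : exists2 delta, 0 < delta & forall t, 0 < t < delta -> M j <= F t.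
Proof.
have [delta /= delta0 FM] := M_near j; exists delta => // t /andP[t0 td].
by apply: FM => //=; rewrite sub0r normrN gtr0_norm.
Qed.

Let p0 : 0 < p. Proof. exact: lt_trans p1. Qed.

Let mf : measurable_fun setT f.
Proof. exact: measurable_radial. Qed.

Let mpotf : measurable_fun setT (fun x => (`|f x| `^ e0 / enorm x `^ beta)%:E).
Proof.
apply/measurable_EFinP; apply: measurable_div_enorm.
by apply: (measurableT_comp (measurable_powR _)); exact: measurableT_comp.
Qed.

Let ae_neq0 (P : 'rV[R]_n -> Prop) : (forall x, x != 0 -> P x) -> {ae mu, forall x, P x}.
Proof.
move=> xP; have := @negligible_radial_graph R n n0 (cst 0) (measurable_cst _).
by apply: filterS => x [/xP].
Qed.

(** For r > 1 the exponent of the potential is positive and the cutoff lies below the identity, so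
    the potential term can only decrease: c = 1 and b = 0. *)
Lemma ckn_sharp_gt1 : 1 < r ->
  (forall e, 0 < e -> exists B, forall t, 0 < t -> B < t -> F t <= e) -> sharp.
Proof.
move=> r_gt1 Ffar; have rN : (r < 1) = false by apply/negbTE; rewrite -leNgt ltW.
split; first exact: ckn_class_ineq.
apply: (@ckn_constant_optimal R n p r alpha beta gamma n0 p1 r0 r1 gammaE m0 a L C F
  a0 FP F0 cF d M (fun j => soft_cut (d j) (M j)) d0 M0 dd dM (@cvg_harmonic R) M_cvg M_near
  (fun j => cutoff_soft_cut (d0 j) (M0 j)) _ (fun=> 1) (fun=> 0)).
- move=> j; rewrite /ckn_class rN.
  have [delta delta0 FM] := delta_near j; have [B FB] := Ffar _ (d0 j).
  exact: (approximant_test_fun (d0 j) (M0 j) delta0 (fun t _ => F0 t) cF FM sF FB).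
- exact: cvg_cst.
- exact: cvg_cst.
- move=> j; rewrite mul1e adde0; apply: ae_le_integral_measurabler.
  + exact: mpotf.
  + by move=> x; rewrite lee_fin divr_ge0 ?powR_ge0.
  + by move=> x; rewrite lee_fin divr_ge0 ?powR_ge0.
  apply: ae_neq0 => x x0; rewrite lee_fin ler_wpM2r ?invr_ge0 ?powR_ge0//.
  have cN := cutoff_soft_cut (d0 j) (M0 j).
  rewrite approximant_neq0// ge0_ler_powR ?nnegrE//.
    by rewrite divr_ge0 ?mulr_ge0 ?subr_ge0 ?(ltW p0) ?(ltW p1) ?(ltW r_gt1).
  by rewrite !ger0_norm ?(cutoff_le cN) ?(cutoff_ge0 cN) ?F0.
Qed.

Hypothesis nb : 0 < n%:R - beta.

(** For r < 1 the exponent [e0] is negative, so the upper bound for the potential comes from the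
    lower bound exp(-d/M) min(F, M) of the cutoff. There must be no subtracted term here, as it
    would ruin the estimate near zeros of [F]; hence [soft_min]. *)
Lemma ckn_sharp_lt1 (k b : nat -> R) : r < 1 -> (forall t, 1 <= t -> F t = 0) ->
  k j @[j --> \oo] --> (1 : R) -> b j @[j --> \oo] --> 0 ->
  (forall j, 0 <= k j) -> (forall j, 0 <= b j) ->
  (forall j t, 0 < F t -> Num.min (F t) (M j) `^ e0 <= k j * F t `^ e0 + b j) ->
  sharp.
Proof.
move=> r_lt1 Fzero k_cvg b_cvg k0 b0 kbP.
split; first exact: ckn_class_ineq.
pose q j := expR (- (d j / M j)) `^ e0.
have q_cvg : q j @[j --> \oo] --> (1 : R).
  have -> : q = fun j => expR (- (d j / M j) * e0) by apply/funext => j; rewrite /q -expRM.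
  rewrite -(@expR0 R); apply: (@continuous_cvg _ _ _ _ _ _ (@expR R)).
    exact: continuous_expR.
  have dM_cvg := cvg_div_nondecreasing d0 M0 dM (@cvg_harmonic R).
  by rewrite -[X in _ --> X](mul0r e0); apply: cvgMl; rewrite -[X in _ --> X]oppr0; exact: cvgN.
(* [F] vanishes from radius 1 on, so the additive error [b j] is incurred on the unit ball only. *)
pose B := fine (\int[mu]_x (\1_[set x : 'rV[R]_n | (enorm x < 1)%R] x / enorm x `^ beta)%:E)%E.
move=> C' C'P; refine (@ckn_constant_optimal R n p r alpha beta gamma n0 p1 r0 r1 gammaE m0 a L C F
  a0 FP F0 cF d M (fun j => soft_min (d j) (M j)) d0 M0 dd dM (@cvg_harmonic R) M_cvg M_near
  (fun j => cutoff_soft_min (d0 j) (M0 j)) _ (fun j => q j * k j) (fun j => q j * b j * B) _ _ _ C' C'P).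
- move=> j; rewrite /ckn_class r_lt1.
  have [delta delta0 FM] := delta_near j.
  have FB t : 0 < t -> 1 < t -> F t = 0 by move=> _ t1; rewrite Fzero// ltW.
  exact: (approximant_weak_test_fun delta0 (fun t _ => F0 t) cF FM sF
    (cutoff_soft_min (d0 j) (M0 j)) FB).
- by rewrite -[X in _ --> X]mul1r; exact: cvgM.
- by rewrite -[X in _ --> X](mul0r B); apply: cvgMl; rewrite -[X in _ --> X](mul1r 0); exact: cvgM.
- move=> j; have cN := cutoff_soft_min (d0 j) (M0 j).
  have q0 : 0 <= q j by exact: powR_ge0.
  have qk0 : (0 <= (q j * k j)%:E)%E by rewrite lee_fin mulr_ge0.
  have qb0 : (0 <= (q j * b j)%:E)%E by rewrite lee_fin mulr_ge0.
  pose I : 'rV[R]_n -> R := \1_[set x : 'rV[R]_n | (enorm x < 1)%R].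
  have mI : measurable_fun setT (fun x : 'rV[R]_n => (I x / enorm x `^ beta)%:E).
    apply/measurable_EFinP; apply: measurable_div_enorm.
    by apply: measurable_indic; apply: open_measurable_rV; exact: open_enorm_lt.
  have I0 x : (0 <= (I x / enorm x `^ beta)%:E)%E.
    by rewrite lee_fin divr_ge0 ?powR_ge0.
  have f0 x : (0 <= (`|f x| `^ e0 / enorm x `^ beta)%:E)%E.
    by rewrite lee_fin divr_ge0 ?powR_ge0.
  have -> : ((q j * b j * B)%:E = (q j * b j)%:E * \int[mu]_x (I x / enorm x `^ beta)%:E)%E.
    rewrite EFinM /B fineK// ge0_fin_numE ?ball_weight_fin//.
    exact: integral_ge0.
  rewrite /ckn_pot -[in leRHS]ge0_integralZl//; last by move=> x _; exact: f0.
  rewrite -[in leRHS]ge0_integralZl//.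
  rewrite -ge0_integralD//; last 4 first.
  + by move=> x _; apply: mule_ge0; [exact: qk0|exact: f0].
  + exact: measurable_funeM.
  + by move=> x _; apply: mule_ge0; [exact: qb0|exact: I0].
  + exact: measurable_funeM.
  apply: ae_le_integral_measurabler.
  + by apply: emeasurable_funD; exact: measurable_funeM.
  + by move=> x; rewrite lee_fin divr_ge0 ?powR_ge0.
  + by move=> x; apply: adde_ge0; apply: mule_ge0; [exact: qk0|exact: f0|exact: qb0|exact: I0].
  apply: ae_neq0 => x x0; rewrite -!EFinM -EFinD lee_fin !mulrA -mulrDl.
  rewrite ler_wpM2r ?invr_ge0 ?powR_ge0// approximant_neq0//.
  have e00 : e0 < 0.
    by rewrite /e0 -mulrA pmulr_rlt0// ltr_pdivrMr ?subr_gt0// mul0r subr_lt0.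
  have [Fx|Fx] := leP (F (enorm x)) 0.
    have -> : F (enorm x) = 0 by apply: le_anti; rewrite Fx F0.
    have N0 : soft_min (d j) (M j) 0 = 0.
      by apply: le_anti; rewrite (cutoff_ge0 cN (lexx _)) (cutoff_le cN (lexx _)).
    by rewrite N0 normr0 powR0 ?lt_eqF// addr_ge0 ?mulr_ge0 ?powR_ge0 ?k0 ?b0.
  have x1 : enorm x < 1.
    by rewrite ltNge; apply/negP => /Fzero x1; rewrite x1 ltxx in Fx.
  have -> : I x = 1 by rewrite /I indicE mem_set.
  have min0 : 0 < Num.min (F (enorm x)) (M j) by rewrite lt_min Fx M0.
  apply: (@le_trans _ _ (q j * Num.min (F (enorm x)) (M j) `^ e0)).
    rewrite /q -powRM ?expR_ge0 ?(ltW min0)// ger0_norm ?(cutoff_ge0 cN) ?F0//.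
    apply: gt0_ler_npowR; first exact: ltW.
      by rewrite mulr_gt0// expR_gt0.
    exact: soft_min_ge.
  rewrite mulr1 -(mulrA (q j) (k j)) -mulrDr ler_wpM2l// ger0_norm ?F0//; exact: kbP.
Qed.

End sharpness.

Lemma near_right0 (R : realType) (delta : R) (P : R -> Prop) : 0 < delta ->
  (forall t, 0 < t < delta -> P t) -> \forall t \near 0^'+, P t.
Proof.
move=> delta0 PP; near=> t; apply: PP; apply/andP; split; near: t.
  exact: nbhs_right_gt.
exact: nbhs_right_lt.
Unshelve. all: by end_near. Qed.

Lemma decay_bounded_continuous (R : realType) (p r s m a L C k : R) (G : R -> R) :
  decay_bounded p r s m a L C k G -> forall t, 0 < t -> {for t, continuous G}.
Proof.
move=> [L0 k0 G0 GL dG GL0 GC] t t0.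
have [tL|tL|->] := ltgtP t L.
- by apply: is_derive_continuous (dG t _); rewrite t0.
- apply: (@is_derive_continuous _ _ 0).
  apply: (@near_eq_is_derive _ _ _ (fun=> 0)).
  by near=> u; rewrite GL//; apply/ltW; near: u; exact: lt_nbhsr.
- apply/left_right_continuousP; rewrite GL//; split=> //.
  have E : \forall u \near L^'+, cst 0 u = G u.
    by near=> u; rewrite GL//; apply/ltW; near: u; exact: nbhs_right_gt.
  by apply: cvg_trans (near_eq_cvg E) _; exact: cvg_cst.
Unshelve. all: by end_near. Qed.

Section sharp_profiles.
Context (R : realType) (n : nat).
Variables (p r alpha beta gamma : R).
Hypothesis n0 : (0 < n)%N.
Hypothesis p1 : 1 < p.
Hypothesis r0 : 0 < r.
Hypothesis r1 : r != 1.
Hypothesis gammaE : gamma * r = 1 + alpha + (p - 1) / p * beta.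
Hypothesis m0 : 0 < n%:R - gamma * r.
Hypothesis nb : 0 < n%:R - beta.
Let m := n%:R - gamma * r.
Let s := 1 + alpha - beta / p.
Let e0 := p * (r - 1) / (p - 1).
Let K := r / (n%:R - gamma * r).
Local Notation sharp := (ckn_best_constant n p r alpha beta gamma K).

Section profile.
Variables (a L C : R) (F : R -> R).
Hypothesis a0 : 0 < a.
Hypothesis FP : radial_profile p r s m a L C F.
Hypothesis F0 : forall t, 0 <= F t.
Hypothesis cF : forall t, 0 < t -> {for t, continuous F}.
Hypothesis sF : forall U : set 'rV[R]_n,
  (forall x, U x -> x != 0 /\ 0 < F (enorm x)) ->
  exists2 f, smooth_expr U f & forall x, U x -> f x = F (enorm x).
Hypothesis Ffar : forall e, 0 < e -> exists B, forall t, 0 < t -> B < t -> F t <= e.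
Hypothesis Fzero : r < 1 -> forall t, 1 <= t -> F t = 0.

Let e00 : r < 1 -> e0 < 0.
Proof.
move=> rl; rewrite /e0 -mulrA pmulr_rlt0 ?(lt_trans ltr01 p1)//.
by rewrite ltr_pdivrMr ?subr_gt0// mul0r subr_lt0.
Qed.

(** For profiles tending to 1 at the origin the levels [M j] increase to 1. As [F] and [M j] are at
    most 1, their minimum is at least their product, so for r < 1 the potential loses only the
    factor M_j^e0, which tends to 1. *)
Lemma ckn_sharp_bounded : (forall t, F t <= 1) ->
  (forall u, 0 < u < 1 -> exists2 delta, 0 < delta & forall t, 0 < t < delta -> u <= F t) ->
  sharp.
Proof.
move=> F1 Fnear.
(* The shift by one avoids the level 0: [harmonic 0] is 1. *)
pose M j : R := 1 - harmonic j.+1.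
have h0 j : 0 < (@harmonic R) j by rewrite /harmonic invr_gt0.
have h1 j : (@harmonic R) j.+1 < 1 by rewrite /harmonic invf_lt1// ltr1n.
have M0 j : 0 < M j by rewrite subr_gt0.
have M1 j : M j <= 1 by rewrite gerBl ltW.
have dM : nondecreasing_seq M.
  by move=> i j ij; rewrite lerB// /harmonic lef_pV2 ?posrE// ler_nat.
have hS : (@harmonic R) j.+1 @[j --> \oo] --> 0.
  by have := @cvg_harmonic R; rewrite -(@cvg_shiftS _ (@harmonic R)).
have M_lim : M j @[j --> \oo] --> (1 : R).
  by rewrite -[X in _ --> X]subr0; apply: cvgB => //; exact: cvg_cst.
have M_cvg t : Num.min (F t) (M j) @[j --> \oo] --> F t.
  apply: (@squeeze_cvgr _ _ _ _ (fun j => F t * M j) (fun=> F t)).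
  - apply: nearW => j; rewrite le_min ge_min lexx/= andbT.
    by rewrite ler_piMr ?F0 ?M1//= ler_piMl ?F1 ?ltW.
  - by rewrite -[X in _ --> X]mulr1; apply: cvgMr.
  - exact: cvg_cst.
have M_near j : \forall t \near 0^'+, M j <= F t.
  have [|delta delta0 FM] := Fnear (M j); first by rewrite M0 gtrBl h0.
  exact: near_right0 delta0 FM.
case: (ltP r 1) => [rl|]; last first.
  rewrite le_eqVlt eq_sym (negbTE r1)/= => rg.
  exact: (ckn_sharp_gt1 n0 p1 r0 r1 gammaE m0 a0 FP F0 cF sF M0 dM M_cvg M_near rg Ffar).
apply: (ckn_sharp_lt1 n0 p1 r0 r1 gammaE m0 a0 FP F0 cF sF M0 dM M_cvg M_near nb
  (k := fun j => M j `^ e0) (b := fun=> 0) rl (Fzero rl)).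
- have <- : (1 : R) `^ e0 = 1 by rewrite powR1.
  apply: (@continuous_cvg _ _ _ _ _ _ (fun z => z `^ e0)) => //.
  exact: continuous_powR_gt0.
- exact: cvg_cst.
- by move=> j; exact: powR_ge0.
- by [].
- move=> j t Ft; rewrite addr0 -powRM ?(ltW (M0 j)) ?F0//.
  apply: gt0_ler_npowR; [exact/ltW/e00|by rewrite mulr_gt0|].
  by rewrite le_min ler_piMl ?F0 ?M1//= ler_piMr ?F1 ?ltW.
Qed.

(** For profiles blowing up at the origin the levels tend to infinity. For r < 1, min(F, M)^e0 is
    one of F^e0 and M^e0, hence at most their sum, and M_j^e0 tends to 0. *)
Lemma ckn_sharp_unbounded :
  (forall u, 0 < u -> exists2 delta, 0 < delta & forall t, 0 < t < delta -> u <= F t) ->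
  sharp.
Proof.
move=> Fnear.
pose M j : R := j.+1%:R.
have M0 j : 0 < M j by rewrite ltr0n.
have dM : nondecreasing_seq M by move=> i j ij; rewrite ler_nat.
have M_cvg t : Num.min (F t) (M j) @[j --> \oo] --> F t.
  have E : \forall j \near \oo, cst (F t) j = Num.min (F t) (M j); last first.
    by apply: cvg_trans (near_eq_cvg E) _; exact: cvg_cst.
  exists (Num.truncn (F t)) => // j /= Fj; rewrite min_l//.
  by apply: le_trans (ltW (truncnS_gt (F t))) _; rewrite ler_nat.
have M_near j : \forall t \near 0^'+, M j <= F t.
  by have [delta delta0 FM] := Fnear (M j) (M0 j); exact: near_right0 delta0 FM.
case: (ltP r 1) => [rl|]; last first.
  rewrite le_eqVlt eq_sym (negbTE r1)/= => rg.
  exact: (ckn_sharp_gt1 n0 p1 r0 r1 gammaE m0 a0 FP F0 cF sF M0 dM M_cvg M_near rg Ffar).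
apply: (ckn_sharp_lt1 n0 p1 r0 r1 gammaE m0 a0 FP F0 cF sF M0 dM M_cvg M_near nb
  (k := fun=> 1) (b := fun j => M j `^ e0) rl (Fzero rl)).
- exact: cvg_cst.
- rewrite (_ : (fun j => _) = fun j => (1 / (j + 1)%:R) `^ (- e0)).
    by apply: cvg_invS_powR => //; rewrite oppr_gt0 e00.
  apply/funext => j.
  by rewrite addn1 mul1r -powR_inv1// -powRrM mulN1r opprK.
- by [].
- by move=> j; exact: powR_ge0.
- move=> j t Ft; rewrite mul1r /Num.min; case: ifP => _.
    by rewrite lerDl powR_ge0.
  by rewrite lerDr powR_ge0.
Qed.

End profile.

End sharp_profiles.

(** * Sharpness in the five cases *)

Section sharp_cases.
Context (R : realType) (n : nat).
Variables (p r alpha beta gamma : R).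
Hypothesis n0 : (0 < n)%N.
Hypothesis p1 : 1 < p.
Hypothesis r0 : 0 < r.
Hypothesis r1 : r != 1.
Hypothesis gammaE : gamma * r = 1 + alpha + (p - 1) / p * beta.
Hypothesis m0 : 0 < n%:R - gamma * r.
Hypothesis nb : 0 < n%:R - beta.
Let m := n%:R - gamma * r.
Let s := 1 + alpha - beta / p.
Let theta := (p - 1) / (p - r).
Let K := r / (n%:R - gamma * r).
Local Notation sharp := (ckn_best_constant n p r alpha beta gamma K).

Let powRVK (k u : R) : k != 0 -> 0 < u -> (u `^ k^-1) `^ k = u.
Proof. by move=> k0 u0; rewrite -powRrM mulVf// powRr1// ltW. Qed.

Let smooth_enorm_powR (U : set 'rV[R]_n) k : (forall x, U x -> x != 0) ->
  smooth_expr U (fun x => enorm x `^ k).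
Proof.
move=> U0; apply: smooth_powR; first by apply: smooth_enorm => /U0; rewrite eqxx.
by move=> x /U0; rewrite enorm_gt0.
Qed.

Let smooth_truncated (q : R -> R) (U : set 'rV[R]_n) : 0 < theta ->
  ((forall x, U x -> x != 0) -> smooth_expr U (fun x => q (enorm x))) ->
  (forall x, U x -> x != 0 /\ 0 < Num.max (q (enorm x)) 0 `^ theta) ->
  exists2 f, smooth_expr U f & forall x, U x -> f x = Num.max (q (enorm x)) 0 `^ theta.
Proof.
move=> theta0 sq UP.
have q0 x : U x -> 0 < q (enorm x).
  move=> /UP[_]; apply: contraTT; rewrite -!leNgt => qx.
  by rewrite max_r// powR0// gt_eqF.
exists (fun x => q (enorm x) `^ theta).
  by apply: smooth_powR; [apply: sq => x /UP[]|exact: q0].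
by move=> x Ux; rewrite max_l// ltW// q0.
Qed.

Let far_zero (F : R -> R) : (forall t, 1 <= t -> F t = 0) ->
  forall e, 0 < e -> exists B, forall t, 0 < t -> B < t -> F t <= e.
Proof. by move=> F0 e e0; exists 1 => t _ t1; rewrite F0 ltW. Qed.

Let theta_gt0 : r < p -> 0 < theta.
Proof. by move=> rp; rewrite divr_gt0 ?subr_gt0. Qed.

Lemma sharp_i : p < r -> n%:R - beta < s * (p * (r - 1) / (r - p)) -> sharp.
Proof.
move=> pr nbs.
have s0 := exponent_gt0_i p1 pr nb nbs.
have k0 := exponent_lt0_i p1 gammaE pr nbs.
have theta0 : theta < 0 by rewrite pmulr_rlt0 ?subr_gt0// invr_lt0 subr_lt0.
have a0 : 0 < - (theta * s) by rewrite oppr_gt0 nmulr_rlt0.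
have FD := decay_family_i p1 r0 m0 pr s0 k0 ltr01.
have FP := decay_unbounded_profile p1 r0 m0 (ltW a0) ltr01 FD.
have q0 (t : R) : 0 < 1 + t `^ s by rewrite ltr_pwDl// powR_ge0.
apply: (ckn_sharp_bounded n0 p1 r0 r1 gammaE m0 nb a0 FP).
- by move=> t; exact: powR_ge0.
- by move=> t t0; exact: is_derive_continuous (decay_unbounded_derive FD t0).
- move=> U UP; exists (fun x => (1 + enorm x `^ s) `^ theta) => //.
  apply: smooth_powR; last by move=> x _; exact: q0.
  apply: smooth_add; first exact: smooth_cst.
  by apply: smooth_enorm_powR => x /UP[].
- move=> e e0; exists (e `^ (s * theta)^-1) => t t0 et.
  rewrite -[leRHS](powRVK (k := s * theta))//; last by rewrite lt_eqF// nmulr_llt0.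
  apply: (@le_trans _ _ (t `^ (s * theta))).
    rewrite (powRrM t); apply: gt0_ler_npowR; rewrite ?powR_gt0 ?(ltW theta0)//.
    by rewrite lerDr.
  apply: gt0_ler_npowR; rewrite ?powR_gt0 ?(ltW et)//.
  by rewrite ltW// pmulr_rlt0.
- by move=> rl; have := lt_trans pr (lt_trans rl p1); rewrite ltxx.
- move=> t; rewrite -[leRHS](_ : 1 `^ theta = 1); last by rewrite powR1.
  by apply: gt0_ler_npowR; rewrite ?(ltW theta0)// lerDl powR_ge0.
- move=> u /andP[u0 u1].
  have v0 : 0 < u `^ theta^-1 - 1.
    rewrite subr_gt0 ltNge; apply/negP => v1.
    have := gt0_ler_npowR (ltW theta0) (powR_gt0 _ u0) v1.
    by rewrite (powRVK (k := theta)) ?lt_eqF// powR1 leNgt u1.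
  exists ((u `^ theta^-1 - 1) `^ s^-1); first by rewrite powR_gt0.
  move=> t /andP[t0 tu]; rewrite -[leLHS](powRVK (k := theta))//; last by rewrite lt_eqF.
  apply: gt0_ler_npowR; rewrite ?(ltW theta0)//.
  by rewrite -lerBrDl ltW// powR_lt_gt0.
Qed.

Lemma sharp_ii : r < p -> 0 < s -> sharp.
Proof.
move=> rp s0; have theta0 := theta_gt0 rp.
have a0 : 0 < theta * s by rewrite mulr_gt0.
have FD := decay_family_ii p1 r0 m0 rp s0 ltr01.
have FP := decay_bounded_profile p1 r0 r1 m0 (ltW a0) FD.
have F1 t : 1 <= t -> Num.max (1 - t `^ s) 0 `^ theta = 0.
  by move=> t1; apply: (decay_bounded_eq0 FD); rewrite powR1.
apply: (ckn_sharp_bounded n0 p1 r0 r1 gammaE m0 nb a0 FP).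
- by move=> t; exact: powR_ge0.
- exact: decay_bounded_continuous FD.
- move=> U; apply: (smooth_truncated (q := fun t => 1 - t `^ s) theta0) => U0.
  by apply: smooth_sub; [exact: smooth_cst|exact: smooth_enorm_powR].
- exact: far_zero.
- by [].
- move=> t; rewrite -[leRHS](_ : 1 `^ theta = 1); last by rewrite powR1.
  rewrite ge0_ler_powR ?nnegrE ?(ltW theta0)// ?le_max ?lexx ?orbT//.
  by rewrite ge_max ler01 gerBl powR_ge0.
- move=> u /andP[u0 u1].
  have v0 : 0 < 1 - u `^ theta^-1.
    rewrite subr_gt0 -[ltRHS](_ : 1 `^ theta^-1 = 1); last by rewrite powR1.
    by rewrite gt0_ltr_powR ?nnegrE ?ler01 ?(ltW u0) ?invr_gt0.
  exists ((1 - u `^ theta^-1) `^ s^-1); first by rewrite powR_gt0.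
  move=> t /andP[t0 tu]; rewrite -[leLHS](powRVK (k := theta))//; last by rewrite gt_eqF.
  rewrite ge0_ler_powR ?nnegrE ?(ltW theta0) ?powR_ge0// ?le_max ?lexx ?orbT//.
  by rewrite lerBrDl -lerBrDr ltW// powR_lt_gt0.
Qed.

Lemma sharp_iii : r < p -> s = 0 -> sharp.
Proof.
move=> rp s0; have theta0 := theta_gt0 rp.
(* Here lambda = 0, so that the support radius exp(lambda) is 1, as lambda = 1 achieves in (ii) and
   (iv). *)
have FD := decay_family_iii p1 r0 m0 0 rp s0.
have FP := decay_bounded_profile p1 r0 r1 m0 (ltW theta0) FD.
have F1 t : 1 <= t -> Num.max (0 - ln t) 0 `^ theta = 0.
  by move=> t1; apply: (decay_bounded_eq0 FD); rewrite expR0.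
apply: (ckn_sharp_unbounded n0 p1 r0 r1 gammaE m0 nb theta0 FP).
- by move=> t; exact: powR_ge0.
- exact: decay_bounded_continuous FD.
- move=> U; apply: (smooth_truncated (q := fun t => 0 - ln t) theta0) => U0.
  apply: smooth_sub; first exact: smooth_cst.
  apply: smooth_ln; first by apply: smooth_enorm => /U0; rewrite eqxx.
  by move=> x /U0; rewrite enorm_gt0.
- exact: far_zero.
- by [].
- move=> u u0; exists (expR (- (u `^ theta^-1))); first exact: expR_gt0.
  move=> t /andP[t0 tu]; rewrite -[leLHS](powRVK (k := theta))//; last by rewrite gt_eqF.
  rewrite ge0_ler_powR ?nnegrE ?(ltW theta0) ?powR_ge0// ?le_max ?lexx ?orbT//.
  by rewrite sub0r lerNr -(expRK (- _)) ler_ln ?posrE ?expR_gt0// ltW.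
Qed.

Lemma sharp_iv : r < p -> s < 0 -> 0 < n%:R - beta + s * (p * (r - 1) / (p - r)) -> sharp.
Proof.
move=> rp s0 nbs; have theta0 := theta_gt0 rp.
have k0 := exponent_gt0_iv p1 gammaE rp nbs.
have a0 : 0 < - (theta * s) by rewrite oppr_gt0 pmulr_rlt0.
have FD := decay_family_iv p1 r0 rp s0 k0 ltr01.
have FP := decay_bounded_profile p1 r0 r1 m0 (ltW a0) FD.
have F1 t : 1 <= t -> Num.max (t `^ s - 1) 0 `^ theta = 0.
  by move=> t1; apply: (decay_bounded_eq0 FD); rewrite powR1.
apply: (ckn_sharp_unbounded n0 p1 r0 r1 gammaE m0 nb a0 FP).
- by move=> t; exact: powR_ge0.
- exact: decay_bounded_continuous FD.
- move=> U; apply: (smooth_truncated (q := fun t => t `^ s - 1) theta0) => U0.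
  by apply: smooth_sub; [exact: smooth_enorm_powR|exact: smooth_cst].
- exact: far_zero.
- by [].
- move=> u u0; have v0 : 0 < 1 + u `^ theta^-1 by rewrite ltr_pwDl// powR_ge0.
  exists ((1 + u `^ theta^-1) `^ s^-1); first by rewrite powR_gt0.
  move=> t /andP[t0 tu]; rewrite -[leLHS](powRVK (k := theta))//; last by rewrite gt_eqF.
  rewrite ge0_ler_powR ?nnegrE ?(ltW theta0) ?powR_ge0// ?le_max ?lexx ?orbT//.
  by rewrite lerBrDl ltW// powR_gt_lt0.
Qed.

Lemma sharp_v : r = p -> 0 < s -> sharp.
Proof.
move=> rp s0; have a0 : 0 < 1 * s by rewrite mul1r.
have FD := decay_family_v p1 r0 m0 rp s0 ltr01.
have FP := decay_unbounded_profile p1 r0 m0 (ltW a0) ltr01 FD.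
apply: (ckn_sharp_bounded n0 p1 r0 r1 gammaE m0 nb a0 FP).
- by move=> t; exact: expR_ge0.
- by move=> t t0; exact: is_derive_continuous (decay_unbounded_derive FD t0).
- move=> U UP; exists (fun x => expR (- 1 * enorm x `^ s)) => //.
  apply: smooth_expR; apply: smooth_mul; first exact: smooth_cst.
  by apply: smooth_enorm_powR => x /UP[].
- move=> e e0; exists ((e^-1) `^ s^-1) => t t0 et.
  rewrite mulN1r expRN -[leRHS]invrK lef_pV2 ?posrE ?expR_gt0 ?invr_gt0//.
  apply: le_trans (expR_ge1Dx _); rewrite -lerBlDl lerBlDr.
  apply: (@le_trans _ _ (t `^ s)); last by rewrite lerDl.
  rewrite leNgt powR_lt_gt0 ?invr_gt0// -leNgt; exact: ltW.
- by move=> rl; have := lt_trans rl p1; rewrite rp ltxx.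
- by move=> t; rewrite expR_le1 mulN1r oppr_le0 powR_ge0.
- move=> u /andP[u0 u1]; have v0 : 0 < - ln u by rewrite oppr_gt0 ln_lt0// u0.
  exists ((- ln u) `^ s^-1); first by rewrite powR_gt0.
  move=> t /andP[t0 tu]; rewrite -{1}(lnK u0) ler_expR mulN1r lerNr ltW//.
  by rewrite powR_lt_gt0.
Qed.

End sharp_cases.

Theorem theorem1p1 (R : realType) (n : nat) (p r alpha beta gamma : R) :
  (2 <= n)%N -> 1 < p -> 0 < r ->
  0 < 1 / r - gamma / n%:R ->
  0 < 1 / p - alpha / n%:R ->
  0 < 1 - beta / n%:R ->
  gamma = (1 + alpha) / r + (p - 1) / (p * r) * beta ->
  let K := r / (n%:R - gamma * r) in
  let s := 1 + alpha - beta / p in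
  let theta := (p - 1) / (p - r) in
  let e := p * (r - 1) / (p - r) + (n%:R - beta) / s in
  let sphere := @usphere R n in
  let sigma := @surface_measure R n in
  let sharp := @ckn_best_constant R n p r alpha beta gamma K in
  let extremal := @ckn_extremal R n p r alpha beta gamma K in
  (* (a) *)
  (1 < r -> forall f : 'rV[R]_n -> R, test_fun f ->
    ckn_ineq p r alpha beta gamma setT K f) /\
  (* (b) *)
  (r < 1 -> forall f : 'rV[R]_n -> R, test_fun f ->
    ckn_ineq p r alpha beta gamma (supp f) K f) /\
  (* (i) *)
  (p < r -> n%:R - beta < s * (p * (r - 1) / (r - p)) ->
    sharp /\
    forall (c : R) (lambda : 'rV[R]_n -> R),
      measurable_fun sphere lambda ->
      (forall w, sphere w -> 0 < lambda w) ->
      (\int[sigma]_(w in sphere) (lambda w `^ e)%:E < +oo)%E ->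
      extremal (fun x => c * (lambda (dir x) + enorm x `^ s) `^ theta)) /\
  (* (ii) *)
  (r < p -> r != 1 -> 0 < s ->
    sharp /\
    forall (c : R) (lambda : 'rV[R]_n -> R),
      measurable_fun sphere lambda ->
      (forall w, sphere w -> 0 < lambda w) ->
      (\int[sigma]_(w in sphere) (lambda w `^ e)%:E < +oo)%E ->
      extremal (fun x =>
        c * Num.max (lambda (dir x) - enorm x `^ s) 0 `^ theta)) /\
  (* (iii) *)
  (r < p -> r != 1 -> s = 0 ->
    sharp /\
    forall (c : R) (lambda : 'rV[R]_n -> R),
      measurable_fun sphere lambda ->
      (\int[sigma]_(w in sphere) (expR ((n%:R - beta) * lambda w))%:E < +oo)%E ->
      extremal (fun x =>
        c * Num.max (lambda (dir x) - ln (enorm x)) 0 `^ theta)) /\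
  (* (iv) *)
  (r < p -> r != 1 -> s < 0 -> 0 < n%:R - beta + s * (p * (r - 1) / (p - r)) ->
    sharp /\
    forall (c : R) (lambda : 'rV[R]_n -> R),
      measurable_fun sphere lambda ->
      (forall w, sphere w -> 0 < lambda w) ->
      (\int[sigma]_(w in sphere) (lambda w `^ e)%:E < +oo)%E ->
      extremal (fun x =>
        c * Num.max (enorm x `^ s - lambda (dir x)) 0 `^ theta)) /\
  (* (v) *)
  (r = p -> 0 < s ->
    sharp /\
    forall (c : R) (lambda : 'rV[R]_n -> R),
      0 < c ->
      measurable_fun sphere lambda ->
      (\int[sigma]_(w in sphere) (`|lambda w| `^ p)%:E < +oo)%E ->
      extremal (fun x => lambda (dir x) * expR (- c * enorm x `^ s))).
Proof.
move=> n2 p1 r0 rg _ nbeta gammaE K s theta e sphere sigma sharp extremal.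
have n0 : (0 < n)%N by exact: ltn_trans n2.
have n_gt0 : 0 < n%:R :> R by rewrite ltr0n.
have p0 : 0 < p by exact: lt_trans p1.
have gammaE' : gamma * r = 1 + alpha + (p - 1) / p * beta.
  by rewrite gammaE; field; rewrite !gt_eqF.
(* The hypothesis 1/r - gamma/n > 0 multiplied by n r. *)
have m0 : 0 < n%:R - gamma * r.
  have := mulr_gt0 (mulr_gt0 n_gt0 r0) rg.
  by congr (_ < _); field; rewrite !gt_eqF.
have nb : 0 < n%:R - beta.
  by have := mulr_gt0 n_gt0 nbeta; congr (_ < _); field; rewrite gt_eqF.
have test_weak (f : 'rV[R]_n -> R) : test_fun f -> weak_test_fun f.
  move=> [sf kf]; split=> // [x|l x _]; last exact: sf.
  by have [] := sf [::] x Logic.I.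
split; [|split; [|split; [|split; [|split; [|split]]]]].
- move=> r1 f /test_weak wf.
  by apply: (ckn_ineq_weak n0 p1 r0 _ gammaE' m0 wf) => //; rewrite gt_eqF.
- move=> r1 f /test_weak wf.
  apply: (ckn_ineq_weak n0 p1 r0 _ gammaE' m0 wf); first by rewrite lt_eqF.
  exact: subset_closure.
- move=> pr nbs; have r1 : r != 1 by rewrite gt_eqF// (lt_trans p1).
  split; first exact: (sharp_i n0 p1 r0 r1 gammaE' m0 nb pr nbs).
  move=> c lambda ml l0 lfin.
  exact: (extremal_i n0 p1 r0 r1 gammaE' m0 c ml l0 lfin pr nbs nb).
- move=> rp r1 s0.
  split; first exact: (sharp_ii n0 p1 r0 r1 gammaE' m0 nb rp s0).
  move=> c lambda ml l0 lfin.
  exact: (extremal_ii n0 p1 r0 r1 gammaE' m0 c ml l0 lfin rp s0).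
- move=> rp r1 s0.
  split; first exact: (sharp_iii n0 p1 r0 r1 gammaE' m0 nb rp s0).
  move=> c lambda ml lfin.
  exact: (extremal_iii n0 p1 r0 r1 gammaE' m0 c ml lfin rp s0).
- move=> rp r1 s0 nbs.
  split; first exact: (sharp_iv n0 p1 r0 r1 gammaE' m0 nb rp s0 nbs).
  move=> c lambda ml l0 lfin.
  exact: (extremal_iv n0 p1 r0 r1 gammaE' m0 c ml l0 lfin rp s0 nbs).
- move=> rp s0; have r1 : r != 1 by rewrite rp gt_eqF.
  split; first exact: (sharp_v n0 p1 r0 r1 gammaE' m0 nb rp s0).
  move=> c lambda c0 ml lfin.
  exact: (extremal_v n0 p1 r0 r1 gammaE' m0 c0 ml lfin rp s0).
Qed.
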